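(* Let $A$ be a linear operator on a Hilbert space $H$. Assume that there exist a countable (not necessarily complete) orthonormal system $\{e_n\}_{n\in\mathbb{N}}$ in $H$ and an unbounded sequence $\{\lambda_n\}$ of positive real numbers such that $Ae_n=\lambda_n^2e_n$ for every $n\in\mathbb{N}$. Let $\delta>0$ and $\alpha\in(0,1]$ be real numbers, let $k\ge0$ be an integer, and let $\sigma$ be a real number with $$0\le\sigma<\frac{1}{2+k+\alpha}.$$ Then there exist a function $c:\mathbb{R}\to[0,+\infty)$ and a solution $u(t)$ (in the sense specified in the context) of the equation $$u''(t)+2\delta A^{\sigma}u'(t)+c(t)Au(t)=0\quad\text{in }[0,+\infty)$$ with the following three properties. (1) $c\in C^{k,\alpha}(\mathbb{R})\cap C^{\infty}(\mathbb{R}\setminus\{0\})$, and $0<c(t)\le1$ for every $t>0$. (2) For every $s>1+\frac{k+\alpha}{2}$, every $r>0$ and every $\beta\in\mathbb{R}$, $$(u(0),u'(0))\in\mathcal{G}_{s,r,\beta}(A)\times\mathcal{G}_{s,r,\beta}(A).$$ (3) For every $t>0$, every $S>1+\frac{k+\alpha}{2}$, every $R>0$ and every $\beta\in\mathbb{R}$, $$(u(t),u'(t))\notin\mathcal{G}_{-S,R,\beta}(A)\times\mathcal{G}_{-S,R,\beta}(A).$$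
   Context: $C^{k,\alpha}(\mathbb{R})$ is the space of functions that are $k$ times continuously differentiable and whose $k$-th derivative is $\alpha$-Hölder continuous on $\mathbb{R}$. Functional spaces. A generalized element $u$ is identified with the sequence $\{u_n\}$ of real numbers which are its components with respect to $\{e_n\}$, written formally $u=\sum_n u_ne_n$ (all elements considered have components only along the $e_n$'s; the series need not converge in $H$). On such elements $A^\sigma$ acts by $A^\sigma e_n=\lambda_n^{2\sigma}e_n$. For real $\beta$: - Gevrey spaces ($s>0$, $r>0$): $u\in\mathcal{G}_{s,r,\beta}(A)$ iff $\sum_{n}(1+\lambda_n)^{4\beta}u_n^2\exp(2r\lambda_n^{1/s})<+\infty$; - Gevrey ultradistributions ($S>0$, $R>0$): $u\in\mathcal{G}_{-S,R,\beta}(A)$ iff $\sum_{n}(1+\lambda_n)^{4\beta}u_n^2\exp(-2R\lambda_n^{1/S})<+\infty$. Notion of solution. $u(t)=\sum_n u_n(t)e_n$ is a solution if each component $u_n:[0,+\infty)\to\mathbb{R}$ solves $u_n''+2\delta\lambda_n^{2\sigma}u_n'+\lambda_n^2c(t)u_n=0$, and $u$ is the (very weak) ultradistributional solution: there is a nondecreasing function $R:[0,+\infty)\to(0,+\infty)$ such that $u\in C^0([0,\tau];\mathcal{G}_{-1,R(\tau),1/2}(A))\cap C^1([0,\tau];\mathcal{G}_{-1,R(\tau),0}(A))$ for every $\tau>0$; here $u'(t)=\sum_n u_n'(t)e_n$. It is known that such a solution exists and is unique for given initial data in $\mathcal{G}_{-1,R_0,1/2}(A)\times\mathcal{G}_{-1,R_0,0}(A)$,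 $R_0>0$. *)

(* Defs.v *)
From HB Require Import structures.
From mathcomp Require Import all_boot all_order all_algebra sesquilinear.
From mathcomp Require Import all_classical all_reals all_analysis.
Import Order.TTheory GRing.Theory Num.Theory.
Import numFieldNormedType.Exports.

Set Implicit Arguments.
Unset Strict Implicit.
Unset Printing Implicit Defensive.

Local Open Scope classical_set_scope.
Local Open Scope ring_scope.

(* Possibly unbounded operators: only the values of A on its domain D matter. *)
Definition linear_operator (R : realType) (H : lmodType R)
    (D : set H) (A : H -> H) : Prop :=
  D 0 /\
  forall (a : R) (x y : H), D x -> D y ->
    D (a *: x + y) /\ A (a *: x + y) = a *: A x + A y.

(* The norm of H is the one induced by the inner product; together with the
   completeness of H this makes (H, ip) a real Hilbert space. *)
Definition induces_norm (R : realType) (H : normedModType R)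
    (ip : {dot H for idfun}) : Prop :=
  forall x : H, ip x x = `|x| ^+ 2.

Definition orthonormal_system (R : realType) (H : lmodType R)
    (ip : {dot H for idfun}) (e : nat -> H) : Prop :=
  forall m n : nat, ip (e m) (e n) = (m == n)%:R.

Definition hoelder (R : realType) (alpha : R) (f : R -> R) : Prop :=
  exists L : R, forall x y : R, `|f x - f y| <= L * `|x - y| `^ alpha.

Definition Ck_hoelder (R : realType) (k : nat) (alpha : R) (f : R -> R) : Prop :=
  [/\ forall i : nat, (i < k)%N -> forall x : R, derivable (derive1n i f) x 1,
      continuous (derive1n k f)
    & hoelder alpha (derive1n k f)].

(* U is meant to be open, so that derive1n i f is the genuine i-th derivative
   on U whatever default values it takes elsewhere. *)
Definition smooth_on (R : realType) (U : set R) (f : R -> R) : Prop :=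
  forall (i : nat) (x : R), U x -> derivable (derive1n i f) x 1.

(* Derivative relative to D: one-sided at an end point of an interval D. *)
Definition has_deriv_within (R : realType) (D : set R)
    (f : R -> R) (t l : R) : Prop :=
  (f s - f t) / (s - t) @[s --> within D t^'] --> l.

(* A generalized element u = sum_n u_n e_n is represented by its sequence of
   components (u_n); since A e_n = lam_n^2 e_n, A^sigma acts by
   A^sigma e_n = lam_n^(2 sigma) e_n. *)
Definition op_power (R : realType) (lam : nat -> R) (sigma : R)
    (v : nat -> R) : nat -> R :=
  fun n => lam n `^ (2 * sigma) * v n.

Definition sqnorm (R : realType) (w v : nat -> R) : \bar R :=
  (\sum_(0 <= n <oo) (w n * v n ^+ 2)%:E)%E.

Definition weighted_l2 (R : realType) (w : nat -> R) : set (nat -> R) :=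
  [set v | (sqnorm w v < +oo)%E].

Definition gevrey_weight (R : realType) (lam : nat -> R) (s r beta : R)
    (n : nat) : R :=
  (1 + lam n) `^ (4 * beta) * expR (2 * r * lam n `^ (1 / s)).

Definition ultra_weight (R : realType) (lam : nat -> R) (S rho beta : R)
    (n : nat) : R :=
  (1 + lam n) `^ (4 * beta) * expR (- 2 * rho * lam n `^ (1 / S)).

Definition gevrey (R : realType) (lam : nat -> R) (s r beta : R) :=
  weighted_l2 (gevrey_weight lam s r beta).

Definition ultradistribution (R : realType) (lam : nat -> R) (S rho beta : R) :=
  weighted_l2 (ultra_weight lam S rho beta).

(* C^0(D; X) and C^1(D; X), where X is the weighted l^2 space of weight w with
   its Hilbert norm; limits are expressed through the square of that norm. *)
Definition C0_in (R : realType) (w : nat -> R) (D : set R)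
    (u : R -> nat -> R) : Prop :=
  forall t : R, D t ->
    weighted_l2 w (u t) /\
    sqnorm w (u s - u t) @[s --> within D (nbhs t)] --> 0%E.

Definition C1_in (R : realType) (w : nat -> R) (D : set R)
    (u du : R -> nat -> R) : Prop :=
  [/\ C0_in w D u,
      C0_in w D du
    & forall t : R, D t ->
        sqnorm w ((s - t)^-1 *: (u s - u t) - du t)
          @[s --> within D t^'] --> 0%E].

(* Componentwise: du is the time derivative of u, and
   u'' + 2 delta A^sigma u' + c(t) A u = 0 on [0, +oo[. *)
Definition solves_equation (R : realType) (lam : nat -> R) (delta sigma : R)
    (c : R -> R) (u du : R -> nat -> R) : Prop :=
  exists ddu : R -> nat -> R, forall (n : nat) (t : R), 0 <= t ->
    [/\ has_deriv_within `[0, +oo[ (fun s => u s n) t (du t n),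
        has_deriv_within `[0, +oo[ (fun s => du s n) t (ddu t n)
      & ddu t n + 2 * delta * op_power lam sigma (du t) n
          + c t * op_power lam 1 (u t) n = 0].

Definition ultradistributional_regularity (R : realType) (lam : nat -> R)
    (u du : R -> nat -> R) : Prop :=
  exists rho : R -> R,
    [/\ forall tau : R, 0 <= tau -> 0 < rho tau,
        forall tau1 tau2 : R, 0 <= tau1 -> tau1 <= tau2 -> rho tau1 <= rho tau2
      & forall tau : R, 0 < tau ->
          C0_in (ultra_weight lam 1 (rho tau) (1 / 2)) `[0, tau] u /\
          C1_in (ultra_weight lam 1 (rho tau) 0) `[0, tau] u du].

Definition is_solution (R : realType) (lam : nat -> R) (delta sigma : R)
    (c : R -> R) (u du : R -> nat -> R) : Prop :=
  solves_equation lam delta sigma c u du /\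
  ultradistributional_regularity lam u du.

(* Main.v *)
Require Import Defs.
From HB Require Import structures.
From mathcomp Require Import all_boot all_order all_algebra sesquilinear.
From mathcomp Require Import all_classical all_reals all_analysis.
From mathcomp Require Import ring lra zify.
Import Order.TTheory GRing.Theory Num.Theory.
Import numFieldNormedType.Exports.

Set Implicit Arguments.
Unset Strict Implicit.
Unset Printing Implicit Defensive.

Local Open Scope classical_set_scope.
Local Open Scope ring_scope.

(** The operator enters only through the eigenvalues: the components of a
    solution satisfy u_n'' + 2 d_n u_n' + lambda_n^2 c(t) u_n = 0 with
    d_n = delta lambda_n^(2 sigma), and all components are taken to be zero
    except those of a very sparse subsequence of eigenvalues L_j. Write
    mu = 2 / (2 + k + alpha) for the reciprocal of 1 + (k + alpha) / 2.

    Time is cut into adjacent blocks [a_j, 2 a_j] with a_j = 2^(-j-1). On the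
    first part of its block the coefficient rises smoothly from a plateau
    C_(j+1) to a plateau C_j; on the rest it ripples around C_j with frequency
    m_j = 2^(-j) L_j^mu and relative amplitude of order eps ([ripple], [cascade]). Choosing
    L_j^2 C_j = d_j^2 + m_j^2 makes the [j]-th component explicitly solvable
    there: B exp(phi - d_j s) sin(m_j s) / m_j, where s is the time elapsed since
    the start of the ripple and phi grows at the rate
    2 eps m_j sin^2(m_j s) ([resonant_mode], [growth_end]), hence by at
    least G_j - eps, where G_j = eps a_j m_j / 4. Such a ripple has a k-th derivative whose alpha-Hoelder
    constant is of order C_j m_j^(k + alpha), and the value of mu makes this at most
    of order 2^(-j) ([level_at_freq]): the sum of all blocks is of class
    C^(k, alpha), and it is smooth away from the time 0, where the blocks
    cluster ([coefficient_hoelder], [coefficient_smooth]).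

    Starting the [j]-th component at the ripple with velocity B = exp(- G_j / 2)
    makes it at least of order exp(G_j / 2 - d_j) at the end of the block. Before
    the block its energy changes little: on the rise the coefficient is
    nondecreasing, and earlier it is smaller than a constant times C_(j+1),
    negligible because L_(j+1) is huge ([mode_backward]). After the block only the slow
    ripples of the preceding indices act, and they cost a factor exp(- K t S_j),
    where S_j is the sum of m_i over i < j, negligible for the same reason ([mode_forward]).
    The damping costs factors exp(O(d_j)) at any fixed time, which are negligible compared
    with exp(G_j) exactly because 2 sigma < mu. Since G_j is larger than
    (j + 1) L_j^p for some p = p(j) that increases to mu ([good]), the data lie in
    every Gevrey space of order s with 1/s < mu, while at every t > 0 the
    components grow too fast for the ultradistributions of order S with
    1/S < mu ([gevrey_of_decay], [not_ultradistribution]).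

    That the components form a solution of order 1 rests on the crude energy
    bound exp(O(L_j (1 + t))) ([mode_energy_bounds]), which also controls the moduli
    of continuity in time ([mode_C1_bounds]). Since the coefficient on the remaining blocks
    is not explicit, each component is obtained from an existence theorem for
    linear equations, by summing Picard iterates ([linear_ode_exists]), and is
    identified with the explicit solution on its block by uniqueness
    ([mode_unique]). *)

(** * Calculus on the line *)

Lemma is_derive_addf (R : realType) (f g : R -> R) (x a b : R) :
  is_derive x 1 f a -> is_derive x 1 g b ->
  is_derive x 1 (fun y => f y + g y) (a + b).
Proof. move=> fa gb; exact: is_deriveD. Qed.

Lemma is_derive_subf (R : realType) (f g : R -> R) (x a b : R) :
  is_derive x 1 f a -> is_derive x 1 g b ->
  is_derive x 1 (fun y => f y - g y) (a - b).
Proof. move=> fa gb; exact: is_deriveB. Qed.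

Lemma is_derive_oppf (R : realType) (f : R -> R) (x a : R) :
  is_derive x 1 f a -> is_derive x 1 (fun y => - f y) (- a).
Proof. move=> fa; exact: is_deriveN. Qed.

Lemma is_derive_mulf (R : realType) (f g : R -> R) (x a b : R) :
  is_derive x 1 f a -> is_derive x 1 g b ->
  is_derive x 1 (fun y => f y * g y) (a * g x + f x * b).
Proof.
move=> fa gb; apply: is_derive_eq.
by rewrite addrC mulrC.
Qed.

Lemma is_derive_const (R : realType) (x c : R) : is_derive x 1 (fun=> c : R) 0.
Proof. exact: is_derive_cst. Qed.

Lemma is_derive_scalef (R : realType) (c : R) (f : R -> R) (x a : R) :
  is_derive x 1 f a -> is_derive x 1 (fun y => c * f y) (c * a).
Proof. move=> fa; exact: is_deriveZ. Qed.

Lemma is_derive_compf (R : realType) (f g : R -> R) (x a b : R) :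
  is_derive (g x) 1 f a -> is_derive x 1 g b ->
  is_derive x 1 (fun y => f (g y)) (a * b).
Proof. move=> fa gb; exact: is_derive1_comp. Qed.

Lemma is_derive_affine (R : realType) (p q x : R) :
  is_derive x 1 (fun y : R => p * (y - q)) p.
Proof.
apply: is_derive_eq (is_derive_scalef p (is_derive_subf (is_derive_id x 1) (is_derive_const x q))) _.
by rewrite subr0 mulr1.
Qed.


Lemma is_derive_powf (R : realType) (f : R -> R) (x a : R) n :
  is_derive x 1 f a ->
  is_derive x 1 (fun y => f y ^+ n) (n%:R * f x ^+ n.-1 * a).
Proof.
move=> fa; elim: n => [|n ih].
  rewrite !mul0r (_ : (fun y => _) = cst 1); first exact: is_derive_const.
  by apply/funext => y; rewrite expr0.
rewrite (_ : (fun y => f y ^+ n.+1) = fun y => f y * f y ^+ n).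
  apply: (is_derive_eq (is_derive_mulf fa ih)) => /=.
  by case: n {ih} => [|n] /=; [ring|rewrite -[n.+2]addn1 natrD exprS; ring].
by apply/funext => y; rewrite exprS.
Qed.

Lemma is_derive_continuous (R : realType) (f : R -> R) (x a : R) :
  is_derive x 1 f a -> {for x, continuous f}.
Proof.
move=> fa; apply: differentiable_continuous; apply/derivable1_diffP.
exact: ex_derive.
Qed.

Lemma is_derive_derive1 (R : realType) (f f' : R -> R) :
  (forall x : R, is_derive x 1 f (f' x)) -> derive1 f = f'.
Proof. by move=> ff'; apply/funext => x; rewrite derive1E derive_val. Qed.

Lemma is_derive_within_continuous (R : realType) (f f' : R -> R) (a b : R) :
  (forall x : R, a <= x <= b -> is_derive x 1 f (f' x)) ->
  {within `[a, b], continuous f}.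
Proof.
move=> ff'; apply: derivable_within_continuous => x; rewrite in_itv /= => xab.
have fx := ff' x xab; exact: ex_derive.
Qed.

Lemma is_derive_mean_value (R : realType) (f f' : R -> R) (a b : R) :
  a <= b -> (forall x : R, a <= x <= b -> is_derive x 1 f (f' x)) ->
  exists2 c, a <= c <= b & f b - f a = f' c * (b - a).
Proof.
move=> ab ff'.
have h (x : R) : x \in `]a, b[ -> is_derive x 1 f (f' x).
  by rewrite in_itv /= => /andP[ax xb]; apply: ff'; rewrite !ltW.
have [c cab ->] := MVT_segment ab h (is_derive_within_continuous ff').
by exists c => //; move: cab; rewrite in_itv.
Qed.

Lemma is_derive0_eq (R : realType) (f : R -> R) (a b : R) :
  a <= b -> (forall x : R, a <= x <= b -> is_derive x 1 f 0) -> f a = f b.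
Proof.
move=> ab f0; have [c _ /eqP] := is_derive_mean_value (f' := cst 0) ab f0.
by rewrite mul0r subr_eq0 => /eqP ->.
Qed.

Lemma is_derive_ge0_le (R : realType) (f f' : R -> R) (a b : R) :
  a <= b -> (forall x : R, a <= x <= b -> is_derive x 1 f (f' x)) ->
  (forall x, a <= x <= b -> 0 <= f' x) -> f a <= f b.
Proof.
move=> ab ff' f'0; have [c cab e] := is_derive_mean_value ab ff'.
by rewrite -subr_ge0 e mulr_ge0 ?subr_ge0 // f'0.
Qed.

Lemma is_derive_bound_dist (R : realType) (f f' : R -> R) (K a b : R) :
  (forall x, `|x - a| <= `|b - a| -> is_derive x 1 f (f' x)) ->
  (forall x, `|x - a| <= `|b - a| -> `|f' x| <= K) ->
  `|f b - f a| <= K * `|b - a|.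
Proof.
move=> ff' f'K; case: (leP a b) => ab.
  have inn x : a <= x <= b -> `|x - a| <= `|b - a|.
    by move=> /andP[? ?]; rewrite !ger0_norm ?subr_ge0 // lerD2r.
  have [c cab ->] := is_derive_mean_value ab (fun x xab => ff' x (inn x xab)).
  by rewrite normrM ler_wpM2r // f'K // inn.
have inn x : b <= x <= a -> `|x - a| <= `|b - a|.
  by move=> /andP[? ?]; rewrite distrC (distrC b) !ger0_norm; lra.
have [c cab e] := is_derive_mean_value (ltW ab) (fun x xab => ff' x (inn x xab)).
by rewrite distrC e normrM (distrC b) ler_wpM2r // f'K // inn.
Qed.

(** Gronwall's inequality, with the derivative bounded from below. *)
Lemma gronwall_ge (R : realType) (y y' : R -> R) (K a b : R) :
  a <= b -> (forall x, a <= x <= b -> is_derive x 1 y (y' x)) ->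
  (forall x, a <= x <= b -> - K * y x <= y' x) ->
  y a * expR (- K * (b - a)) <= y b.
Proof.
move=> ab yy' Ky.
pose z x := y x * expR (K * (x - a)).
have zz' x : a <= x <= b ->
    is_derive x 1 z (y' x * expR (K * (x - a)) + y x * (expR (K * (x - a)) * K)).
  move=> xab; apply: is_derive_mulf; first exact: yy'.
  by apply: is_derive_compf; exact: is_derive_affine.
have : z a <= z b.
  apply: (is_derive_ge0_le ab zz') => x xab.
  rewrite (_ : _ + _ = (y' x + K * y x) * expR (K * (x - a))); last by ring.
  rewrite mulr_ge0 ?expR_ge0 //.
  by have := Ky x xab; lra.
rewrite /z subrr mulr0 expR0 mulr1 mulNr expRN => le.
by rewrite ler_pdivrMr ?expR_gt0.
Qed.

(** Gronwall's inequality, with the derivative bounded from above. *)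
Lemma gronwall_le (R : realType) (y y' : R -> R) (K a b : R) :
  a <= b -> (forall x, a <= x <= b -> is_derive x 1 y (y' x)) ->
  (forall x, a <= x <= b -> y' x <= K * y x) ->
  y b <= y a * expR (K * (b - a)).
Proof.
move=> ab yy' Ky.
have := @gronwall_ge R (fun x => - y x) (fun x => - y' x) (- K) a b ab.
rewrite opprK mulNr lerN2; apply => x xab; first by apply: is_derive_oppf; exact: yy'.
by have := Ky x xab; rewrite mulrN lerN2.
Qed.

Lemma continuous_antiderivative (R : realType) (f : R -> R) (t0 : R) :
  continuous f ->
  exists F : R -> R, F t0 = 0 /\ forall x : R, is_derive x 1 F (f x).
Proof.
move=> cf.
pose mu := @lebesgue_measure R.
(* an antiderivative on each segment centred at t0 *)
pose G n (x : R) := (\int[mu]_(t in `[(t0 - n.+1%:R)%R, x]) f t)%R.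
have intf a b : mu.-integrable `[a, b] (EFin \o f).
  apply: continuous_compact_integrable; first exact: segment_compact.
  exact: continuous_subspaceT.
have dG n (x : R) : t0 - n.+1%:R < x -> is_derive x 1 (G n) (f x).
  move=> nx.
  have xx1 : x < x + 1 by rewrite ltrDl ltr01.
  have [d e] := @continuous_FTC1_closed R f (t0 - n.+1%:R) x (x + 1)
    xx1 (intf _ _) nx (cf x).
  by apply: DeriveDef => //; rewrite -derive1E.
have GG n m x : (n <= m)%N -> t0 - n%:R <= x ->
    G n x - G n t0 = G m x - G m t0.
  move=> nm nx.
  have nm1 : n.+1%:R <= m.+1%:R :> R by rewrite ler_nat.
  have n1 : n%:R + 1 = n.+1%:R :> R by rewrite natr1.
  have n0 : 0 <= n%:R :> R by [].
  have D y : t0 - n.+1%:R < y ->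
      is_derive y 1 (fun z => G n z - G m z) (f y - f y).
    move=> ny; apply: is_derive_subf; apply: dG => //.
    by apply: le_lt_trans ny; rewrite lerD2l lerN2.
  suff : G n x - G m x = G n t0 - G m t0 by lra.
  case: (lerP t0 x) => tx.
    apply/esym; apply: (@is_derive0_eq _ (fun z => G n z - G m z) _ _ tx).
    by move=> y /andP[ty _]; rewrite -[0](subrr (f y)); apply: D; lra.
  apply: (@is_derive0_eq _ (fun z => G n z - G m z) _ _ (ltW tx)).
  by move=> y /andP[ty _]; rewrite -[0](subrr (f y)); apply: D; lra.
pose N x := Num.truncn `|x - t0|.
pose F x := G (N x).+1 x - G (N x).+1 t0.
exists F; split; first by rewrite /F subrr.
move=> x.
pose M := (N x).+2.
have NM y : `|y - x| < 1 -> F y = G M y - G M t0.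
  move=> yx; rewrite /F; apply: GG.
        rewrite /M ltnS truncn_le_nat -[X in _ < X]natr1.
    have := @truncnS_gt R `|x - t0|; rewrite -/(N x).
    have : `|y - t0| <= `|y - x| + `|x - t0|.
      by rewrite (le_trans _ (ler_normD _ _)) // addrA subrK.
    by lra.
  have := @truncnS_gt R `|y - t0|; rewrite -/(N y).
  have : - (y - t0) <= `|y - t0| by rewrite -normrN ler_norm.
  by lra.
have nearM : \near x, G M x - G M t0 = F x.
  apply: (filterS _ (@nbhsx_ballx R R x 1 ltr01)) => y.
  by rewrite /ball /= distrC => /NM.
apply: (near_eq_is_derive nearM).
rewrite -[f x]subr0; apply: is_derive_subf (is_derive_const _ _).
apply: dG.
have := @truncnS_gt R `|x - t0|; rewrite -/(N x).
have : - (x - t0) <= `|x - t0| by rewrite -normrN ler_norm.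
have : (N x).+1%:R <= M.+1%:R :> R by rewrite ler_nat /M; lia.
by lra.
Qed.

(** * Series dominated by a geometric series *)

Lemma is_derive_epsP (R : realType) (f : R -> R) (x l : R) :
  is_derive x 1 f l <->
  forall e, 0 < e -> exists2 d, 0 < d & forall y, `|y - x| < d ->
    `|f y - f x - (y - x) * l| <= e * `|y - x|.
Proof.
pose q (h : R) := h^-1 *: ((f \o shift x) (h *: 1) - f x).
have qE h : h != 0 -> q h - l = h^-1 * (f (x + h) - f x - h * l).
  by move=> h0; rewrite /q /= /GRing.scale /= mulr1 (addrC h); field.
split=> [fl e e0|H].
  have : q h @[h --> 0^'] --> l.
    have -> : l = 'D_1 f x by rewrite derive_val.
    by have : derivable f x 1 by exact: ex_derive.
  move/cvgrPdist_le => /(_ e e0) [d /= d0 hd].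
  exists d => // y yd.
  have [->|yx] := eqVneq y x; first by rewrite !subrr mul0r subr0 normr0 mulr0.
  have yx0 : y - x != 0 by rewrite subr_eq0.
  have := hd (y - x); rewrite /= sub0r normrN => /(_ yd yx0).
  rewrite distrC qE // (addrC x) subrK normrM normfV => le.
  by rewrite (mulrC e) -ler_pdivrMl ?normr_gt0.
have ql : q h @[h --> 0^'] --> l.
  apply/cvgrPdist_le => e e0; have [d d0 hd] := H e e0.
  exists d => //= h /=; rewrite sub0r normrN => hlt h0.
  rewrite distrC qE // normrM normfV ler_pdivrMl ?normr_gt0 // (mulrC _ e).
  by have := hd (x + h); rewrite (addrC x) addrK => /(_ hlt).
apply: DeriveDef; first by apply/cvg_ex; exists l.
exact: cvg_lim ql.
Qed.

Lemma has_deriv_within_of_is_derive (R : realType) (D : set R) (f : R -> R) (t l : R) :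
  is_derive t 1 f l -> has_deriv_within D f t l.
Proof.
move/is_derive_epsP => H; apply/cvgrPdist_le => e e0; have [d d0 hd] := H e e0.
exists d => //= s /=; rewrite distrC => sd st _.
have st0 : s - t != 0 by rewrite subr_eq0.
have -> : l - (f s - f t) / (s - t) = - ((s - t)^-1 * (f s - f t - (s - t) * l)).
  by field.
by rewrite normrN normrM normfV ler_pdivrMl ?normr_gt0 // (mulrC _ e) hd.
Qed.

Section geometric_bounds.
Context (R : realType) (a : nat -> R) (M : R).
Hypothesis aM : forall n, `|a n| <= M / 2 ^+ n.

Lemma geometric_bound_ge0 : 0 <= M.
Proof. by have := le_trans (normr_ge0 _) (aM 0); rewrite expr0 divr1. Qed.

Lemma cvg_series_geometric_bound : cvgn (series a).
Proof.
apply: normed_cvg; apply: (@series_le_cvg _ _ (geometric M 2^-1)) => [|n|n|].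
- by move=> n; exact: normr_ge0.
- by apply: mulr_ge0; rewrite ?geometric_bound_ge0 ?exprn_ge0.
- by rewrite /= exprVn.
- by apply: is_cvg_geometric_series; rewrite ger0_norm // invf_lt1 // ltr1n.
Qed.

Lemma series_sub_geometric_bound N n : (N <= n)%N ->
  `|series a n - series a N| <= 2 * M / 2 ^+ N.
Proof.
move=> Nn; have dif k : `|series a (N + k)%N - series a N| <=
    2 * M / 2 ^+ N - 2 * M / 2 ^+ (N + k).
  elim: k => [|k ih]; first by rewrite addn0 !subrr normr0.
  rewrite addnS seriesSr addrAC (le_trans (ler_normD _ _)) //.
  rewrite (le_trans (lerD ih (aM _))) // exprS.
  have : 2 ^+ (N + k) != 0 :> R by rewrite expf_neq0.
  move: (2 ^+ (N + k)) (2 * M / 2 ^+ N) => z w z0.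
  by rewrite le_eqVlt; apply/orP; left; apply/eqP; field.
have := dif (n - N)%N; rewrite subnKC // => /le_trans; apply.
by rewrite gerBl divr_ge0 ?exprn_ge0 // mulr_ge0 ?geometric_bound_ge0.
Qed.

Lemma series_tail_geometric_bound N : `|limn (series a) - series a N| <= 2 * M / 2 ^+ N.
Proof.
have cv := cvg_series_geometric_bound.
have cn : `|series a n - series a N| @[n --> \oo] --> `|limn (series a) - series a N|.
  by apply: cvg_norm; apply: cvgB => //; exact: cvg_cst.
apply: (cvgr_to_le cn); near=> n.
by apply: series_sub_geometric_bound; near: n; exact: nbhs_infty_ge.
Unshelve. all: by end_near. Qed.

Lemma series_geometric_bound : `|limn (series a)| <= 2 * M.
Proof.
have := series_tail_geometric_bound 0.
by rewrite expr0 divr1 [series a 0%N]big_geq // subr0.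
Qed.

End geometric_bounds.

Lemma is_derive_series (R : realType) (f f' : nat -> R -> R) (x : R) N :
  (forall n, is_derive x 1 (f n) (f' n x)) ->
  is_derive x 1 (fun y => series (f^~ y) N) (series (f'^~ x) N).
Proof.
move=> ff'; elim: N => [|N ih].
  rewrite [series _ 0%N]big_geq //.
  rewrite (_ : (fun y => _) = cst 0); first exact: is_derive_const.
  by apply/funext => y; rewrite [series _ 0%N]big_geq.
rewrite seriesSr (_ : (fun y => _) = fun y => series (f^~ y) N + f N y).
  exact: is_derive_addf.
by apply/funext => y; rewrite seriesSr.
Qed.

(** Termwise differentiation of a series of functions whose terms and whose
    derivatives are dominated by a geometric series near [x]. *)
Lemma is_derive_lim_series (R : realType) (f f' : nat -> R -> R) (M M' r x : R) :
  0 < r ->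
  (forall n y, `|y - x| < r -> is_derive y 1 (f n) (f' n y)) ->
  (forall n y, `|y - x| < r -> `|f n y| <= M / 2 ^+ n) ->
  (forall n y, `|y - x| < r -> `|f' n y| <= M' / 2 ^+ n) ->
  is_derive x 1 (fun y => limn (series (f^~ y))) (limn (series (f'^~ x))).
Proof.
move=> r0 ff' fM f'M; apply/is_derive_epsP => e e0.
have xr : `|x - x| < r by rewrite subrr normr0.
have M'0 : 0 <= M' by apply: (@geometric_bound_ge0 _ (f'^~ x)) => n; exact: f'M.
(* N makes the tail of the series of the derivatives smaller than e / 3 *)
have [N NM] : exists N, 2 * M' / 2 ^+ N <= e / 3.
  have /cvgrPdist_le/(_ (e / 3)) : geometric (2 * M') 2^-1 @ \oo --> (0 : R).
    by apply: cvg_geometric; rewrite ger0_norm // invf_lt1 // ltr1n.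
  move=> /(_ ltac:(by rewrite divr_gt0)) [N _ /(_ N (leqnn N))] /=.
  rewrite sub0r normrN exprVn ger0_norm; first by exists N.
  by rewrite divr_ge0 ?mulr_ge0 ?exprn_ge0.
have dP : is_derive x 1 (fun y => series (f^~ y) N) (series (f'^~ x) N).
  by apply: is_derive_series => n; exact: ff'.
have [d d0 hd] := (is_derive_epsP _ _ _).1 dP (e / 3) ltac:(by rewrite divr_gt0).
exists (Num.min d r) => [|y]; first by rewrite lt_min d0.
rewrite lt_min => /andP[yd yr].
pose S z := limn (series (f^~ z)); set T := limn (series (f'^~ x)).
rewrite -/(S y) -/(S x).
have cvS z : `|z - x| < r -> series (f^~ z) n @[n --> \oo] --> S z.
  by move=> zr; apply: (@cvg_series_geometric_bound _ (f^~ z) M) => n; exact: fM.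
have tl : `|(S y - series (f^~ y) N) - (S x - series (f^~ x) N)| <= 2 * M' / 2 ^+ N * `|y - x|.
  have cn : `|(series (f^~ y) n - series (f^~ y) N) - (series (f^~ x) n - series (f^~ x) N)|
     @[n --> \oo] --> `|(S y - series (f^~ y) N) - (S x - series (f^~ x) N)|.
    apply: cvg_norm; apply: cvgB; apply: cvgB; try exact: cvg_cst.
      exact: cvS.
    exact: cvS.
  apply: (cvgr_to_le cn); near=> n.
  have Nn : (N <= n)%N by near: n; exact: nbhs_infty_ge.
  apply: (@is_derive_bound_dist _ (fun z => series (f^~ z) n - series (f^~ z) N)
    (fun z => series (f'^~ z) n - series (f'^~ z) N)) => z zy.
    by apply: is_derive_subf; apply: is_derive_series => k; apply: ff'; lra.
  apply: series_sub_geometric_bound => // k; apply: f'M; lra.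
have tl2 : `|T - series (f'^~ x) N| <= 2 * M' / 2 ^+ N.
  by apply: series_tail_geometric_bound => n; exact: f'M.
have := hd y yd.
rewrite (_ : S y - S x - (y - x) * T = ((S y - series (f^~ y) N) - (S x - series (f^~ x) N)) +
  (series (f^~ y) N - series (f^~ x) N - (y - x) * series (f'^~ x) N) -
  (y - x) * (T - series (f'^~ x) N)); last by ring.
move=> h1.
have h2 : `|(y - x) * (T - series (f'^~ x) N)| <= e / 3 * `|y - x|.
  by rewrite normrM mulrC ler_wpM2r // (le_trans tl2).
have h3 := le_trans tl (ler_wpM2r (normr_ge0 (y - x)) NM).
apply: le_trans (ler_normB _ _) _.
apply: le_trans (lerD (ler_normD _ _) (lexx _)) _.
apply: le_trans (lerD (lerD h3 h1) h2) _.
by rewrite -!mulrDl le_eqVlt; apply/orP; left; apply/eqP; field.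
Unshelve. all: by end_near. Qed.

(** * Linear equations of the second order *)

(** The antiderivative of a continuous function that vanishes at [t0]. *)
Definition antiderivative (R : realType) (t0 : R) (f : R -> R) : R -> R :=
  xget (cst 0) [set F | F t0 = 0 /\ forall x : R, is_derive x 1 F (f x)].

Lemma antiderivativeP (R : realType) (t0 : R) (f : R -> R) : continuous f ->
  antiderivative t0 f t0 = 0 /\
  forall x : R, is_derive x 1 (antiderivative t0 f) (f x).
Proof.
by move=> cf; rewrite /antiderivative; case: xgetP => [F _ //|];
  have [F FP] := continuous_antiderivative t0 cf => /(_ F).
Qed.

Lemma continuous_antiderivativeP (R : realType) (t0 : R) (f : R -> R) :
  continuous f -> continuous (antiderivative t0 f).
Proof.
move=> cf x; apply: is_derive_continuous; exact: (antiderivativeP t0 cf).2.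
Qed.

(** A weight, even about [t0], that dominates 2 K times its antiderivative
    vanishing at [t0]: in the norm that it defines, one step of the iteration
    below is a contraction by 1/2. *)
Definition picard_weight (R : realType) (K t0 t : R) : R :=
  expR (2 * K * (t - t0)) + expR (- (2 * K) * (t - t0)).

Lemma picard_weight_ge1 (R : realType) (K t0 t : R) : 1 <= picard_weight K t0 t.
Proof.
rewrite /picard_weight.
have := expR_ge1Dx (2 * K * (t - t0)); have := expR_ge1Dx (- (2 * K) * (t - t0)).
by lra.
Qed.

Lemma picard_weight_local_bound (R : realType) (K t0 t x : R) : 0 <= K ->
  `|t - x| < 1 ->
  picard_weight K t0 t <= 2 * expR (2 * K * (`|x - t0| + 1)).
Proof.
move=> K0 tx; rewrite /picard_weight.
have tt : `|t - t0| <= `|x - t0| + 1.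
  have : `|t - t0| <= `|t - x| + `|x - t0|.
    by rewrite (le_trans _ (ler_normD _ _)) // addrA subrK.
  by lra.
have h1 := ler_norm (t - t0); have h2 := ler_norm (- (t - t0)).
rewrite normrN in h2.
set E := expR (2 * K * (`|x - t0| + 1)).
have e1 : expR (2 * K * (t - t0)) <= E.
  by rewrite ler_expR; apply: ler_wpM2l; lra.
have e2 : expR (- (2 * K) * (t - t0)) <= E.
  by rewrite ler_expR mulNr -mulrN; apply: ler_wpM2l; lra.
by lra.
Qed.

Lemma antiderivative_picard_weight (R : realType) (K t0 c : R) (F g : R -> R) :
  0 < K -> 0 <= c -> F t0 = 0 -> (forall x : R, is_derive x 1 F (g x)) ->
  (forall x, `|g x| <= c * picard_weight K t0 x) ->
  forall t, `|F t| <= c / (2 * K) * picard_weight K t0 t.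
Proof.
move=> K0 c0 Ft0 Fg gc t.
pose S (x : R) := c / (2 * K) * (expR (2 * K * (x - t0)) - expR (- (2 * K) * (x - t0))).
have dS (x : R) : is_derive x 1 S (c * picard_weight K t0 x).
  have E p : is_derive x 1 (fun y => expR (p * (y - t0))) (expR (p * (x - t0)) * p).
    by apply: is_derive_compf; exact: is_derive_affine.
  apply: (is_derive_eq (is_derive_scalef _ (is_derive_subf (E _) (E _)))).
  by rewrite /picard_weight; field; rewrite gt_eqF.
have St0 : S t0 = 0 by rewrite /S !subrr !mulr0 subrr mulr0.
have gB x : - (c * picard_weight K t0 x) <= g x <= c * picard_weight K t0 x.
  by rewrite -ler_norml.
have mono a b : a <= b -> S a - F a <= S b - F b /\ S a + F a <= S b + F b.
  move=> ab; split.
    apply: (is_derive_ge0_le ab (f := fun x => S x - F x)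
      (f' := fun x => c * picard_weight K t0 x - g x)) => x _.
    by have := gB x; lra.
  apply: (is_derive_ge0_le ab (f := fun x => S x + F x)
    (f' := fun x => c * picard_weight K t0 x + g x)) => x _.
  by have := gB x; lra.
suff h : `|F t| <= `|S t|.
  have cK : 0 <= c / (2 * K) by rewrite divr_ge0 // mulr_ge0 // ltW.
  apply: (le_trans h); rewrite /S /picard_weight normrM (ger0_norm cK).
  apply: ler_wpM2l => //.
  by apply: (le_trans (ler_normB _ _)); rewrite !ger0_norm ?expR_ge0.
case: (leP t0 t) => [/mono|/ltW/mono]; rewrite St0 Ft0 => -[h1 h2].
  by apply: le_trans (ler_norm _); rewrite ler_norml; lra.
by rewrite -(normrN (S t)); apply: le_trans (ler_norm _); rewrite ler_norml; lra.
Qed.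

(** Shifting a series by one index, with a zero first term. *)
Lemma lim_series_shift (R : realType) (a b : nat -> R) :
  cvgn (series a) -> b 0%N = 0 -> (forall n, b n.+1 = a n) ->
  limn (series b) = limn (series a).
Proof.
move=> ca b0 ba; apply/cvg_lim => //; rewrite -cvg_shiftS /=.
rewrite (_ : (fun n => series b n.+1) = series a) //.
apply/funext => n /=; rewrite /series /= big_nat_recl // b0 add0r.
by apply: eq_bigr => i _; rewrite ba.
Qed.

Section picard.
Context (R : realType) (q : R -> R) (d Q t0 y0 v0 : R).
Hypotheses (cq : continuous q) (qQ : forall t, `|q t| <= Q) (d0 : 0 <= d).

(** Picard's iteration for the system u' = v, v' = - 2 d v - q u: the
    solution is the sum of the iterates. *)
Fixpoint picard n : (R -> R) * (R -> R) :=
  if n is n'.+1 then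
    (antiderivative t0 (picard n').2,
     antiderivative t0 (fun t => - (2 * d) * (picard n').2 t - q t * (picard n').1 t))
  else (cst y0, cst v0).

Lemma continuous_picard n : continuous (picard n).1 /\ continuous (picard n).2.
Proof.
elim: n => [|n [c1 c2]] /=; first by split; exact: cst_continuous.
split; apply: continuous_antiderivativeP => // t.
apply: cvgB; apply: cvgM; [exact: cvg_cst|exact: c2|exact: cq|exact: c1].
Qed.

Lemma picard1S n : (picard n.+1).1 t0 = 0 /\
  forall t : R, is_derive t 1 (picard n.+1).1 ((picard n).2 t).
Proof. by apply: antiderivativeP; exact: (continuous_picard n).2. Qed.

Lemma picard2S n : (picard n.+1).2 t0 = 0 /\
  forall t : R, is_derive t 1 (picard n.+1).2
    (- (2 * d) * (picard n).2 t - q t * (picard n).1 t).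
Proof.
apply: antiderivativeP => t; have [c1 c2] := continuous_picard n.
apply: cvgB; apply: cvgM; [exact: cvg_cst|exact: c2|exact: cq|exact: c1].
Qed.

Let K := 2 * d + Q + 1.

Lemma picard_bound n t :
  `|(picard n).1 t| <= (`|y0| + `|v0|) / 2 ^+ n * picard_weight K t0 t /\
  `|(picard n).2 t| <= (`|y0| + `|v0|) / 2 ^+ n * picard_weight K t0 t.
Proof.
have Q0 : 0 <= Q by exact: le_trans (qQ t0).
have K0 : 0 < K by rewrite /K ltr_wpDl // addr_ge0 // mulr_ge0.
pose b : R := `|y0| + `|v0|; have b0 : 0 <= b by rewrite addr_ge0.
rewrite -/b; elim: n t => [|n ih] t.
  have w1 := picard_weight_ge1 K t0 t; rewrite /= expr0 divr1.
  by split; apply: le_trans (ler_peMr b0 w1); rewrite /b ?lerDl ?lerDr.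
clearbody b; have bn : 0 <= b / 2 ^+ n by rewrite divr_ge0 ?exprn_ge0.
have half (c : R) : 0 <= c -> c <= K * (b / 2 ^+ n) -> c / (2 * K) <= b / 2 ^+ n.+1.
  move=> c0 cK; rewrite ler_pdivrMr ?mulr_gt0 //; apply: (le_trans cK).
  rewrite exprS invfM le_eqVlt; apply/orP; left; apply/eqP.
  by move: (2 ^+ n)^-1 => z; field.
have w0 : 0 <= picard_weight K t0 t by apply: le_trans (picard_weight_ge1 _ _ _).
split.
  have [e de] := picard1S n.
  have h := antiderivative_picard_weight K0 bn e de (fun x => (ih x).2) t.
  apply: (le_trans h); apply: ler_wpM2r => //; apply: half => //.
  by apply: ler_peMl => //; rewrite /K lerDr addr_ge0 // mulr_ge0.
have [e de] := picard2S n.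
have c0 : 0 <= (2 * d + Q) * (b / 2 ^+ n) by rewrite mulr_ge0 // addr_ge0 // mulr_ge0.
have := antiderivative_picard_weight K0 c0 e de _ t.
move=> h; apply: (le_trans (h _)) => [x|].
  have [h1 h2] := ih x.
  apply: (le_trans (ler_normB _ _)); rewrite !normrM normrN normrM normr_nat (ger0_norm d0).
  have d20 : 0 <= 2 * d by rewrite mulr_ge0.
  apply: le_trans (lerD (ler_wpM2l d20 h2) (ler_pM _ _ (qQ x) h1)) _ => //.
  by rewrite -mulrDl !mulrA.
by apply: ler_wpM2r => //; apply: half => //; apply: ler_wpM2r; rewrite // /K lerDl.
Qed.

(** Existence for the Cauchy problem u'' + 2 d u' + q u = 0 on the whole line. *)
Lemma linear_ode_exists : exists u v : R -> R,
  [/\ u t0 = y0, v t0 = v0,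
      forall t : R, is_derive t 1 u (v t)
    & forall t : R, is_derive t 1 v (- (2 * d) * v t - q t * u t)].
Proof.
have Q0 : 0 <= Q by exact: le_trans (qQ t0).
have K0 : 0 < K by rewrite /K ltr_wpDl // addr_ge0 // mulr_ge0.
pose b : R := `|y0| + `|v0|; have b0 : 0 <= b by rewrite addr_ge0.
pose M x := b * (2 * expR (2 * K * (`|x - t0| + 1))).
have bound n x y : `|y - x| < 1 ->
    `|(picard n).1 y| <= M x / 2 ^+ n /\ `|(picard n).2 y| <= M x / 2 ^+ n.
  move=> yx; have w := picard_weight_local_bound t0 (ltW K0) yx.
  have bn : 0 <= b / 2 ^+ n by rewrite divr_ge0 ?exprn_ge0.
  have [h1 h2] := picard_bound n y.
  rewrite /M mulrAC; split; [apply: (le_trans h1)|apply: (le_trans h2)]; exact: ler_wpM2l.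
have xx (x : R) : `|x - x| < 1 by rewrite subrr normr0.
have c1 x : cvgn (series (fun n => (picard n).1 x)).
  by apply: (@cvg_series_geometric_bound _ _ (M x)) => n; exact: (bound n x x (xx x)).1.
have c2 x : cvgn (series (fun n => (picard n).2 x)).
  by apply: (@cvg_series_geometric_bound _ _ (M x)) => n; exact: (bound n x x (xx x)).2.
have at0 (a : nat -> R) c : a 0%N = c -> (forall n, a n.+1 = 0) -> limn (series a) = c.
  move=> a0 aS; apply/cvg_lim => //; rewrite -cvg_shiftS /=.
  rewrite (_ : (fun n => series a n.+1) = cst c); first exact: cvg_cst.
  apply/funext => n /=; rewrite /series /= big_nat_recl // a0.
  by rewrite big1 ?addr0 // => i _; rewrite aS.
exists (fun x => limn (series (fun n => (picard n).1 x))).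
exists (fun x => limn (series (fun n => (picard n).2 x))); split.
- by apply: at0 => // n; exact: (picard1S n).1.
- by apply: at0 => // n; exact: (picard2S n).1.
- move=> t.
  pose f' n x := if n is k.+1 then (picard k).2 x else 0.
  rewrite -(lim_series_shift (b := f'^~ t) (c2 t)) //.
  apply: (is_derive_lim_series (M := M t) (M' := 2 * M t) ltr01).
  + move=> [|n] y _ /=; first exact: is_derive_const.
    exact: (picard1S n).2.
  + by move=> n y yt; exact: (bound n t y yt).1.
  + move=> [|n] y yt; rewrite /f'.
      by rewrite normr0 divr_ge0 // mulr_ge0 // mulr_ge0 // mulr_ge0 // expR_ge0.
    apply: (le_trans (bound n t y yt).2).
    by rewrite exprS invfM mulrACA divff // mul1r.
move=> t.
pose f' n x := if n is k.+1 then - (2 * d) * (picard k).2 x - q x * (picard k).1 x else 0.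
have lin (N : nat) : series (fun n => - (2 * d) * (picard n).2 t - q t * (picard n).1 t) N =
   - (2 * d) * series (fun n => (picard n).2 t) N - q t * series (fun n => (picard n).1 t) N.
  by rewrite /series /= !mulr_sumr -sumrB.
have cl : series (fun n => - (2 * d) * (picard n).2 t - q t * (picard n).1 t) n @[n --> \oo] -->
    - (2 * d) * limn (series (fun n => (picard n).2 t)) - q t * limn (series (fun n => (picard n).1 t)).
  under eq_fun do rewrite lin.
  by apply: cvgB; apply: cvgMl_tmp.
rewrite -(cvg_lim _ cl) // -(lim_series_shift (b := f'^~ t)) //; last by apply/cvg_ex; eexists; exact: cl.
apply: (is_derive_lim_series (M := M t) (M' := 2 * K * M t) ltr01).
- move=> [|n] y _ /=; first exact: is_derive_const.
  exact: (picard2S n).2.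
- by move=> n y yt; exact: (bound n t y yt).2.
- move=> [|n] y yt; rewrite /f'.
    by rewrite normr0 divr_ge0 // mulr_ge0 // ?mulr_ge0 // ?mulr_ge0 ?expR_ge0 // ltW.
  have [h1 h2] := bound n t y yt.
  apply: (le_trans (ler_normB _ _)); rewrite !normrM normrN normrM normr_nat (ger0_norm d0).
  have Mn : 0 <= M t / 2 ^+ n by apply: le_trans h1.
  rewrite (_ : 2 * K * M t / 2 ^+ n.+1 = K * (M t / 2 ^+ n)); last first.
    by rewrite exprS invfM; move: (2 ^+ n)^-1 => z; field.
  have d20 : 0 <= 2 * d by rewrite mulr_ge0.
  apply: le_trans (lerD (ler_wpM2l d20 h2) (ler_pM _ _ (qQ y) h1)) _ => //.
  by rewrite -mulrDl; apply: ler_wpM2r => //; rewrite /K lerDl.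
Qed.

End picard.

(** * Symbol classes and a smooth step *)

(** [symbol m n F]: every function [F j] is [n] times differentiable, and for
    [i <= n] its [i]-th derivative is bounded by a constant times [m j ^+ i], the
    constant being the same for all [j]. *)
Fixpoint symbol (R : realType) (m : nat -> R) (n : nat) (F : nat -> R -> R) : Prop :=
  (exists K, forall j x, `|F j x| <= K) /\
  if n is n'.+1 then
    exists G, (forall j (x : R), is_derive x 1 (F j) (m j * G j x)) /\ symbol m n' G
  else True.

Lemma symbol_bounded (R : realType) (m : nat -> R) n F :
  symbol m n F -> exists K, forall j x, `|F j x| <= K.
Proof. by case: n => [|n] []. Qed.

Lemma symbol_weaken (R : realType) (m : nat -> R) n F : symbol m n.+1 F -> symbol m n F.
Proof.
elim: n F => [|n ih] F [bF [G [dG sG]]]; split => //.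
by exists G; split => //; exact: ih.
Qed.

Lemma symbol_coef (R : realType) (m c : nat -> R) n K :
  (forall j, `|c j| <= K) -> symbol m n (fun j _ => c j).
Proof.
elim: n c K => [|n ih] c K cK; first by split => //; exists K.
split; first by exists K.
exists (fun _ _ => 0); split; last by apply: (ih (fun=> 0) 0) => j; rewrite normr0.
by move=> j x; rewrite mulr0; exact: is_derive_const.
Qed.

Lemma symbolD (R : realType) (m : nat -> R) n F G :
  symbol m n F -> symbol m n G -> symbol m n (fun j x => F j x + G j x).
Proof.
have bD A B : (exists K, forall j x, `|A j x| <= K) -> (exists K, forall j x, `|B j x| <= K) ->
    exists K, forall (j : nat) (x : R), `|A j x + B j x : R| <= K.
  move=> [K AK] [L BL]; exists (K + L) => j x.
  by apply: le_trans (ler_normD _ _) _; exact: lerD.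
elim: n F G => [|n ih] F G sF sG.
  by split => //; apply: bD; [exact: symbol_bounded sF|exact: symbol_bounded sG].
have [_ [F' [dF sF']]] := sF; have [_ [G' [dG sG']]] := sG.
split; first by apply: bD; [exact: symbol_bounded sF|exact: symbol_bounded sG].
exists (fun j x => F' j x + G' j x); split; last exact: ih.
by move=> j x; rewrite mulrDr; exact: is_derive_addf.
Qed.

Lemma symbolM (R : realType) (m : nat -> R) n F G :
  symbol m n F -> symbol m n G -> symbol m n (fun j x => F j x * G j x).
Proof.
have bM A B : (exists K, forall j x, `|A j x| <= K) -> (exists K, forall j x, `|B j x| <= K) ->
    exists K, forall (j : nat) (x : R), `|A j x * B j x : R| <= K.
  by move=> [K AK] [L BL]; exists (K * L) => j x; rewrite normrM ler_pM.
elim: n F G => [|n ih] F G sF sG.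
  by split => //; apply: bM; [exact: symbol_bounded sF|exact: symbol_bounded sG].
have [_ [F' [dF sF']]] := sF; have [_ [G' [dG sG']]] := sG.
split; first by apply: bM; [exact: symbol_bounded sF|exact: symbol_bounded sG].
exists (fun j x => F' j x * G j x + F j x * G' j x); split.
  move=> j x; apply: (is_derive_eq (is_derive_mulf (dF j x) (dG j x))).
  by ring.
by apply: symbolD; apply: ih => //; apply: symbol_weaken.
Qed.

Lemma symbol_affine (R : realType) (m p q : nat -> R) n F :
  (forall j, 0 < m j) -> (forall j, `|p j| <= m j) -> symbol (cst 1) n F ->
  symbol m n (fun j x => F j (p j * (x - q j))).
Proof.
move=> m0 pm; elim: n F => [|n ih] F sF.
  by split => //; have [K FK] := symbol_bounded sF; exists K.
split; first by have [K FK] := symbol_bounded sF; exists K.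
have [_ [G [dG sG]]] := sF.
exists (fun j x => p j / m j * G j (p j * (x - q j))); split.
  move=> j x; apply: (is_derive_eq (is_derive_compf (dG j _) (is_derive_affine _ _ _))).
  by rewrite /= mul1r; field; rewrite gt_eqF.
apply: symbolM; last exact: ih.
apply: (@symbol_coef _ _ _ _ (1)) => j.
by rewrite normrM normfV (gtr0_norm (m0 j)) ler_pdivrMr // mul1r.
Qed.

Lemma symbol_sin_cos (R : realType) n :
  symbol (cst 1) n (fun=> @sin R) /\ symbol (cst 1) n (fun=> @cos R).
Proof.
have bs : exists K : R, forall (j : nat) x, `|sin x| <= K by exists 1 => _; exact: sin_max.
have bc : exists K : R, forall (j : nat) x, `|cos x| <= K by exists 1 => _; exact: cos_max.
elim: n => [//|n [ihs ihc]]; split; split => //.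
  by exists (fun=> @cos R); split => // j x; rewrite mul1r; exact: is_derive_sin.
exists (fun _ x => - 1 * sin x); split.
  by move=> j x; rewrite mul1r mulN1r; exact: is_derive_cos.
by apply: symbolM => //; apply: (@symbol_coef _ _ _ _ (1)) => j; rewrite normrN1.
Qed.

(** What membership in a symbol class says of the iterated derivatives, for
    functions multiplied by constants [A j]. *)
Lemma symbol_derive1n (R : realType) (m A : nat -> R) n F i :
  symbol m n F -> (i <= n)%N ->
  (exists K, forall j x,
    `|derive1n i (fun y => A j * F j y) x| <= K * (`|A j| * `|m j| ^+ i)) /\
  ((i < n)%N -> forall j (x : R), derivable (derive1n i (fun y => A j * F j y)) x 1).
Proof.
elim: n A F i => [|n ih] A F [|i] //.
- by move=> sF _; split => //; have [K FK] := symbol_bounded sF; exists K => j x;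
    rewrite expr0 mulr1 normrM mulrC; exact: ler_wpM2r.
- move=> sF _; split => [|_ j x].
    have [K FK] := symbol_bounded sF; exists K => j x.
    by rewrite expr0 mulr1 normrM mulrC; exact: ler_wpM2r.
  have [_ [G [dG _]]] := sF; have d := is_derive_scalef (A j) (dG j x).
  exact: ex_derive.
move=> [_ [G [dG sG]]] lei.
have E j : derive1n i.+1 (fun y => A j * F j y) = derive1n i (fun y => A j * m j * G j y).
  rewrite derive1Sn; congr (derive1n i _); apply: is_derive_derive1 => x.
  by rewrite -mulrA; exact: is_derive_scalef.
have [[K HK] HD] := ih (fun j => A j * m j) G i sG lei.
split; last by move=> ltin j x; rewrite E; exact: HD.
by exists K => j x; rewrite E exprS (mulrA `|A j|) -normrM; exact: HK.
Qed.

(** [flat n x] is x^(-n) exp(-1/x), extended by 0 to x <= 0. *)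
Definition flat (R : realType) (n : nat) (x : R) : R :=
  if 0 < x then x^-1 ^+ n * expR (- x^-1) else 0.

Lemma flat_ge0 (R : realType) n (x : R) : 0 <= flat n x.
Proof.
rewrite /flat; case: ltP => // x0.
by rewrite mulr_ge0 ?expR_ge0 // exprn_ge0 // invr_ge0 ltW.
Qed.

Lemma flat_le (R : realType) n (x : R) : flat n x <= n`!%:R.
Proof.
rewrite /flat; case: ltP => // x0.
have y0 : 0 < x^-1 by rewrite invr_gt0.
move: x^-1 y0 => y y0; rewrite expRN ler_pdivrMr ?expR_gt0 //.
have f0 : 0 < n`!%:R :> R by rewrite ltr0n fact_gt0.
rewrite mulrC -ler_pdivrMr //; case: n {f0} => [|n].
  by rewrite expr0 fact0 divr1; have := expR_ge1Dx y; lra.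
by have := expR_ge1Dxn n (ltW y0); lra.
Qed.

Lemma is_derive_flat (R : realType) n (x : R) :
  is_derive x 1 (flat n) (- n%:R * flat n.+1 x + flat n.+2 x).
Proof.
have [x0|x0|<-] := ltgtP 0 x.
- have d : is_derive x 1 (fun y => y^-1 ^+ n * expR (- y^-1))
      (- n%:R * flat n.+1 x + flat n.+2 x).
    have dinv : is_derive x 1 (fun y => y^-1) (- (x^-1 ^+ 2)).
      have := @is_deriveV _ (@id R) x 1 1; rewrite /= => H.
      apply: (is_derive_eq (H _ _)); first by rewrite gt_eqF.
      by rewrite /GRing.scale /= mulr1 exprVn.
    have dpow : is_derive x 1 (fun y : R => y^-1 ^+ n) (n%:R * x^-1 ^+ n.-1 * - (x^-1 ^+ 2)).
      exact: is_derive_powf.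
    apply: (is_derive_eq (is_derive_mulf dpow
      (is_derive_compf (is_derive_expR _) (is_derive_oppf dinv)))).
    rewrite /flat x0 opprK; case: n {dpow} => [|n]; first by rewrite /=; ring.
    by rewrite /= !exprS; ring.
  apply: near_eq_is_derive d.
  apply: (filterS _ (lt_nbhsr x0)) => y; rewrite /flat => y0.
  by rewrite y0.
- have : is_derive x 1 (cst (0:R)) (- n%:R * flat n.+1 x + flat n.+2 x).
    by rewrite /flat ltNge (ltW x0) /= mulr0 addr0; exact: is_derive_const.
  apply: near_eq_is_derive.
  apply: (filterS _ (lt_nbhsl x0)) => y; rewrite /flat => y0 /=.
  by rewrite ltNge (ltW y0).
apply/is_derive_epsP => e e0.
have f0 : 0 < n.+2`!%:R :> R by rewrite ltr0n fact_gt0.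
exists (e / n.+2`!%:R); first by rewrite divr_gt0.
move=> y; rewrite /flat ltxx mulr0 addr0 mulr0 !subr0 => yd.
case: ltP => [y0|_]; last by rewrite normr0 mulr_ge0 // ltW.
rewrite (_ : y^-1 ^+ n * expR (- y^-1) = y * y * flat n.+2 y); last first.
  by rewrite /flat y0 !exprS; field; rewrite gt_eqF.
rewrite !normrM (ger0_norm (flat_ge0 _ _)) mulrAC ler_wpM2r //.
apply: le_trans (_ : `|y| * n.+2`!%:R <= _); first by rewrite ler_wpM2l // flat_le.
by rewrite -ler_pdivlMr // ltW.
Qed.

Lemma symbol_flat (R : realType) k n : symbol (cst 1) k (fun=> @flat R n).
Proof.
have b i : exists K : R, forall (j : nat) x, `|flat i x| <= K.
  by exists i`!%:R => _ x; rewrite ger0_norm ?flat_ge0 // flat_le.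
elim: k n => [//|k ih] n; split => //.
exists (fun _ x => - n%:R * flat n.+1 x + flat n.+2 x); split.
  by move=> j x; rewrite mul1r; exact: is_derive_flat.
apply: symbolD => //; apply: symbolM => //.
by apply: (@symbol_coef _ _ _ _ (n%:R)) => j; rewrite normrN ger0_norm.
Qed.

(** A smooth step from 0 to 1 across [0, 1], all of whose derivatives are
    bounded. *)
Lemma smooth_step_exists (R : realType) : exists th th' : R -> R,
  [/\ forall x : R, is_derive x 1 th (th' x),
      forall x, x <= 0 -> th x = 0 /\ th' x = 0,
      forall x, 1 <= x -> th x = 1 /\ th' x = 0,
      forall x, 0 <= th x <= 1 /\ 0 <= th' x
    & forall n, symbol (cst 1) n (fun=> th) /\ symbol (cst 1) n (fun=> th')].
Proof.
pose b (x : R) := flat 0 x * flat 0 (- 1 * (x - 1)).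
have sb n : symbol (cst 1) n (fun=> b).
  apply: symbolM; first exact: symbol_flat.
  apply: (@symbol_affine _ _ (fun=> -1) (fun=> 1) _ (fun=> flat 0)) => //.
    by move=> j /=; rewrite normrN1.
  exact: symbol_flat.
have cb : continuous b.
  move=> x; have [_ [G [dG _]]] := sb 1%N.
  exact: is_derive_continuous (dG 0%N x).
have b0 x : 0 <= b x by rewrite mulr_ge0 // flat_ge0.
have bl x : x <= 0 -> b x = 0 by move=> x0; rewrite /b /flat ltNge x0 /= mul0r.
have br x : 1 <= x -> b x = 0.
  move=> x1; rewrite /b {2}/flat ltNge (_ : _ <= 0) /= ?mulr0 //; lra.
have bpos x : 0 < x < 1 -> 0 < b x.
  move=> /andP[cl x1]; have cr : 0 < -1 * (x - 1) by lra.
  rewrite /b /flat cl cr !expr0 !mul1r.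
  by apply: mulr_gt0; exact: expR_gt0.
clearbody b; have [B [B0 dB]] := continuous_antiderivative 0 cb.
have Bl x : x <= 0 -> B x = 0.
  move=> x0; rewrite -B0; apply: (@is_derive0_eq _ B _ _ x0) => y /andP[_ y0].
  by rewrite -(bl y).
have Br x : 1 <= x -> B x = B 1.
  move=> x1; apply/esym; apply: (@is_derive0_eq _ B _ _ x1) => y /andP[y1 _].
  by rewrite -(br y).
have Bm x y : x <= y -> B x <= B y.
  by move=> xy; apply: (is_derive_ge0_le xy (f := B) (f' := b)) => *.
have B1 : 0 < B 1.
  have dB' (x : R) : 4^-1 <= x <= 3 / 4 -> is_derive x 1 B (b x) by [].
  have h : 4^-1 <= 3 / 4 :> R by lra.
  have [c /andP[c1 c2] e] := is_derive_mean_value h dB'.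
  have bc : 0 < b c by apply: bpos; lra.
  have : 0 < B (3/4) - B 4^-1 by rewrite e mulr_gt0 //; lra.
  have := Bm 0 4^-1; have := Bm (3/4) 1; rewrite B0.
  move=> h1 h2; have := h1 _; have := h2 _; lra.
have i0 : 0 <= (B 1)^-1 by rewrite invr_ge0 ltW.
have th01 x : 0 <= (B 1)^-1 * B x <= 1.
  have /andP[h1 h2] : 0 <= B x <= B 1.
    apply/andP; split.
      by case: (leP x 0) => [/Bl ->//|/ltW/Bm]; rewrite B0.
    by case: (leP 1 x) => [/Br ->//|/ltW/Bm].
  by rewrite mulr_ge0 //= mulrC ler_pdivrMr // mul1r.
exists (fun x => (B 1)^-1 * B x), (fun x => (B 1)^-1 * b x); split.
- by move=> x; exact: is_derive_scalef.
- move=> x x0; split; first by rewrite (Bl _ x0) mulr0.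
  by rewrite /= (bl _ x0) mulr0.
- move=> x x1; split; first by rewrite (Br _ x1) mulVf // gt_eqF.
  by rewrite /= (br _ x1) mulr0.
- by move=> x; split; [exact: th01|rewrite mulr_ge0].
have sb' n : symbol (cst 1) n (fun=> fun x => (B 1)^-1 * b x).
  by apply: symbolM => //; apply: (@symbol_coef _ _ _ _ (`|(B 1)^-1|)).
have bth : exists K, forall (j : nat) x, `|(B 1)^-1 * B x| <= K.
  by exists 1 => _ x; have /andP[h1 h2] := th01 x; rewrite ger0_norm.
move=> n; split => //; case: n => [|n]; split => //.
exists (fun=> fun x => (B 1)^-1 * b x); split => // j x.
by rewrite mul1r; exact: is_derive_scalef.
Qed.

(** * Blocks, ripples and the coefficient *)

Lemma is_derive_ge0_of_secants (R : realType) (f : R -> R) (x l : R) :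
  is_derive x 1 f l ->
  (forall r, 0 < r -> exists y, [/\ y != x, `|y - x| < r & 0 <= (f y - f x) * (y - x)]) ->
  0 <= l.
Proof.
move/is_derive_epsP => fl H; rewrite leNgt; apply/negP => l0.
have l20 : 0 < - l / 2 by lra.
have [d d0 hd] := fl _ l20.
have [y [yx yd fy]] := H d d0.
have := hd y yd; have yx0 : y - x != 0 by rewrite subr_eq0.
have : 0 < (y - x) ^+ 2 by rewrite exprn_even_gt0.
have n0 : 0 < `|y - x| by rewrite normr_gt0.
rewrite -(ler_pM2r n0) -normrM => h1 /ler_normlW.
rewrite -mulrA -normrM -expr2 (ger0_norm (ltW h1)) mulrBl -mulrA (mulrC l) mulrA -expr2.
move: ((y - x) ^+ 2) h1 => z z0 h.
have : 0 < - l * z by rewrite mulr_gt0 //; lra.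
by lra.
Qed.

Lemma is_derive_ge0_of_ndecr_left (R : realType) (f : R -> R) (x l : R) :
  is_derive x 1 f l -> (forall y, y <= x -> f y <= f x) -> 0 <= l.
Proof.
move=> fl fx; apply: (is_derive_ge0_of_secants fl) => r r0.
exists (x - r / 2); have h : x - r / 2 - x = - (r / 2) by lra.
split; rewrite ?h.
- by rewrite -subr_eq0 h oppr_eq0; lra.
- by rewrite normrN ger0_norm; lra.
- by rewrite mulr_le0 // ?subr_le0 ?fx; lra.
Qed.

Lemma is_derive_eq0_of_cst_left (R : realType) (f : R -> R) (x l : R) :
  is_derive x 1 f l -> (forall y, y <= x -> f y = f x) -> l = 0.
Proof.
move=> fl fx; apply/eqP; rewrite eq_le -oppr_ge0; apply/andP; split.
  apply: (is_derive_ge0_of_ndecr_left (is_derive_oppf fl)) => y yx.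
  by rewrite (fx y).
by apply: (is_derive_ge0_of_ndecr_left fl) => y yx; rewrite (fx y).
Qed.

Lemma is_derive_eq0_of_cst_right (R : realType) (f : R -> R) (x l : R) :
  is_derive x 1 f l -> (forall y, x <= y -> f y = f x) -> l = 0.
Proof.
move=> fl fx; have fl' : is_derive (-1 * (x - 0 : R)) 1 (fun y => f (-1 * (y - 0))) (l * -1).
  apply: is_derive_compf; last exact: is_derive_affine.
  by rewrite subr0 mulN1r subr0 mulN1r opprK.
have := is_derive_eq0_of_cst_left fl' _.
rewrite mulrN1 => H; apply: oppr_inj; rewrite oppr0; apply: H => y.
rewrite !subr0 !mulN1r opprK => yx; apply: fx; lra.
Qed.

Lemma derive1n_eq_open (R : realType) (U : set R) (f g : R -> R) i x :
  open U -> (forall y, U y -> f y = g y) -> U x -> derive1n i f x = derive1n i g x.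
Proof.
move=> oU fg; elim: i x => [|i ih] x Ux; first exact: fg.
rewrite !derive1nS !derive1E; apply: near_eq_derive.
by apply: (filterS _ (open_nbhs_nbhs (conj oU Ux))) => y; exact: ih.
Qed.

Lemma symbol_row (R : realType) (m : nat -> R) n F j :
  symbol m n F -> symbol (cst 1) n (fun=> F j).
Proof.
elim: n F => [|n ih] F sF.
  by split => //; have [K FK] := symbol_bounded sF; exists K.
split; first by have [K FK] := symbol_bounded sF; exists K.
have [_ [G [dG sG]]] := sF.
exists (fun _ x => m j * G j x); split; first by move=> i x; rewrite mul1r.
apply: symbolM; last exact: ih.
by apply: (@symbol_coef _ _ _ _ `|m j|).
Qed.

(** The [j]-th block of time is [4 / scale j, 8 / scale j]; the blocks are
    adjacent and accumulate at 0. *)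
Definition scale (R : realType) (j : nat) : R := 2 ^+ (j + 3).

Lemma scale_gt0 (R : realType) j : 0 < scale R j.
Proof. by rewrite exprn_gt0. Qed.

Lemma scaleS (R : realType) j : scale R j.+1 = 2 * scale R j.
Proof. by rewrite /scale addSn exprS. Qed.

Lemma inv_scale_le (R : realType) i j : (i <= j)%N -> (scale R j)^-1 <= (scale R i)^-1.
Proof.
by move=> ij; rewrite lef_pV2 ?posrE ?scale_gt0 // ler_eXn2l ?ltr1n // leq_add2r.
Qed.

Lemma inv_scaleS (R : realType) j : (scale R j)^-1 = 2 * (scale R j.+1)^-1.
Proof. by rewrite scaleS invfM mulrA divff // mul1r. Qed.

Lemma block_end_le (R : realType) i j : (i < j)%N -> 8 / scale R j <= 4 / scale R i.
Proof.
move=> ij; rewrite (inv_scaleS R i).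
by have := @inv_scale_le R i.+1 j ij; lra.
Qed.

Lemma inv_scale_archi (R : realType) (t : R) j : 0 < t ->
  exists2 J, (j <= J)%N & 4 / scale R J < t.
Proof.
move=> t0.
have /cvgrPdist_lt/(_ t t0) : geometric (4 / 2 ^+ 3) 2^-1 @ \oo --> (0 : R).
  by apply: cvg_geometric; rewrite ger0_norm // invf_lt1 // ltr1n.
move=> [N _ HN]; exists (maxn j N); first exact: leq_maxl.
have := HN (maxn j N) (leq_maxr _ _).
rewrite /= sub0r normrN ger0_norm; last by rewrite mulr_ge0 ?divr_ge0 // exprn_ge0.
apply: le_lt_trans; rewrite le_eqVlt; apply/orP; left; apply/eqP.
have : 2 ^+ maxn j N != 0 :> R by rewrite expf_neq0.
rewrite /scale exprD /geometric /= exprVn; move: (2 ^+ maxn j N) => z z0.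
by field.
Qed.

(** A bump in the last three quarters of the block, equal to 1 on
    [6 / scale j, 7 / scale j], and its derivative. *)
Definition envelope (R : realType) (th : R -> R) j (t : R) : R :=
  th (scale R j * (t - 5 / scale R j)) * th (- scale R j * (t - 8 / scale R j)).

Definition envelope' (R : realType) (th th' : R -> R) j (t : R) : R :=
  scale R j *
  (th' (scale R j * (t - 5 / scale R j)) * th (- scale R j * (t - 8 / scale R j)) -
   th (scale R j * (t - 5 / scale R j)) * th' (- scale R j * (t - 8 / scale R j))).

(** With s = m_j (t - 5 / scale j), the function sin(s) exp(phi), where
    phi' = 2 e m_j envelope sin(s)^2, solves w'' + m_j^2 (1 + e ripple) w = 0. *)
Definition ripple (R : realType) (th th' : R -> R) (e : R) (m : nat -> R) j (t : R) : R :=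
  let s := m j * (t - 5 / scale R j) in
  - (8 * envelope th j t * (sin s * cos s) +
     2 * (envelope' th th' j t / m j) * sin s ^+ 2 +
     4 * e * envelope th j t ^+ 2 * sin s ^+ 4).

(** The data of the coefficient: a smooth step, the strength [eps] of the
    ripples, and, on the [j]-th block, the frequency, the plateau value
    [level j] and the amplitude [depth j] of the ripple around it. *)
Record cascade (R : realType) (k : nat) (alpha : R) := Cascade {
  step : R -> R;
  step' : R -> R;
  eps : R;
  freq : nat -> R;
  level : nat -> R;
  depth : nat -> R;
  step_derive : forall x : R, is_derive x 1 step (step' x);
  step_le0 : forall x, x <= 0 -> step x = 0 /\ step' x = 0;
  step_ge1 : forall x, 1 <= x -> step x = 1 /\ step' x = 0;
  step_bounds : forall x, 0 <= step x <= 1 /\ 0 <= step' x;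
  step_symbol : forall n, symbol (cst 1) n (fun=> step) /\ symbol (cst 1) n (fun=> step');
  eps_gt0 : 0 < eps;
  ripple_small : forall j t, `|eps * ripple step step' eps freq j t| <= 1 / 2;
  freq_ge : forall j, scale R j <= freq j;
  depth_gt0 : forall j, 0 < depth j;
  depth_le : forall j, depth j <= level j;
  levelS : forall j, level j.+1 <= level j / 2;
  level0 : level 0%N <= 1 / 4;
  level_freq : forall j, level j * (freq j ^+ k * freq j `^ alpha) <= 2 / 2 ^+ j }.

Section coefficient.
Context (R : realType) (k : nat) (alpha : R) (P : cascade k alpha).

(** The ripple with its strength. *)
Definition rip j t := eps P * ripple (step P) (step' P) (eps P) (freq P) j t.

(** The contribution of the [j]-th block: a rise from [level j.+1] to
    [level j], then a ripple. *)
Definition stair j t :=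
  (level P j - level P j.+1) * step P (scale R j * (t - 4 / scale R j)) +
  depth P j * rip j t.

(** The sum of all stairs: a staircase descending to 0 at time 0, with ripples
    on its steps. *)
Definition coefficient t := limn (series (fun j => stair j t)).

End coefficient.

Lemma freq_gt0 (R : realType) k (alpha : R) (P : cascade k alpha) j : 0 < freq P j.
Proof. exact: lt_le_trans (scale_gt0 R j) (freq_ge P j). Qed.

Lemma freq_ge1 (R : realType) k (alpha : R) (P : cascade k alpha) j : 1 <= freq P j.
Proof. by apply: le_trans (freq_ge P j); rewrite exprn_ege1 // ler1n. Qed.

Lemma level_gt0 (R : realType) k (alpha : R) (P : cascade k alpha) j : 0 < level P j.
Proof. exact: lt_le_trans (depth_gt0 P j) (depth_le P j). Qed.

Lemma envelope_eq0 (R : realType) k (alpha : R) (P : cascade k alpha) j (t : R) :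
  t <= 5 / scale R j \/ 8 / scale R j <= t ->
  envelope (step P) j t = 0 /\ envelope' (step P) (step' P) j t = 0.
Proof.
have s0 := scale_gt0 R j; rewrite /envelope /envelope' => -[h|h].
  have h1 : scale R j * (t - 5 / scale R j) <= 0.
    by rewrite mulr_ge0_le0 ?subr_le0 // ltW.
  by have [-> ->] := step_le0 P h1; rewrite !mul0r subr0 mulr0.
have h1 : - scale R j * (t - 8 / scale R j) <= 0.
  by rewrite mulNr oppr_le0 mulr_ge0 ?subr_ge0 // ltW.
by have [-> ->] := step_le0 P h1; rewrite !mulr0 subr0 mulr0.
Qed.

Lemma rip_eq0 (R : realType) k (alpha : R) (P : cascade k alpha) j (t : R) :
  t <= 5 / scale R j \/ 8 / scale R j <= t -> rip P j t = 0.
Proof.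
move=> h; rewrite /rip /ripple; have [-> ->] := envelope_eq0 P h.
by rewrite !expr0n /= !(mul0r, mulr0) !addr0 oppr0 mulr0.
Qed.

Lemma rise_eq0 (R : realType) k (alpha : R) (P : cascade k alpha) j (t : R) :
  t <= 4 / scale R j -> step P (scale R j * (t - 4 / scale R j)) = 0.
Proof.
move=> h; apply: (step_le0 P _).1.
by rewrite mulr_ge0_le0 ?subr_le0 // ltW // scale_gt0.
Qed.

Lemma rise_eq1 (R : realType) k (alpha : R) (P : cascade k alpha) j (t : R) :
  5 / scale R j <= t -> step P (scale R j * (t - 4 / scale R j)) = 1.
Proof.
move=> h; apply: (step_ge1 P _).1; rewrite mulrBr mulrCA divff ?gt_eqF ?scale_gt0 //.
have : scale R j * (5 / scale R j) <= scale R j * t by rewrite ler_pM2l ?scale_gt0.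
rewrite mulrCA divff ?gt_eqF ?scale_gt0 //; lra.
Qed.

Lemma stair_eq0 (R : realType) k (alpha : R) (P : cascade k alpha) j (t : R) :
  t <= 4 / scale R j -> stair P j t = 0.
Proof.
move=> h; rewrite /stair rise_eq0 // rip_eq0 ?mulr0 ?addr0 //.
left; apply: (le_trans h); rewrite ler_pM2r ?invr_gt0 ?scale_gt0 // ler_nat //.
Qed.

Lemma stair_end (R : realType) k (alpha : R) (P : cascade k alpha) j (t : R) :
  8 / scale R j <= t -> stair P j t = level P j - level P j.+1.
Proof.
move=> h; rewrite /stair rise_eq1 ?rip_eq0 ?mulr1 ?mulr0 ?addr0 //; first by right.
by apply: le_trans h; rewrite ler_pM2r ?invr_gt0 ?scale_gt0 // ler_nat //.
Qed.

Lemma stair_late (R : realType) k (alpha : R) (P : cascade k alpha) j (t : R) :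
  5 / scale R j <= t -> stair P j t = level P j - level P j.+1 + depth P j * rip P j t.
Proof. by move=> h; rewrite /stair rise_eq1 // mulr1. Qed.

Lemma rip_le (R : realType) k (alpha : R) (P : cascade k alpha) j (t : R) :
  `|depth P j * rip P j t| <= level P j / 2.
Proof.
rewrite normrM (gtr0_norm (depth_gt0 P j)).
by apply: le_trans (ler_pM _ _ (depth_le P j) (ripple_small P j t)) _; rewrite ?mul1r // ltW // depth_gt0.
Qed.

Lemma stair_bounds (R : realType) k (alpha : R) (P : cascade k alpha) j (t : R) :
  0 <= stair P j t <= 2 * level P j.
Proof.
have c0 := level_gt0 P j; have c1 := level_gt0 P j.+1; have cS := levelS P j.
case: (leP t (5 / scale R j)) => h.
  rewrite /stair rip_eq0 ?mulr0 ?addr0; last by left.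
  have [/andP[h1 h2] _] := step_bounds P (scale R j * (t - 4 / scale R j)).
  rewrite mulr_ge0 //=; last by lra.
  by apply: (@le_trans _ _ ((level P j - level P j.+1) * 1)); [apply: ler_wpM2l; lra|lra].
rewrite (stair_late _ (ltW h)); have := rip_le P j t.
by rewrite ler_norml => /andP[h1 h2]; apply/andP; split; lra.
Qed.

(** * Values of the coefficient *)

Lemma level_decay (R : realType) k (alpha : R) (P : cascade k alpha) j :
  level P j <= 1 / 4 / 2 ^+ j.
Proof.
elim: j => [|j ih]; first by rewrite expr0 divr1; exact: level0.
apply: le_trans (levelS P j) _.
by rewrite exprS invfM mulrCA mulrC ler_pM2l ?invr_gt0.
Qed.

Lemma coefficient_le0 (R : realType) k (alpha : R) (P : cascade k alpha) (t : R) :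
  t <= 0 -> coefficient P t = 0.
Proof.
move=> t0; rewrite /coefficient (_ : series _ = cst 0) ?lim_cst //.
apply/funext => n; rewrite /series /= big1 // => i _; apply: stair_eq0.
by apply: (le_trans t0); rewrite divr_ge0 // ltW // scale_gt0.
Qed.

(** From the [J]-th block on, all later stairs are complete and their sum
    telescopes. *)
Lemma coefficientE (R : realType) k (alpha : R) (P : cascade k alpha) J (t : R) :
  4 / scale R J <= t ->
  coefficient P t = level P J.+1 + \sum_(0 <= i < J.+1) stair P i t.
Proof.
move=> Jt; apply/cvg_lim => //.
have lev0 : level P n @[n --> \oo] --> (0 : R).
  apply: (@squeeze_cvgr _ _ _ _ (cst 0) (geometric (1 / 4) 2^-1)).
  - near=> n; rewrite (ltW (level_gt0 P n)) /= /geometric /= exprVn.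
    exact: level_decay.
  - exact: cvg_cst.
  - by apply: cvg_geometric; rewrite ger0_norm // invf_lt1 // ltr1n.
have E n : (J < n)%N -> series (fun j => stair P j t) n =
    \sum_(0 <= i < J.+1) stair P i t + level P J.+1 - level P n.
  elim: n => [//|n ih]; rewrite ltnS leq_eqVlt => /orP[/eqP <-|Jn].
    by rewrite addrK.
  rewrite seriesSr ih // stair_end; first by ring.
  by apply: le_trans Jt; exact: block_end_le.
have cv : \sum_(0 <= i < J.+1) stair P i t + level P J.+1 - level P n @[n --> \oo] -->
    \sum_(0 <= i < J.+1) stair P i t + level P J.+1 - 0.
  by apply: cvgB => //; exact: cvg_cst.
rewrite addrC -[X in _ --> X]subr0; apply: cvg_trans cv.
apply: near_eq_cvg; near=> n; rewrite E //.
by near: n; exists J.+1.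
Unshelve. all: by end_near. Qed.

Lemma coefficient_ge_stair (R : realType) k (alpha : R) (P : cascade k alpha) j (t : R) :
  4 / scale R j <= t -> level P j.+1 + stair P j t <= coefficient P t.
Proof.
move=> jt; rewrite (coefficientE P jt) lerD2l big_nat_recr //= lerDr sumr_ge0 // => i _.
by have /andP[] := stair_bounds P i t.
Qed.

Lemma coefficient_gt0 (R : realType) k (alpha : R) (P : cascade k alpha) (t : R) :
  0 < t -> 0 < coefficient P t.
Proof.
move=> /(inv_scale_archi 0)[J _ /ltW Jt].
apply: lt_le_trans (coefficient_ge_stair P Jt).
have /andP[h _] := stair_bounds P J t.
by have := level_gt0 P J.+1; lra.
Qed.

Lemma coefficient_ge_level (R : realType) k (alpha : R) (P : cascade k alpha) j (t : R) :
  5 / scale R j <= t -> level P j / 2 <= coefficient P t.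
Proof.
move=> jt; have jt4 : 4 / scale R j <= t.
  by apply: le_trans jt; rewrite ler_pM2r ?invr_gt0 ?scale_gt0 // ler_nat.
apply: le_trans (coefficient_ge_stair P jt4); rewrite stair_late //.
by have := rip_le P j t; rewrite ler_norml => /andP[h1 h2]; lra.
Qed.

Lemma coefficient_le_level (R : realType) k (alpha : R) (P : cascade k alpha) j (t : R) :
  t <= 8 / scale R j -> coefficient P t <= 4 * level P j.
Proof.
move=> tj; have c0 := level_gt0 P j.
case: (leP t 0) => [/(coefficient_le0 P) ->|t0]; first by rewrite mulr_ge0 // ltW.
have [J jJ /ltW Jt] := inv_scale_archi j t0.
rewrite (coefficientE P Jt) (@big_cat_nat _ _ _ j) //=; last exact: leqW.
rewrite big_nat big1 ?add0r; last first.
  by move=> i /andP[_ ij]; apply: stair_eq0; apply: (le_trans tj); exact: block_end_le.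
clear t0 tj Jt; have : level P J.+1 + \sum_(j <= i < J.+1) stair P i t <=
    4 * level P j - 3 * level P J.+1.
  elim: J jJ => [|J ih] jJ.
    move: jJ; rewrite leqn0 => /eqP ->; rewrite big_nat1.
    have /andP[_ h] := stair_bounds P 0 t; have := levelS P 0; lra.
  have /andP[_ h] := stair_bounds P J.+1 t.
  have h2 := levelS P J.+1.
  case: (ltngtP j J.+1) jJ => // [ltj _|-> _]; last first.
    by rewrite big_nat1; lra.
  by rewrite big_nat_recr ?(ltnW ltj) //=; have := ih ltj; lra.
by have := level_gt0 P J.+1; lra.
Qed.

Lemma coefficient_le1 (R : realType) k (alpha : R) (P : cascade k alpha) (t : R) :
  coefficient P t <= 1.
Proof.
have h0 := level0 P.
case: (leP t (8 / scale R 0)) => [/(coefficient_le_level P) h|/ltW h]; first by lra.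
have h4 : 4 / scale R 0 <= t by apply: le_trans h; rewrite ler_pM2r ?invr_gt0 ?scale_gt0 // ler_nat.
rewrite (coefficientE P h4) big_nat1.
rewrite stair_end //; lra.
Qed.

Lemma coefficient_ge0 (R : realType) k (alpha : R) (P : cascade k alpha) (t : R) :
  0 <= coefficient P t.
Proof.
by case: (leP t 0) => [/(coefficient_le0 P) ->|/(coefficient_gt0 P)/ltW].
Qed.

Lemma coefficient_plateau (R : realType) k (alpha : R) (P : cascade k alpha) j (t : R) :
  5 / scale R j <= t <= 8 / scale R j ->
  coefficient P t = level P j + depth P j * rip P j t.
Proof.
move=> /andP[jt tj]; have jt4 : 4 / scale R j <= t.
  by apply: le_trans jt; rewrite ler_pM2r ?invr_gt0 ?scale_gt0 // ler_nat.
rewrite (coefficientE P jt4) big_nat_recr //= big_nat big1 => [|i /andP[_ ij]].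
  by rewrite stair_late //; ring.
by apply: stair_eq0; apply: (le_trans tj); exact: block_end_le.
Qed.

(** Stairs, normalised by their level, form a symbol class at the scale given
    by the frequencies. *)
Lemma stair_symbol (R : realType) k (alpha : R) (P : cascade k alpha) n :
  exists F, symbol (freq P) n F /\ forall j, stair P j = fun t => level P j * F j t.
Proof.
pose m := freq P; have m0 := freq_gt0 P; have lv j := level_gt0 P j.
have sc j : `|scale R j| <= m j by rewrite gtr0_norm ?scale_gt0 // freq_ge.
have scN j : `|- scale R j| <= m j by rewrite normrN.
pose U j t := step P (scale R j * (t - 5 / scale R j)).
pose V j t := step P (- scale R j * (t - 8 / scale R j)).
pose U' j t := step' P (scale R j * (t - 5 / scale R j)).
pose V' j t := step' P (- scale R j * (t - 8 / scale R j)).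
have sU : symbol m n U.
  exact: (@symbol_affine _ m (scale R) (fun j => 5 / scale R j) n (fun=> step P) m0 sc (step_symbol P n).1).
have sV : symbol m n V.
  exact: (@symbol_affine _ m (fun j => - scale R j) (fun j => 8 / scale R j) n
    (fun=> step P) m0 scN (step_symbol P n).1).
have sU' : symbol m n U'.
  exact: (@symbol_affine _ m (scale R) (fun j => 5 / scale R j) n (fun=> step' P) m0 sc (step_symbol P n).2).
have sV' : symbol m n V'.
  exact: (@symbol_affine _ m (fun j => - scale R j) (fun j => 8 / scale R j) n
    (fun=> step' P) m0 scN (step_symbol P n).2).
pose W j t := step P (scale R j * (t - 4 / scale R j)).
have sW : symbol m n W.
  exact: (@symbol_affine _ m (scale R) (fun j => 4 / scale R j) n (fun=> step P) m0 sc (step_symbol P n).1).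
have mm j : `|m j| <= m j by rewrite gtr0_norm.
pose S j t := sin (m j * (t - 5 / scale R j)).
pose C j t := cos (m j * (t - 5 / scale R j)).
have sS : symbol m n S.
  exact: (@symbol_affine _ m m (fun j => 5 / scale R j) n (fun=> @sin R) m0 mm (symbol_sin_cos R n).1).
have sC : symbol m n C.
  exact: (@symbol_affine _ m m (fun j => 5 / scale R j) n (fun=> @cos R) m0 mm (symbol_sin_cos R n).2).
have cst_symbol (a : R) : symbol m n (fun _ _ => a) by exact: (@symbol_coef _ _ (fun=> a) _ `|a|).
pose F j t := (1 - level P j.+1 / level P j) * W j t +
  depth P j / level P j * (eps P * (-1 * (8 * (U j t * V j t) * (S j t * C j t) +
    2 * (scale R j / m j * (U' j t * V j t + -1 * (U j t * V' j t))) * (S j t * S j t) +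
    4 * eps P * (U j t * V j t * (U j t * V j t)) * (S j t * S j t * (S j t * S j t))))).
exists F; split; last first.
  move=> j; apply/funext => t; rewrite /stair /F [RHS]mulrDr; congr (_ + _).
    by rewrite [RHS]mulrA; congr (_ * _); field; rewrite gt_eqF.
  rewrite [RHS]mulrA (mulrC (level P j)) divfK ?gt_eqF //; congr (_ * _).
  rewrite /rip /ripple /envelope /envelope' -/(U j t) -/(V j t) -/(U' j t) -/(V' j t) -/(S j t) -/(C j t) -/m.
  by field; rewrite gt_eqF.
have sD := @symbolD R m n; have sM := @symbolM R m n.
apply: (sD); apply: (sM) => //.
- apply: (@symbol_coef _ _ _ _ 1) => j.
  have h : level P j.+1 / level P j <= 1.
    by rewrite ler_pdivrMr // mul1r; have := levelS P j; have := lv j; lra.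
  have h0 : 0 <= level P j.+1 / level P j by rewrite divr_ge0 // ltW.
  by rewrite ger0_norm; lra.
- apply: (@symbol_coef _ _ _ _ 1) => j.
  rewrite ger0_norm; last by rewrite divr_ge0 // ltW // depth_gt0.
  by rewrite ler_pdivrMr // mul1r depth_le.
do 2 (apply: (sM) => //).
have sr : symbol m n (fun j _ => scale R j / m j).
  apply: (@symbol_coef _ _ _ _ 1) => j.
  by rewrite normrM normfV (gtr0_norm (m0 j)) ler_pdivrMr // mul1r.
have sE : symbol m n (fun j t => U' j t * V j t + -1 * (U j t * V' j t)).
  by apply: (sD); [exact: sM|apply: (sM) => //; exact: sM].
have sUV : symbol m n (fun j t => U j t * V j t) by exact: sM.
have sSS : symbol m n (fun j t => S j t * S j t) by exact: sM.
apply: (sD); first apply: (sD).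
- by apply: (sM); apply: (sM).
- apply: (sM) => //; apply: (sM) => //; exact: (sM).
apply: (sM); last exact: sM.
by apply: (sM) => //; exact: sM.
Qed.

(** * Regularity of the coefficient *)

Lemma stair_derive1n (R : realType) k (alpha : R) (P : cascade k alpha) i :
  exists2 K, 0 <= K & forall j (x : R),
    derivable (derive1n i (stair P j)) x 1 /\
    `|derive1n i (stair P j) x| <= K * (level P j * freq P j ^+ i).
Proof.
have [F [sF FE]] := stair_symbol P i.+1.
have [[K HK] HD] := symbol_derive1n (level P) sF (leqnSn i).
exists `|K| => // j x; rewrite FE; split; first exact: HD.
apply: le_trans (HK j x) _.
rewrite (gtr0_norm (level_gt0 P j)) (gtr0_norm (freq_gt0 P j)) ler_wpM2r ?ler_norm //.
by rewrite mulr_ge0 ?exprn_ge0 // ltW ?level_gt0 ?freq_gt0.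
Qed.

Lemma is_derive_stair (R : realType) k (alpha : R) (P : cascade k alpha) j (x : R) :
  is_derive x 1 (stair P j) (derive1 (stair P j) x).
Proof.
have [K _ H] := stair_derive1n P 0; have [h _] := H j x.
by rewrite derive1E; apply: DeriveDef.
Qed.

Lemma stair_derive_ge0 (R : realType) k (alpha : R) (P : cascade k alpha) j (x : R) :
  x <= 5 / scale R j -> 0 <= derive1 (stair P j) x.
Proof.
move=> xj; apply: (is_derive_ge0_of_ndecr_left (is_derive_stair P j x)) => y yx.
rewrite /stair !rip_eq0; [|by left|by left; exact: le_trans xj].
rewrite !mulr0 !addr0; apply: ler_wpM2l.
  by have := levelS P j; have := level_gt0 P j; lra.
have sxy : scale R j * (y - 4 / scale R j) <= scale R j * (x - 4 / scale R j).
  by rewrite ler_pM2l ?scale_gt0 // lerD2r.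
apply: (is_derive_ge0_le sxy (f' := step' P)) => z _; first exact: step_derive.
exact: (step_bounds P z).2.
Qed.

Lemma stair_derive_eq0 (R : realType) k (alpha : R) (P : cascade k alpha) j (x : R) :
  8 / scale R j <= x -> derive1 (stair P j) x = 0.
Proof.
move=> xj; apply: (is_derive_eq0_of_cst_right (is_derive_stair P j x)) => y yx.
by rewrite !stair_end //; exact: le_trans yx.
Qed.

Lemma is_derive_coefficient (R : realType) k (alpha : R) (P : cascade k alpha) J (t : R) :
  4 / scale R J < t ->
  is_derive t 1 (coefficient P) (\sum_(0 <= i < J.+1) derive1 (stair P i) t).
Proof.
move=> Jt; have d : is_derive t 1 (fun y => level P J.+1 + series (fun i => stair P i y) J.+1)
    (0 + series (fun i => derive1 (stair P i) t) J.+1).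
  have ds := @is_derive_series R (stair P) (fun i => derive1 (stair P i)) t J.+1
    (fun i => is_derive_stair P i t).
  exact: (is_derive_addf (is_derive_const t (level P J.+1)) ds).
rewrite add0r in d; apply: near_eq_is_derive d.
apply: (filterS _ (lt_nbhsr Jt)) => y /ltW yt.
by rewrite (coefficientE P yt).
Qed.

Lemma coefficient_derivable (R : realType) k (alpha : R) (P : cascade k alpha) (t : R) :
  0 < t -> is_derive t 1 (coefficient P) (derive1 (coefficient P) t).
Proof.
move=> /(inv_scale_archi 0)[J _ /(is_derive_coefficient P) d].
by rewrite derive1E; apply: DeriveDef => //; exact: ex_derive.
Qed.

(** The coefficient increases on the rise of each block. *)
Lemma coefficient_rise (R : realType) k (alpha : R) (P : cascade k alpha) j (t : R) :
  4 / scale R j <= t <= 5 / scale R j -> 0 <= derive1 (coefficient P) t.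
Proof.
move=> /andP[jt tj]; have s0 := scale_gt0 R j; have i0 : 0 < (scale R j)^-1 by rewrite invr_gt0.
have jt' : 4 / scale R j.+1 < t.
  by apply: lt_le_trans jt; rewrite (inv_scaleS R j); have := inv_scaleS R j; lra.
rewrite derive1E (@derive_val _ _ _ _ _ _ _ (is_derive_coefficient P jt')).
rewrite big_nat; apply: sumr_ge0 => i /andP[_]; rewrite ltnS leq_eqVlt => /orP[/eqP ->|].
  rewrite stair_derive_eq0 //; apply: le_trans jt; exact: block_end_le.
rewrite ltnS => ij; apply: stair_derive_ge0; apply: (le_trans tj).
by rewrite ler_pM2l //; exact: inv_scale_le.
Qed.

(** After the [j]-th block the coefficient decreases at a logarithmic rate that
    involves only the frequencies of the blocks of smaller index. *)
Lemma coefficient_later (R : realType) k (alpha : R) (P : cascade k alpha) :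
  exists2 K, 0 <= K & forall j (t : R), 8 / scale R j <= t ->
    - (K * \sum_(0 <= i < j) freq P i) * coefficient P t <= derive1 (coefficient P) t.
Proof.
have [K K0 HK] := stair_derive1n P 1.
exists (2 * K) => [|j t jt]; first by rewrite mulr_ge0.
have i0 : 0 < (scale R j)^-1 by rewrite invr_gt0 scale_gt0.
have jt' : 4 / scale R j < t by apply: lt_le_trans jt; rewrite ltr_pM2r // ltr_nat.
rewrite derive1E (@derive_val _ _ _ _ _ _ _ (is_derive_coefficient P jt')).
rewrite big_nat_recr //= stair_derive_eq0 // addr0.
rewrite mulr_sumr -sumrN mulr_suml; rewrite !big_nat; apply: ler_sum => i /andP[_ ij].
have c0 := coefficient_ge0 P t; have m0 := freq_gt0 P i.
have h0 : 0 <= K * freq P i * coefficient P t by rewrite mulr_ge0 // mulr_ge0 // ltW.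
case: (leP t (5 / scale R i)) => [/(stair_derive_ge0 P) h|/ltW/(coefficient_ge_level P) h].
  by lra.
have [_] := HK i t; rewrite expr1 derive1n1 => hK.
have : - (K * (level P i * freq P i)) <= derive1 (stair P i) t.
  by move: hK; rewrite ler_norml => /andP[].
have : K * freq P i * level P i <= K * freq P i * (2 * coefficient P t).
  by apply: ler_wpM2l; [rewrite mulr_ge0 // ltW|lra].
by lra.
Qed.

Lemma stair_derive1n_geometric (R : realType) k (alpha : R) (P : cascade k alpha) i :
  0 <= alpha -> (i <= k)%N ->
  exists M, forall j (x : R), `|derive1n i (stair P j) x| <= M / 2 ^+ j.
Proof.
move=> a0 ik; have [K K0 HK] := stair_derive1n P i; exists (K * 2) => j x.
apply: le_trans (HK j x).2 _; rewrite -mulrA; apply: ler_wpM2l => //.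
apply: le_trans (level_freq P j); rewrite ler_pM2l ?level_gt0 //.
have m1 := freq_ge1 P j.
apply: le_trans (_ : freq P j ^+ k <= _); first by rewrite ler_weXn2l.
rewrite ler_peMr ?exprn_ge0 //; first by exact: le_trans m1.
by rewrite -(powRr0 (freq P j)); apply: ler_powR.
Qed.

Lemma coefficient_derive1n (R : realType) k (alpha : R) (P : cascade k alpha) i :
  0 <= alpha -> (i <= k)%N ->
  derive1n i (coefficient P) = (fun x => limn (series (fun j => derive1n i (stair P j) x))) /\
  ((i < k)%N -> forall x : R, derivable (derive1n i (coefficient P)) x 1).
Proof.
move=> a0.
have D j (ij : (j < k)%N) (x : R) :
    is_derive x 1 (fun y => limn (series (fun n => derive1n j (stair P n) y)))
      (limn (series (fun n => derive1n j.+1 (stair P n) x))).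
  have [M HM] := stair_derive1n_geometric P a0 (ltnW ij).
  have [M' HM'] := stair_derive1n_geometric P a0 ij.
  apply: (@is_derive_lim_series R (fun n => derive1n j (stair P n))
    (fun n => derive1n j.+1 (stair P n)) M M' 1 x ltr01) => n y _ //.
  have [K _ H] := stair_derive1n P j; have [h _] := H n y.
  by rewrite derive1nS derive1E; apply: DeriveDef.
elim: i => [|i ih] ik.
  split => [|k0 x]; first by [].
  by have [h _] := D 0%N k0 x; exact: h.
have [e _] := ih (ltnW ik).
have E : derive1n i.+1 (coefficient P) =
    (fun x => limn (series (fun j => derive1n i.+1 (stair P j) x))).
  by rewrite derive1nS e; apply: is_derive_derive1 => x; exact: D.
by split => // ik' x; rewrite E; have [h _] := D _ ik' x; exact: h.
Qed.

(** Interpolation between the bounds on a function and on its derivative. *)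
Lemma hoelder_interpolation (R : realType) (g : R -> R) (A m alpha : R) x y :
  0 < alpha -> alpha <= 1 -> 1 <= m ->
  (forall z, `|g z| <= A) -> (forall z, derivable g z 1) ->
  (forall z, `|derive1 g z| <= A * m) ->
  `|g x - g y| <= 2 * A * m `^ alpha * `|x - y| `^ alpha.
Proof.
move=> a0 a1 m1 gA dg g'A.
have m0 : 0 <= m by apply: le_trans m1.
have A0 : 0 <= A := le_trans (normr_ge0 _) (gA 0).
rewrite -mulrA -powRM //; case: (leP (m * `|x - y|) 1) => h.
  have dd (z : R) : is_derive z 1 g (derive1 g z) by rewrite derive1E; apply: DeriveDef.
  apply: le_trans (is_derive_bound_dist (fun z _ => dd z) (fun z _ => g'A z)) _.
  rewrite -mulrA; apply: le_trans (_ : A * (m * `|x - y|) `^ alpha <= _); last first.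
    by rewrite ler_wpM2r ?powR_ge0 //; lra.
  apply: ler_wpM2l => //.
  have [->|p0] := eqVneq (m * `|x - y|) 0; first exact: powR_ge0.
  have p1 : 0 < m * `|x - y| <= 1 by rewrite h lt_neqAle eq_sym p0 mulr_ge0.
  by rewrite -[X in X <= _]powRr1 ?(ltW (andP p1).1) //; apply: ger_powR.
apply: le_trans (ler_normB _ _) _; apply: le_trans (lerD (gA x) (gA y)) _.
have -> : A + A = 2 * A by ring.
rewrite ler_peMr ?mulr_ge0 //.
by rewrite -(powRr0 (m * `|x - y|)); apply: ler_powR; rewrite ltW.
Qed.

Lemma coefficient_hoelder (R : realType) k (alpha : R) (P : cascade k alpha) :
  0 < alpha -> alpha <= 1 -> Defs.hoelder alpha (derive1n k (coefficient P)).
Proof.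
move=> a0 a1; have [E _] := coefficient_derive1n P (ltW a0) (leqnn k); rewrite {}E.
have [K K0 HK] := stair_derive1n P k; have [K' K'0 HK'] := stair_derive1n P k.+1.
pose L := Num.max K K'.
have [M HM] := stair_derive1n_geometric P (ltW a0) (leqnn k).
exists (2 * (2 * L * 2)) => x y.
have cv z : cvgn (series (fun j => derive1n k (stair P j) z)).
  by apply: (cvg_series_geometric_bound (M := M)) => j; exact: HM.
rewrite -lim_seriesB //; set h := `|x - y| `^ alpha.
have -> : 2 * (2 * L * 2) * h = 2 * (2 * L * 2 * h) by ring.
apply: series_geometric_bound => j /=.
have lm : 0 <= level P j * freq P j ^+ k.
  by rewrite mulr_ge0 ?exprn_ge0 // ltW ?level_gt0 ?freq_gt0.
have m1 := freq_ge1 P j.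
have := @hoelder_interpolation R (derive1n k (stair P j)) (L * (level P j * freq P j ^+ k))
  (freq P j) alpha x y a0 a1 m1 _ _ _.
move=> H; apply: le_trans (H _ _ _) _.
- move=> z; apply: le_trans (HK j z).2 _.
  by rewrite ler_wpM2r // le_max lexx.
- by move=> z; exact: (HK j z).1.
- move=> z; rewrite -derive1nS; apply: le_trans (HK' j z).2 _.
  have -> : L * (level P j * freq P j ^+ k) * freq P j = L * (level P j * freq P j ^+ k.+1).
    by rewrite exprSr; ring.
  apply: ler_wpM2r; last by rewrite le_max lexx orbT.
  by rewrite mulr_ge0 ?exprn_ge0 // ltW ?level_gt0 ?freq_gt0.
have -> : 2 * (L * (level P j * freq P j ^+ k)) * freq P j `^ alpha * h =
  2 * L * h * (level P j * (freq P j ^+ k * freq P j `^ alpha)) by ring.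
have -> : 2 * L * 2 * h / 2 ^+ j = 2 * L * h * (2 / 2 ^+ j) by ring.
apply: ler_wpM2l (level_freq P j).
by rewrite !mulr_ge0 ?powR_ge0 // le_max K0.
Qed.

Lemma hoelder_continuous (R : realType) (alpha : R) (f : R -> R) :
  0 < alpha -> Defs.hoelder alpha f -> continuous f.
Proof.
move=> a0 [L HL] x; apply/cvgrPdist_le => e e0.
pose M := `|L| + 1; have M0 : 0 < M by rewrite ltr_pwDr.
pose d := (e / M) `^ alpha^-1; have d0 : 0 < d by rewrite powR_gt0 // divr_gt0.
exists d => //= y /= xy; apply: le_trans (HL x y) _.
have h : `|x - y| `^ alpha <= e / M.
  have -> : e / M = d `^ alpha by rewrite /d -powRrM mulVf ?gt_eqF // powRr1 // divr_ge0 // ltW.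
  by apply: ge0_ler_powR; rewrite ?nnegrE // ltW.
apply: le_trans (_ : M * `|x - y| `^ alpha <= _).
  by rewrite ler_wpM2r ?powR_ge0 // /M; have := ler_norm L; lra.
by rewrite mulrC -ler_pdivlMr.
Qed.

Lemma coefficient_Ck_hoelder (R : realType) k (alpha : R) (P : cascade k alpha) :
  0 < alpha -> alpha <= 1 -> Ck_hoelder k alpha (coefficient P).
Proof.
move=> a0 a1; have H := coefficient_hoelder P a0 a1; split => //.
  by move=> i ik; exact: (coefficient_derive1n P (ltW a0) (ltnW ik)).2.
exact: hoelder_continuous H.
Qed.

Lemma coefficient_smooth (R : realType) k (alpha : R) (P : cascade k alpha) :
  smooth_on [set t | t != 0] (coefficient P).
Proof.
have loc (U : set R) g i x : open U -> (forall y, U y -> coefficient P y = g y) -> U x ->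
    derivable (derive1n i g) x 1 -> derivable (derive1n i (coefficient P)) x 1.
  move=> oU cg Ux; apply: near_eq_derivable.
  apply: (filterS _ (open_nbhs_nbhs (conj oU Ux))) => y Uy.
  by apply/esym; exact: derive1n_eq_open Uy.
have sd g i x : symbol (cst 1) i.+1 (fun=> g) -> derivable (derive1n i g) x 1.
  move=> sg; have [_ /(_ (ltnSn i) 0%N x)] := symbol_derive1n (cst 1) sg (leqnSn i).
  by rewrite (_ : (fun y => _) = g) //; apply/funext => y; rewrite mul1r.
move=> i x /= x0; case: (ltP x 0) => [xn|xp].
  apply: (loc [set y | y < 0] (cst 0)); [exact: open_lt| |by []|].
    by move=> y /ltW /(coefficient_le0 P).
  by apply: sd; apply: (@symbol_coef _ _ (fun=> 0) _ 0) => _; rewrite normr0.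
have {xp} xp : 0 < x by rewrite lt_neqAle eq_sym x0.
have [J _ Jx] := inv_scale_archi 0 xp.
apply: (loc [set y | 4 / scale R J < y]
  (fun y => level P J.+1 + \sum_(0 <= l < J.+1) stair P l y)); [exact: open_gt| |by []|].
  by move=> y /ltW /(coefficientE P).
apply: sd; apply: symbolD.
  exact: (@symbol_coef _ _ (fun=> level P J.+1) _ `|level P J.+1|).
elim: (J.+1) => [|n ih].
  rewrite (_ : (fun _ _ => _) = (fun (_ : nat) (_ : R) => 0 : R)).
    by apply: (@symbol_coef _ _ (fun=> 0) _ 0) => _; rewrite normr0.
  by apply/funext => ?; apply/funext => y; rewrite big_geq.
rewrite (_ : (fun _ _ => _) = fun (_ : nat) y => \sum_(0 <= l < n) stair P l y + stair P n y).
  apply: symbolD => //; have [F [sF FE]] := stair_symbol P i.+1.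
  rewrite FE; apply: symbolM; last exact: symbol_row sF.
  exact: (@symbol_coef _ _ (fun=> level P n) _ `|level P n|).
by apply/funext => ?; apply/funext => y; rewrite big_nat_recr.
Qed.

(** * The resonant solution on its block *)

(** [u] and its derivative [v] solve u'' + 2 d u' + L^2 c(t) u = 0 on [a, b]. *)
Definition mode_on (R : realType) (d L : R) (c u v : R -> R) (a b : R) : Prop :=
  forall t : R, a <= t <= b ->
    is_derive t 1 u (v t) /\ is_derive t 1 v (- (2 * d) * v t - L ^+ 2 * c t * u t).

Lemma is_derive_sqr (R : realType) (f : R -> R) (t a : R) :
  is_derive t 1 f a -> is_derive t 1 (fun s => f s ^+ 2) (2 * f t * a).
Proof. by move=> /(is_derive_powf 2) /=; rewrite expr1. Qed.

(** The energy with the unit propagation speed grows and decays at most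
    exponentially, at a rate linear in the frequency. *)
Lemma mode_energy_bounds (R : realType) (d L : R) (c u v : R -> R) (a b : R) :
  0 <= d -> 0 <= L -> (forall t, 0 <= c t <= 1) -> a <= b -> mode_on d L c u v a b ->
  v b ^+ 2 + L ^+ 2 * u b ^+ 2 <=
    (v a ^+ 2 + L ^+ 2 * u a ^+ 2) * expR ((4 * d + L) * (b - a)) /\
  (v a ^+ 2 + L ^+ 2 * u a ^+ 2) * expR (- (4 * d + L) * (b - a)) <=
    v b ^+ 2 + L ^+ 2 * u b ^+ 2.
Proof.
move=> d0 L0 c01 ab uv.
pose E t := v t ^+ 2 + L ^+ 2 * u t ^+ 2.
pose E' t := 2 * v t * (- (2 * d) * v t - L ^+ 2 * c t * u t) + L ^+ 2 * (2 * u t * v t).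
have dE (t : R) : a <= t <= b -> is_derive t 1 E (E' t).
  move=> /uv[du dv].
  exact: (is_derive_addf (is_derive_sqr dv) (is_derive_scalef (L ^+ 2) (is_derive_sqr du))).
have EE t : - (4 * d + L) * E t <= E' t <= (4 * d + L) * E t.
  have /andP[c0 c1] := c01 t; rewrite /E /E'.
  move: (u t) (v t) (c t) c0 c1 => x y z z0 z1.
  have h1 : 0 <= L * (1 - z) * (y - L * x) ^+ 2 by apply: mulr_ge0 (sqr_ge0 _); rewrite mulr_ge0 ?subr_ge0.
  have h2 : 0 <= L * (1 - z) * (y + L * x) ^+ 2 by apply: mulr_ge0 (sqr_ge0 _); rewrite mulr_ge0 ?subr_ge0.
  have h3 : 0 <= L * z * (y ^+ 2 + L ^+ 2 * x ^+ 2).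
    apply: mulr_ge0; first exact: mulr_ge0.
    by apply: addr_ge0; [exact: sqr_ge0|apply: mulr_ge0; exact: sqr_ge0].
  have h4 : 0 <= d * (L ^+ 2 * x ^+ 2).
    by apply: mulr_ge0 => //; apply: mulr_ge0; exact: sqr_ge0.
  have h5 : 0 <= d * y ^+ 2 by exact: mulr_ge0 (sqr_ge0 _).
  by apply/andP; split; nra.
split.
  by apply: (gronwall_le ab dE) => t _; have /andP[] := EE t.
by apply: (gronwall_ge ab dE) => t _; have /andP[] := EE t.
Qed.

Lemma mode_unique (R : realType) (d L : R) (c u v u1 v1 : R -> R) (a b : R) :
  0 <= d -> 0 < L -> (forall t, 0 <= c t <= 1) -> a <= b ->
  mode_on d L c u v a b -> mode_on d L c u1 v1 a b ->
  u a = u1 a -> v a = v1 a -> u b = u1 b /\ v b = v1 b.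
Proof.
move=> d0 L0 c01 ab uv uv1 ua va.
have w : mode_on d L c (fun t => u t - u1 t) (fun t => v t - v1 t) a b.
  move=> t tab; have [du dv] := uv t tab; have [du1 dv1] := uv1 t tab; split.
    exact: is_derive_subf.
  by apply: (is_derive_eq (is_derive_subf dv dv1)); ring.
have [h _] := mode_energy_bounds d0 (ltW L0) c01 ab w.
move: h; rewrite ua va !subrr expr0n /= mulr0 addr0 mul0r => h.
have h1 : 0 <= (v b - v1 b) ^+ 2 by exact: sqr_ge0.
have h2 : 0 <= L ^+ 2 * (u b - u1 b) ^+ 2 by apply: mulr_ge0; exact: sqr_ge0.
have e1 : (v b - v1 b) ^+ 2 = 0 by lra.
have e2 : L ^+ 2 * (u b - u1 b) ^+ 2 = 0 by lra.
move/eqP: e1; rewrite sqrf_eq0 subr_eq0 => /eqP e1.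
by move/eqP: e2; rewrite mulf_eq0 sqrf_eq0 gt_eqF //= sqrf_eq0 subr_eq0 => /eqP e2.
Qed.

Section resonance.
Context (R : realType) (k : nat) (alpha : R) (P : cascade k alpha) (j : nat) (d B : R).

(** The phase of the ripple. *)
Definition phase (t : R) : R := freq P j * (t - 5 / scale R j).

(** The rate of growth that the ripple produces. *)
Definition growth_rate (t : R) : R :=
  2 * eps P * freq P j * envelope (step P) j t * sin (phase t) ^+ 2.

(** The logarithm of the amplification since the start of the ripple. *)
Definition growth : R -> R := antiderivative (5 / scale R j) growth_rate.

(** The explicit solution on [5 / scale j, 8 / scale j], where the coefficient
    ripples. *)
Definition resonant (t : R) : R :=
  B / freq P j * (expR (growth t - d * (t - 5 / scale R j)) * sin (phase t)).

(** Its derivative. *)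
Definition resonant' (t : R) : R :=
  B / freq P j * (expR (growth t - d * (t - 5 / scale R j)) *
    (freq P j * cos (phase t) + (growth_rate t - d) * sin (phase t))).

End resonance.

Lemma is_derive_envelope (R : realType) k (alpha : R) (P : cascade k alpha) j (t : R) :
  is_derive t 1 (envelope (step P) j) (envelope' (step P) (step' P) j t).
Proof.
have d1 := is_derive_compf (step_derive P _) (is_derive_affine (scale R j) (5 / scale R j) t).
have d2 := is_derive_compf (step_derive P _) (is_derive_affine (- scale R j) (8 / scale R j) t).
apply: (is_derive_eq (is_derive_mulf d1 d2)).
by rewrite /envelope'; ring.
Qed.

Lemma is_derive_phase (R : realType) k (alpha : R) (P : cascade k alpha) j (t : R) :
  is_derive t 1 (phase P j) (freq P j).
Proof. exact: is_derive_affine. Qed.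

Lemma is_derive_growth_rate (R : realType) k (alpha : R) (P : cascade k alpha) j (t : R) :
  is_derive t 1 (growth_rate P j)
    (2 * eps P * freq P j * (envelope' (step P) (step' P) j t * sin (phase P j t) ^+ 2 +
      envelope (step P) j t * (2 * sin (phase P j t) * (cos (phase P j t) * freq P j)))).
Proof.
have ds := is_derive_sqr (is_derive_compf (is_derive_sin _) (is_derive_phase P j t)).
have d1 := is_derive_scalef (2 * eps P * freq P j) (is_derive_envelope P j t).
by apply: (is_derive_eq (is_derive_mulf d1 ds)); ring.
Qed.

Lemma growthP (R : realType) k (alpha : R) (P : cascade k alpha) j :
  growth P j (5 / scale R j) = 0 /\
  forall t : R, is_derive t 1 (growth P j) (growth_rate P j t).
Proof.
apply: antiderivativeP => t; exact: is_derive_continuous (is_derive_growth_rate P j t).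
Qed.

Lemma resonant_mode (R : realType) k (alpha : R) (P : cascade k alpha) j (d L B : R) :
  L ^+ 2 * level P j = d ^+ 2 + freq P j ^+ 2 ->
  L ^+ 2 * depth P j = freq P j ^+ 2 ->
  mode_on d L (coefficient P) (resonant P j d B) (resonant' P j d B)
    (5 / scale R j) (8 / scale R j).
Proof.
move=> Llev Ldep t tj; have m0 := freq_gt0 P j.
have [_ dg] := growthP P j.
have daff : is_derive t 1 (fun s => d * (s - 5 / scale R j)) d by exact: is_derive_affine.
have de := is_derive_compf (is_derive_expR _) (is_derive_subf (dg t) daff).
have ds := is_derive_compf (is_derive_sin _) (is_derive_phase P j t).
have dc := is_derive_compf (is_derive_cos _) (is_derive_phase P j t).
have dr := is_derive_growth_rate P j t.
split.
  apply: (is_derive_eq (is_derive_scalef (B / freq P j) (is_derive_mulf de ds))).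
  by rewrite /resonant'; ring.
have dr' := is_derive_mulf (is_derive_subf dr (is_derive_const t d)) ds.
have d1 := is_derive_addf (is_derive_scalef (freq P j) dc) dr'.
apply: (is_derive_eq (is_derive_scalef (B / freq P j) (is_derive_mulf de d1))).
rewrite (coefficient_plateau P tj).
have -> : L ^+ 2 * (level P j + depth P j * rip P j t) =
    d ^+ 2 + freq P j ^+ 2 + freq P j ^+ 2 * rip P j t.
  by rewrite mulrDr Llev mulrA Ldep.
rewrite /resonant /resonant' /rip /ripple -/(phase P j t) /growth_rate.
set E := expR _; set S := sin _; set C := cos _.
by field; rewrite gt_eqF.
Qed.

Lemma growth_end (R : realType) k (alpha : R) (P : cascade k alpha) j :
  eps P * (freq P j / scale R j - 1) <= growth P j (8 / scale R j).
Proof.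
have s0 := scale_gt0 R j; have m0 := freq_gt0 P j; have e0 := eps_gt0 P.
have i0 : 0 < (scale R j)^-1 by rewrite invr_gt0.
have [g0 dg] := growthP P j.
have gr0 t : 0 <= growth_rate P j t.
  have /andP[h1 _] := (step_bounds P (scale R j * (t - 5 / scale R j))).1.
  have /andP[h2 _] := (step_bounds P (- scale R j * (t - 8 / scale R j))).1.
  apply: mulr_ge0; last exact: sqr_ge0.
  apply: mulr_ge0; last exact: mulr_ge0.
  by rewrite !mulr_ge0 // ltW.
have mono x y : x <= y -> growth P j x <= growth P j y.
  by move=> xy; apply: (is_derive_ge0_le xy (f' := growth_rate P j)).
have h5 : growth P j (5 / scale R j) <= growth P j (6 / scale R j) by apply: mono; lra.
have h7 : growth P j (7 / scale R j) <= growth P j (8 / scale R j) by apply: mono; lra.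
(* where the envelope is 1 the growth is explicit *)
pose G t := eps P * (phase P j t - sin (phase P j t) * cos (phase P j t)).
have h67 : 6 / scale R j <= 7 / scale R j by lra.
have hD t : 6 / scale R j <= t <= 7 / scale R j ->
    is_derive t 1 (fun s => growth P j s - G s) 0.
  move=> /andP[t6 t7].
  have ds := is_derive_compf (is_derive_sin _) (is_derive_phase P j t).
  have dc := is_derive_compf (is_derive_cos _) (is_derive_phase P j t).
  have dG := is_derive_scalef (eps P) (is_derive_subf (is_derive_phase P j t) (is_derive_mulf ds dc)).
  apply: (is_derive_eq (is_derive_subf (dg t) dG)).
  have c2 := cos2Dsin2 (phase P j t).
  rewrite /growth_rate /envelope.
  have -> : step P (scale R j * (t - 5 / scale R j)) = 1.
    apply: (step_ge1 P _).1.
    have : scale R j * (6 / scale R j) <= scale R j * t by rewrite ler_pM2l.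
    by rewrite mulrBr !(mulrCA (scale R j)) divff ?gt_eqF //; lra.
  have -> : step P (- scale R j * (t - 8 / scale R j)) = 1.
    apply: (step_ge1 P _).1.
    have : scale R j * t <= scale R j * (7 / scale R j) by rewrite ler_pM2l.
    by rewrite mulNr mulrBr !(mulrCA (scale R j)) divff ?gt_eqF //; lra.
  move: c2; set S := sin _; set C := cos _ => c2.
  have -> : 2 * eps P * freq P j * (1 * 1) * S ^+ 2 -
      eps P * (freq P j - (C * freq P j * C + S * (- S * freq P j))) =
     eps P * freq P j * (C ^+ 2 + S ^+ 2 - 1) by ring.
  by rewrite c2 subrr mulr0.
have e := is_derive0_eq h67 hD.
have sc t : `|sin (phase P j t) * cos (phase P j t)| <= 1 / 2.
  have := cos2Dsin2 (phase P j t); set S := sin _; set C := cos _ => c2.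
  have p1 := sqr_ge0 (S - C); have p2 := sqr_ge0 (S + C).
  by rewrite ler_norml; apply/andP; split; nra.
have ph : phase P j (7 / scale R j) - phase P j (6 / scale R j) = freq P j / scale R j.
  by rewrite /phase; ring.
have := sc (7 / scale R j); have := sc (6 / scale R j); rewrite !ler_norml.
move=> /andP[a1 a2] /andP[b1 b2].
have : eps P * (freq P j / scale R j - 1) <= G (7 / scale R j) - G (6 / scale R j).
  by rewrite /G -mulrBr ler_pM2l // -ph; lra.
by move: g0 e h5 h7; lra.
Qed.

(** * Energy estimates for one mode *)

Lemma Ck_hoelder_continuous (R : realType) k (alpha : R) (f : R -> R) :
  Ck_hoelder k alpha f -> continuous f.
Proof.
case: k => [|k] [df cf _]; first exact: cf.
by move=> x; apply: differentiable_continuous; apply/derivable1_diffP; exact: (df 0%N).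
Qed.

(** Backwards from the start of the [j]-th ripple to the initial time the
    energy grows by a factor that involves only the damping: the coefficient
    increases on the rise, and before that it is too small to matter. *)
Lemma mode_backward (R : realType) k (alpha : R) (P : cascade k alpha) j (d L : R) (u v : R -> R) :
  0 <= d -> 4 * L ^+ 2 * level P j.+1 <= 1 ->
  mode_on d L (coefficient P) u v 0 (5 / scale R j) -> u (5 / scale R j) = 0 ->
  v 0 ^+ 2 + u 0 ^+ 2 <= v (5 / scale R j) ^+ 2 * expR (4 * d + 1).
Proof.
move=> d0 small uv u5; set c : R -> R := coefficient P.
have i0 : 0 < (scale R j)^-1 by rewrite invr_gt0 scale_gt0.
have i1 : (scale R j)^-1 <= 1 / 8.
  by have := @inv_scale_le R 0 j (leq0n j); rewrite /scale add0n; lra.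
have ab : 4 / scale R j <= 5 / scale R j by lra.
(* the term u^2 keeps control of u although c may be arbitrarily small *)
pose F t := v t ^+ 2 + (1 + L ^+ 2 * c t) * u t ^+ 2.
pose F' t := 2 * v t * (- (2 * d) * v t - L ^+ 2 * c t * u t) +
  ((0 + L ^+ 2 * derive1 c t) * u t ^+ 2 + (1 + L ^+ 2 * c t) * (2 * u t * v t)).
have dF (t : R) : 4 / scale R j <= t <= 5 / scale R j -> is_derive t 1 F (F' t).
  move=> /andP[t4 t5]; have [du dv] : is_derive t 1 u (v t) /\
      is_derive t 1 v (- (2 * d) * v t - L ^+ 2 * c t * u t).
    by apply: uv; apply/andP; split => //; lra.
  have t0 : 0 < t by lra.
  have dc := is_derive_addf (is_derive_const t 1) (is_derive_scalef (L ^+ 2) (coefficient_derivable P t0)).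
  exact: (is_derive_addf (is_derive_sqr dv) (is_derive_mulf dc (is_derive_sqr du))).
have rise : F (4 / scale R j) <= F (5 / scale R j) * expR ((4 * d + 1) / scale R j).
  have := @gronwall_ge R F F' (4 * d + 1) _ _ ab dF.
  have -> : 5 / scale R j - 4 / scale R j = (scale R j)^-1 by lra.
  rewrite mulNr expRN ler_pdivrMr ?expR_gt0 // => H; apply: H => t tj.
  have cr := coefficient_rise P tj; have c0 := coefficient_ge0 P t.
  rewrite /F /F' -/c; rewrite -/c in cr c0.
  have h1 : 0 <= L ^+ 2 * derive1 c t * u t ^+ 2.
    by apply: mulr_ge0 (sqr_ge0 _); apply: mulr_ge0 (sqr_ge0 _) _.
  have h2 : 0 <= L ^+ 2 * c t * u t ^+ 2.
    by apply: mulr_ge0 (sqr_ge0 _); apply: mulr_ge0 (sqr_ge0 _) _.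
  have h3 : 0 <= d * u t ^+ 2 by exact: mulr_ge0 (sqr_ge0 _).
  have h4 : 0 <= d * (L ^+ 2 * c t * u t ^+ 2) by exact: mulr_ge0.
  have h5 := sqr_ge0 (u t + v t).
  by nra.
pose G t := v t ^+ 2 + u t ^+ 2.
pose G' t := 2 * v t * (- (2 * d) * v t - L ^+ 2 * c t * u t) + 2 * u t * v t.
have a0 : 0 <= 4 / scale R j by lra.
have start : G 0 <= G (4 / scale R j) * expR ((4 * d + 1) * (4 / scale R j)).
  have dG (t : R) : 0 <= t <= 4 / scale R j -> is_derive t 1 G (G' t).
    move=> /andP[t4 t5]; have [du dv] : is_derive t 1 u (v t) /\
      is_derive t 1 v (- (2 * d) * v t - L ^+ 2 * c t * u t).
      by apply: uv; apply/andP; split => //; lra.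
    exact: (is_derive_addf (is_derive_sqr dv) (is_derive_sqr du)).
  have := @gronwall_ge R G G' (4 * d + 1) _ _ a0 dG.
  rewrite subr0 mulNr expRN ler_pdivrMr ?expR_gt0 // => H; apply: H => t /andP[_ t4].
  have c0 : 0 <= c t by exact: coefficient_ge0.
  have z1 : L ^+ 2 * c t <= 1.
    have tS : t <= 8 / scale R j.+1 by move: t4; rewrite (inv_scaleS R j); lra.
    have := ler_wpM2l (sqr_ge0 L) (coefficient_le_level P tS); rewrite -/c; lra.
  have z0 : 0 <= L ^+ 2 * c t by apply: mulr_ge0 (sqr_ge0 _) _.
  rewrite /G /G'; move: (L ^+ 2 * c t) (u t) (v t) z0 z1 => z x y z0 z1.
  have h1 : 0 <= (1 - z) * (x + y) ^+ 2 by apply: mulr_ge0 (sqr_ge0 _); lra.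
  have h2 : 0 <= z * (x ^+ 2 + y ^+ 2) by apply: mulr_ge0 => //; apply: addr_ge0; exact: sqr_ge0.
  have h3 : 0 <= d * x ^+ 2 by exact: mulr_ge0 (sqr_ge0 _).
  by nra.
have FG : G (4 / scale R j) <= F (4 / scale R j).
  rewrite /G /F lerD2l; apply: ler_peMl; first exact: sqr_ge0.
  by rewrite lerDl; apply: mulr_ge0 (sqr_ge0 _) _; exact: coefficient_ge0.
apply: (le_trans start); apply: le_trans (ler_wpM2r (expR_ge0 _) (le_trans FG rise)) _.
rewrite {1}/F u5 expr0n /= mulr0 addr0 -mulrA -expRD; apply: ler_wpM2l; first exact: sqr_ge0.
rewrite ler_expR.
have : (4 * d + 1) * (5 * (scale R j)^-1) <= (4 * d + 1) * 1 by apply: ler_wpM2l; lra.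
by lra.
Qed.

(** After the [j]-th block the energy can only decrease through the damping and
    the later ripples, which are slow. *)
Lemma mode_forward (R : realType) k (alpha : R) (P : cascade k alpha) j (d L K t : R) (u v : R -> R) :
  0 <= d -> 0 <= K ->
  (forall s : R, 8 / scale R j <= s -> - K * coefficient P s <= derive1 (coefficient P) s) ->
  8 / scale R j <= t ->
  mode_on d L (coefficient P) u v (8 / scale R j) t ->
  (v (8 / scale R j) ^+ 2 + L ^+ 2 * coefficient P (8 / scale R j) * u (8 / scale R j) ^+ 2) *
    expR (- (4 * d + K) * t) <= v t ^+ 2 + L ^+ 2 * u t ^+ 2.
Proof.
move=> d0 K0 cK jt uv; set c : R -> R := coefficient P.
have i0 : 0 < (scale R j)^-1 by rewrite invr_gt0 scale_gt0.
pose G s := v s ^+ 2 + L ^+ 2 * c s * u s ^+ 2.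
pose G' s := 2 * v s * (- (2 * d) * v s - L ^+ 2 * c s * u s) +
  (L ^+ 2 * derive1 c s * u s ^+ 2 + L ^+ 2 * c s * (2 * u s * v s)).
have dG (s : R) : 8 / scale R j <= s <= t -> is_derive s 1 G (G' s).
  move=> /[dup] /andP[s8 _] /uv[du dv].
  have s0 : 0 < s by lra.
  have dc := is_derive_scalef (L ^+ 2) (coefficient_derivable P s0).
  exact: (is_derive_addf (is_derive_sqr dv) (is_derive_mulf dc (is_derive_sqr du))).
have c0 s : 0 <= c s by exact: coefficient_ge0.
have q0 s : 0 <= L ^+ 2 * c s * u s ^+ 2.
  by apply: mulr_ge0 (sqr_ge0 _); apply: mulr_ge0 (sqr_ge0 _) _.
have G0 s : 0 <= G s by apply: addr_ge0 (sqr_ge0 _) _.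
have gr : G (8 / scale R j) * expR (- (4 * d + K) * (t - 8 / scale R j)) <= G t.
  apply: (gronwall_ge jt dG) => s /andP[s8 _]; rewrite /G /G'.
  have h1 : 0 <= L ^+ 2 * u s ^+ 2 * (derive1 c s + K * c s).
    apply: mulr_ge0; first by apply: mulr_ge0; exact: sqr_ge0.
    by have := cK s s8; rewrite -/c; lra.
  have h2 : 0 <= d * (L ^+ 2 * c s * u s ^+ 2) by exact: mulr_ge0.
  have h3 : 0 <= K * v s ^+ 2 by exact: mulr_ge0 (sqr_ge0 _).
  by nra.
have Gt : G t <= v t ^+ 2 + L ^+ 2 * u t ^+ 2.
  rewrite /G lerD2l; apply: ler_wpM2r; first exact: sqr_ge0.
  by rewrite ler_piMr ?sqr_ge0 // coefficient_le1.
apply: le_trans (le_trans gr Gt); apply: ler_wpM2l; first exact: G0.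
rewrite ler_expR !mulNr lerN2; apply: ler_wpM2l; last by lra.
by rewrite addr_ge0 // mulr_ge0.
Qed.

Lemma resonant_energy (R : realType) k (alpha : R) (P : cascade k alpha) j (d L B : R) :
  0 <= d -> eps P <= 1 -> L ^+ 2 * level P j = d ^+ 2 + freq P j ^+ 2 ->
  B ^+ 2 / 2 * expR (2 * eps P * (freq P j / scale R j) - 2 - 2 * d) <=
  resonant' P j d B (8 / scale R j) ^+ 2 +
    L ^+ 2 * coefficient P (8 / scale R j) * resonant P j d B (8 / scale R j) ^+ 2.
Proof.
move=> d0 e1 Llev; have s0 := scale_gt0 R j; have m0 := freq_gt0 P j.
have i0 : 0 < (scale R j)^-1 by rewrite invr_gt0.
have i1 : (scale R j)^-1 <= 1 / 8.
  by have := @inv_scale_le R 0 j (leq0n j); rewrite /scale add0n; lra.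
have -> : coefficient P (8 / scale R j) = level P j.
  have h : 5 / scale R j <= 8 / scale R j <= 8 / scale R j by rewrite lexx andbT; lra.
  by rewrite (coefficient_plateau P h) rip_eq0 ?mulr0 ?addr0 //; right.
rewrite Llev /resonant /resonant'.
have -> : growth_rate P j (8 / scale R j) = 0.
  have [e0 _] := envelope_eq0 P (or_intror (lexx (8 / scale R j))).
  by rewrite /growth_rate e0 mulr0 mul0r.
have ge := growth_end P j; set g := growth P j _ in ge *.
have c2 := cos2Dsin2 (phase P j (8 / scale R j)).
move: c2; set S := sin _; set C := cos _ => c2.
have -> : 8 / scale R j - 5 / scale R j = 3 / scale R j by lra.
set E := expR (g - _); set m := freq P j in m0 ge *.
have -> : (B / m * (E * (m * C + (0 - d) * S))) ^+ 2 + (d ^+ 2 + m ^+ 2) * (B / m * (E * S)) ^+ 2 =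
   (B * E / m) ^+ 2 * ((m * C - d * S) ^+ 2 + (d ^+ 2 + m ^+ 2) * S ^+ 2) by ring.
have h : m ^+ 2 / 2 <= (m * C - d * S) ^+ 2 + (d ^+ 2 + m ^+ 2) * S ^+ 2.
  have -> : m ^+ 2 / 2 = m ^+ 2 / 2 * (C ^+ 2 + S ^+ 2) by rewrite c2 mulr1.
  have h1 := sqr_ge0 (m * C - 2 * d * S); have h2 := sqr_ge0 (m * S).
  by nra.
apply: le_trans (ler_wpM2l (sqr_ge0 _) h).
have -> : (B * E / m) ^+ 2 * (m ^+ 2 / 2) = B ^+ 2 / 2 * (E * E) by field; rewrite gt_eqF.
apply: ler_wpM2l; first by rewrite mulr_ge0 ?sqr_ge0.
rewrite -expRD ler_expR.
have : d * (3 * (scale R j)^-1) <= d * 1 by apply: ler_wpM2l; lra.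
have e0 := eps_gt0 P.
by move: ge; rewrite mulrBr; lra.
Qed.

(** One resonant mode: exponentially small at the initial time, exponentially
    large after its block. *)
Lemma resonant_mode_exists (R : realType) k (alpha : R) (P : cascade k alpha) j (d L K : R) :
  0 < alpha -> alpha <= 1 -> eps P <= 1 -> 0 <= d -> 1 <= L -> 0 <= K ->
  (forall s : R, 8 / scale R j <= s -> - K * coefficient P s <= derive1 (coefficient P) s) ->
  L ^+ 2 * level P j = d ^+ 2 + freq P j ^+ 2 ->
  L ^+ 2 * depth P j = freq P j ^+ 2 ->
  4 * L ^+ 2 * level P j.+1 <= 1 ->
  exists u v : R -> R,
  [/\ forall t : R, is_derive t 1 u (v t) /\
        is_derive t 1 v (- (2 * d) * v t - L ^+ 2 * coefficient P t * u t),
      forall t, 0 <= t ->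
        v t ^+ 2 + L ^+ 2 * u t ^+ 2 <= expR ((4 * d + L) * (1 + t)),
      v 0 ^+ 2 + u 0 ^+ 2 <= expR (- (eps P * freq P j / scale R j) + 4 * d + 1)
    & forall t, 8 / scale R j <= t ->
        expR (eps P * freq P j / scale R j - 2 - 2 * d - (4 * d + K) * t) / 2 <=
        v t ^+ 2 + L ^+ 2 * u t ^+ 2].
Proof.
move=> a0 a1 e1 d0 L1 K0 cK Llev Ldep small.
have L0 : 0 < L by apply: lt_le_trans L1.
set c : R -> R := coefficient P; set Gam := eps P * freq P j / scale R j.
have s0 := scale_gt0 R j; have m0 := freq_gt0 P j; have e0 := eps_gt0 P.
have i0 : 0 < (scale R j)^-1 by rewrite invr_gt0.
have i1 : (scale R j)^-1 <= 1 / 8.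
  by have := @inv_scale_le R 0 j (leq0n j); rewrite /scale add0n; lra.
have c01 t : 0 <= c t <= 1 by rewrite coefficient_ge0 coefficient_le1.
have cc : continuous (fun t => L ^+ 2 * c t).
  move=> t; apply: cvgM; first exact: cvg_cst.
  exact: (Ck_hoelder_continuous (coefficient_Ck_hoelder P a0 a1)).
have cQ t : `|L ^+ 2 * c t| <= L ^+ 2.
  have /andP[c0 c1] := c01 t.
  by rewrite normrM !ger0_norm ?sqr_ge0 // ler_piMr ?sqr_ge0.
(* half of the growth is spent on making the data small *)
pose B := expR (- Gam / 2).
have B2 : B ^+ 2 = expR (- Gam) by rewrite expr2 -expRD; congr expR; lra.
have [u [v [u5 v5 du dv]]] := linear_ode_exists (5 / scale R j) 0 B cc cQ d0.
have uv (a b : R) : mode_on d L c u v a b by move=> t _; split.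
exists u, v; split.
- by move=> t; split.
- move=> t t0; have E5 : v (5 / scale R j) ^+ 2 + L ^+ 2 * u (5 / scale R j) ^+ 2 <= 1.
    rewrite u5 v5 expr0n /= mulr0 addr0 B2 expR_le1.
    by rewrite oppr_le0 /Gam mulr_ge0 ?mulr_ge0 // ltW.
  have dL : 0 <= 4 * d + L by rewrite addr_ge0 ?mulr_ge0 // ltW.
  have lift (x : R) : x <= 1 + t ->
      (v (5 / scale R j) ^+ 2 + L ^+ 2 * u (5 / scale R j) ^+ 2) * expR ((4 * d + L) * x) <=
      expR ((4 * d + L) * (1 + t)).
    move=> xt; apply: le_trans (ler_wpM2r (expR_ge0 _) E5) _.
    by rewrite mul1r ler_expR; exact: ler_wpM2l.
  case: (leP (5 / scale R j) t) => tj.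
    have [h _] := mode_energy_bounds d0 (ltW L0) c01 tj (uv _ _).
    by apply: (le_trans h); apply: lift; lra.
  have [_] := mode_energy_bounds d0 (ltW L0) c01 (ltW tj) (uv _ _).
  rewrite mulNr expRN ler_pdivrMr ?expR_gt0 // => h.
  by apply: (le_trans h); apply: lift; lra.
- apply: le_trans (mode_backward d0 small (uv _ _) u5) _.
  by rewrite v5 B2 -expRD addrA.
move=> t tj.
have ab : 5 / scale R j <= 8 / scale R j by lra.
have [g0 _] := growthP P j.
have [u8 v8] := mode_unique d0 L0 c01 ab (uv _ _) (resonant_mode B Llev Ldep)
  ltac:(by rewrite u5 /resonant /phase !subrr !mulr0 sin0 !mulr0)
  ltac:(by rewrite v5 /resonant' /phase g0 !subrr !mulr0 sin0 cos0 mulr0 addr0 subr0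
    expR0 mul1r mulr1 divfK // gt_eqF).
apply: le_trans (mode_forward d0 K0 cK tj (uv _ _)).
have := resonant_energy B d0 e1 Llev; rewrite -u8 -v8 B2 => h.
apply: le_trans (ler_wpM2r (expR_ge0 _) h).
rewrite mulrAC -mulrA -expRD mulrAC -expRD.
rewrite ler_pM2r ?invr_gt0 // ler_expR /Gam.
by lra.
Qed.

(** * The choice of the eigenvalues *)

Lemma ripple_small_exists (R : realType) (th th' : R -> R) :
  (forall x, 0 <= th x <= 1 /\ 0 <= th' x) -> (exists K, forall x, th' x <= K) ->
  exists e, [/\ 0 < e, e <= 1 & forall (m : nat -> R), (forall j, scale R j <= m j) ->
    forall j t, `|e * ripple th th' e m j t| <= 1 / 2].
Proof.
move=> thb [K HK].
have K0 : 0 <= K by apply: le_trans (HK 0); exact: (thb 0).2.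
exists (2 * (12 + 4 * K))^-1.
have D0 : 0 < 2 * (12 + 4 * K) by lra.
have e0 : 0 < (2 * (12 + 4 * K))^-1 by rewrite invr_gt0.
have e1 : (2 * (12 + 4 * K))^-1 <= 1 by rewrite invf_le1 //; lra.
split => // m sm j t; rewrite normrM (gtr0_norm e0) mulrC ler_pdivrMr //.
move: (2 * _)^-1 e0 e1 => e e0 e1.
rewrite (_ : 1 / 2 * _ = 12 + 4 * K); last by field.
rewrite /ripple /envelope /envelope'; set s := m j * _.
have m0 : 0 < m j by apply: lt_le_trans (sm j); exact: scale_gt0.
have [/andP[a0 a1] a'0] := thb (scale R j * (t - 5 / scale R j)).
have [/andP[b0 b1] b'0] := thb (- scale R j * (t - 8 / scale R j)).
have a'K := HK (scale R j * (t - 5 / scale R j)).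
have b'K := HK (- scale R j * (t - 8 / scale R j)).
move: (th (scale R j * (t - 5 / scale R j))) (th (- scale R j * (t - 8 / scale R j)))
  (th' (scale R j * (t - 5 / scale R j))) (th' (- scale R j * (t - 8 / scale R j)))
  a0 a1 a'0 a'K b0 b1 b'0 b'K => a b a' b' a0 a1 a'0 a'K b0 b1 b'0 b'K.
have sS := sin_max s; have sC := cos_max s.
have ab1 : `|a * b| <= 1 by rewrite ger0_norm ?mulr_ge0 // mulr_ile1.
have s2 : `|sin s ^+ 2| <= 1 by rewrite normrX exprn_ile1.
have s4 : `|sin s ^+ 4| <= 1 by rewrite normrX exprn_ile1.
have sc : `|sin s * cos s| <= 1 by rewrite normrM mulr_ile1.
have p1 : `|8 * (a * b) * (sin s * cos s)| <= 8.
  by rewrite normrM normrM normr_nat -mulrA ler_piMr // mulr_ile1.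
have p3 : `|4 * e * (a * b) ^+ 2 * sin s ^+ 4| <= 4.
  have q : `|e * ((a * b) ^+ 2 * sin s ^+ 4)| <= 1.
    rewrite normrM mulr_ile1 // ?(gtr0_norm e0) // normrM mulr_ile1 //.
    by rewrite normrX exprn_ile1.
  have -> : 4 * e * (a * b) ^+ 2 * sin s ^+ 4 = 4 * (e * ((a * b) ^+ 2 * sin s ^+ 4)) by ring.
  by rewrite normrM normr_nat ler_piMr.
have p2 : `|2 * (scale R j * (a' * b - a * b') / m j) * sin s ^+ 2| <= 4 * K.
  have h : `|a' * b - a * b'| <= 2 * K.
    have q1 : 0 <= a' * b <= K by rewrite mulr_ge0 //= -[K]mulr1 ler_pM.
    have q2 : 0 <= a * b' <= K by rewrite mulr_ge0 //= -[K]mul1r ler_pM.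
    move: q1 q2 => /andP[? ?] /andP[? ?].
    by rewrite ler_norml; apply/andP; split; lra.
  have h2 : `|scale R j * (a' * b - a * b') / m j| <= 2 * K.
    rewrite 2!normrM normfV (gtr0_norm (scale_gt0 R j)) (gtr0_norm m0) ler_pdivrMr // mulrC.
    by apply: ler_pM => //; exact: ltW (scale_gt0 R j).
  rewrite 2!normrM normr_nat; have -> : 4 * K = 2 * (2 * K) * 1 by ring.
  by apply: ler_pM => //; rewrite ler_pM2l.
rewrite normrN; apply: le_trans (ler_normD _ _) _.
by apply: le_trans (lerD (ler_normD _ _) (lexx _)) _; lra.
Qed.

Lemma powR_dominated (R : realType) (A p q : R) : p < q ->
  \forall y \near +oo, A * y `^ p <= y `^ q.
Proof.
move=> pq; have qp : 0 < q - p by rewrite subr_gt0.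
near=> y.
have y1 : 1 <= y by near: y; exact: nbhs_pinfty_ge.
have y0 : 0 < y by apply: lt_le_trans y1.
have yA : `|A| `^ (q - p)^-1 <= y by near: y; exact: nbhs_pinfty_ge.
have h : `|A| <= y `^ (q - p).
  have -> : `|A| = (`|A| `^ (q - p)^-1) `^ (q - p).
    by rewrite -powRrM mulVf ?gt_eqF // powRr1.
  by apply: ge0_ler_powR; rewrite ?nnegrE ?powR_ge0 // ltW.
have -> : y `^ q = y `^ (q - p) * y `^ p.
  by rewrite -powRD ?subrK // (gt_eqF y0) implybT.
apply: ler_wpM2r; first exact: powR_ge0.
by apply: le_trans h; exact: ler_norm.
Unshelve. all: by end_near. Qed.

Section spectral_parameters.
Context (R : realType) (k : nat) (alpha delta sigma : R).

(** The critical exponent: the reciprocal of 1 + (k + alpha) / 2. *)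
Definition critical : R := 2 / (2 + k%:R + alpha).

(** Half the coefficient of the first-order term, at the eigenvalue [y]. *)
Definition damping (y : R) : R := delta * y `^ (2 * sigma).

(** The frequency of the ripple of the [j]-th block, if [y] is the [j]-th chosen
    eigenvalue; below, the corresponding plateau value and amplitude. *)
Definition freq_at j (y : R) : R := y `^ critical / 2 ^+ j.

Definition level_at j (y : R) : R := (damping y ^+ 2 + freq_at j y ^+ 2) / y ^+ 2.

Definition depth_at j (y : R) : R := freq_at j y ^+ 2 / y ^+ 2.

(** What is required of the [j]-th chosen eigenvalue [y]. *)
Definition good (e : R) j (y : R) : Prop :=
  [/\ 1 <= y /\ j%:R <= y, damping y <= freq_at j y, scale R j <= freq_at j y,
      8 * j.+1%:R * (damping y + y `^ (critical * (1 - j.+2%:R^-1)) + 1) <=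
        e * freq_at j y / scale R j
    & level_at j y <= 1 / 4].

(** What is required of two consecutive chosen eigenvalues. *)
Definition sparse (e : R) j (x y : R) : Prop :=
  [/\ level_at j.+1 y <= level_at j x / 2,
      4 * x ^+ 2 * level_at j.+1 y <= 1, freq_at j x <= freq_at j.+1 y
    & 8 * j.+2%:R * (j.+1%:R * freq_at j x) <= e * freq_at j.+1 y / scale R j.+1].

End spectral_parameters.

Lemma critical_gt0 (R : realType) k (alpha : R) : 0 < alpha -> 0 < critical k alpha.
Proof. by move=> a0; rewrite divr_gt0 // addr_gt0 // ltr_pwDl. Qed.

Lemma critical_lt1 (R : realType) k (alpha : R) : 0 < alpha -> critical k alpha < 1.
Proof.
move=> a0; have k0 : 0 <= k%:R :> R by [].
by rewrite ltr_pdivrMr; lra.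
Qed.

Lemma freq_at_large (R : realType) k (alpha e M : R) j : 0 < alpha -> 0 < e ->
  \forall y \near +oo, M <= e * freq_at k alpha j y.
Proof.
move=> a0 e0; have := powR_dominated (M * 2 ^+ j / e) (critical_gt0 k a0).
apply: filterS => y; rewrite powRr0 mulr1 ler_pdivrMr // => h.
by rewrite /freq_at mulrA ler_pdivlMr ?exprn_gt0 // (mulrC e).
Qed.

Lemma freq_at_dominates (R : realType) k (alpha e M p : R) j : p < critical k alpha -> 0 < e ->
  \forall y \near +oo, M * y `^ p <= e * freq_at k alpha j y.
Proof.
move=> pc e0; have := powR_dominated (M * 2 ^+ j / e) pc.
apply: filterS => y; rewrite mulrAC ler_pdivrMr // => h.
by rewrite /freq_at mulrA ler_pdivlMr ?exprn_gt0 // (mulrC e) mulrAC.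
Qed.

Lemma sigma_subcritical (R : realType) k (alpha sigma : R) : 0 < alpha ->
  sigma < 1 / (2 + k%:R + alpha) -> 2 * sigma < critical k alpha.
Proof. by rewrite /critical; lra. Qed.

Lemma freq_at_le (R : realType) k (alpha : R) j y : freq_at k alpha j y <= y `^ critical k alpha.
Proof. by rewrite ler_pdivrMr ?exprn_gt0 // ler_peMr ?powR_ge0 // exprn_ege1 // ler1n. Qed.

Lemma level_at_small (R : realType) k (alpha delta sigma e : R) j :
  0 < alpha -> 0 < delta -> sigma < 1 / (2 + k%:R + alpha) -> 0 < e ->
  \forall y \near +oo, level_at k alpha delta sigma j y <= e.
Proof.
move=> a0 d0 /(sigma_subcritical a0) s1 e0; near=> y.
have y1 : 1 <= y by near: y; exact: nbhs_pinfty_ge.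
have y0 : 0 < y by apply: lt_le_trans y1.
have h1 : delta * y `^ (2 * sigma) <= 1 * freq_at k alpha j y.
  by near: y; exact: freq_at_dominates.
have h2 : 2 / e * y `^ (critical k alpha * 2) <= y `^ 2.
  near: y; apply: powR_dominated; have := critical_lt1 k a0; lra.
rewrite mul1r in h1.
rewrite /level_at ler_pdivrMr ?exprn_gt0 //.
have h3 : damping delta sigma y ^+ 2 <= (y `^ critical k alpha) ^+ 2.
  rewrite ler_sqr ?nnegrE ?powR_ge0 //; last by rewrite mulr_ge0 ?powR_ge0 // ltW.
  by apply: le_trans (freq_at_le _ _ _ _); exact: h1.
have h4 : freq_at k alpha j y ^+ 2 <= (y `^ critical k alpha) ^+ 2.
  rewrite ler_sqr ?nnegrE ?powR_ge0 ?freq_at_le //.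
  by rewrite divr_ge0 ?powR_ge0 ?exprn_ge0.
have e1 : (y `^ critical k alpha) ^+ 2 = y `^ (critical k alpha * 2).
  by rewrite -powR_mulrn ?powR_ge0 // -powRrM.
have e2 : y `^ 2 = y ^+ 2 by rewrite powR_mulrn // ltW.
move: h2; rewrite -e1 e2 mulrAC ler_pdivrMr // => h2.
by rewrite (mulrC e); lra.
Unshelve. all: by end_near. Qed.

Lemma good_eventually (R : realType) k (alpha delta sigma e : R) j :
  0 < alpha -> 0 < delta -> sigma < 1 / (2 + k%:R + alpha) -> 0 < e ->
  \forall y \near +oo, good k alpha delta sigma e j y.
Proof.
move=> a0 d0 s1 e0; have s2 := sigma_subcritical a0 s1.
have es : 0 < e / scale R j by rewrite divr_gt0 ?scale_gt0.
near=> y; split.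
- by split; near: y; exact: nbhs_pinfty_ge.
- by rewrite -[freq_at _ _ _ _]mul1r; near: y; exact: freq_at_dominates.
- by rewrite -[freq_at _ _ _ _]mul1r; near: y; exact: freq_at_large.
- have h1 : 24 * j.+1%:R * delta * y `^ (2 * sigma) <= e / scale R j * freq_at k alpha j y.
    by near: y; exact: freq_at_dominates.
  have h2 : 24 * j.+1%:R * y `^ (critical k alpha * (1 - j.+2%:R^-1)) <=
      e / scale R j * freq_at k alpha j y.
    near: y; apply: freq_at_dominates => //.
    by rewrite gtr_pMr ?critical_gt0 // gtrBl invr_gt0 ltr0n.
  have h3 : 24 * j.+1%:R <= e / scale R j * freq_at k alpha j y.
    by near: y; exact: freq_at_large.
  rewrite /damping [leRHS]mulrAC.
  have -> : 8 * j.+1%:R * (delta * y `^ (2 * sigma) + y `^ (critical k alpha * (1 - j.+2%:R^-1)) + 1) =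
    (24 * j.+1%:R * delta * y `^ (2 * sigma) +
     24 * j.+1%:R * y `^ (critical k alpha * (1 - j.+2%:R^-1)) + 24 * j.+1%:R) / 3 by field.
  by lra.
by near: y; exact: level_at_small.
Unshelve. all: by end_near. Qed.

Lemma sparse_eventually (R : realType) k (alpha delta sigma e x : R) j :
  0 < alpha -> 0 < delta -> sigma < 1 / (2 + k%:R + alpha) -> 0 < e -> 0 < x ->
  \forall y \near +oo, sparse k alpha delta sigma e j x y.
Proof.
move=> a0 d0 s1 e0 x0; have s2 := sigma_subcritical a0 s1.
have es : 0 < e / scale R j.+1 by rewrite divr_gt0 ?scale_gt0.
have lx : 0 < level_at k alpha delta sigma j x.
  rewrite /level_at divr_gt0 ?exprn_gt0 // ltr_pwDl ?sqr_ge0 // exprn_gt0 //.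
  by rewrite mulr_gt0 // powR_gt0.
near=> y; split.
- by near: y; apply: level_at_small => //; rewrite divr_gt0.
- rewrite mulrC -ler_pdivlMr ?mulr_gt0 ?exprn_gt0 //.
  by near: y; apply: level_at_small => //; rewrite divr_gt0 // mulr_gt0 // exprn_gt0.
- by rewrite -[freq_at _ _ j.+1 _]mul1r; near: y; exact: freq_at_large.
by rewrite [leRHS]mulrAC; near: y; exact: freq_at_large.
Unshelve. all: by end_near. Qed.

(** An unbounded sequence of positive numbers has a subsequence whose terms,
    and pairs of consecutive terms, satisfy prescribed eventual properties. *)
Lemma subsequence_exists (R : realType) (lam : nat -> R) (Q : nat -> R -> Prop)
    (S : nat -> R -> R -> Prop) :
  (forall n, 0 < lam n) -> (forall M, exists n, M < lam n) ->
  (forall j, \forall y \near +oo, Q j y) ->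
  (forall j x, 0 < x -> \forall y \near +oo, S j x y) ->
  exists nn : nat -> nat,
    [/\ forall j, (nn j < nn j.+1)%N, forall j, Q j (lam (nn j))
      & forall j, S j (lam (nn j)) (lam (nn j.+1))].
Proof.
move=> lam0 lamM QE SE.
have pick (E : R -> Prop) n : (\forall y \near +oo, E y) ->
    exists n', (n < n')%N /\ E (lam n').
  move=> [M [_ HM]]; have [n' hn'] := lamM (`|M| + \sum_(i < n.+1) lam i).
  have s0 : 0 <= \sum_(i < n.+1) lam i by apply: sumr_ge0 => i _; exact: ltW.
  exists n'; split; last first.
    by apply: HM; have := ler_norm M; lra.
  rewrite ltnNge; apply/negP => n'n.
  have : lam n' <= \sum_(i < n.+1) lam i.
    have n'1 : (n' < n.+1)%N by [].
    by rewrite (bigD1 (Ordinal n'1)) //= lerDl; apply: sumr_ge0 => i _; exact: ltW.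
  by have := normr_ge0 M; lra.
have step (p : nat * nat) : exists n', [/\ (p.2 < n')%N, Q p.1.+1 (lam n') & S p.1 (lam p.2) (lam n')].
  have [|n' [h1 [h2 h3]]] := pick (fun y => Q p.1.+1 y /\ S p.1 (lam p.2) y) p.2.
    by apply: filterI; [exact: QE|exact: SE].
  by exists n'.
have [f Hf] := choice step.
have [n0 [_ Q0]] := pick _ 0%N (QE 0%N).
pose nn := fix nn j := if j is j'.+1 then f (j', nn j') else n0.
exists nn; split.
- by move=> j; have [] := Hf (j, nn j).
- by case=> [//|j]; have [] := Hf (j, nn j).
by move=> j; have [] := Hf (j, nn j).
Qed.

(** The reason for the value of the critical exponent: at this frequency the
    plateau is just low enough for the coefficient to be of class C^(k, alpha). *)
Lemma level_at_freq (R : realType) k (alpha delta sigma y : R) j :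
  0 < alpha -> 0 < delta -> 0 < y -> damping delta sigma y <= freq_at k alpha j y ->
  level_at k alpha delta sigma j y *
    (freq_at k alpha j y ^+ k * freq_at k alpha j y `^ alpha) <= 2 / 2 ^+ j.
Proof.
move=> a0 d0 y0 dm; set m := freq_at k alpha j y in dm *.
have yc : 0 < y `^ critical k alpha by rewrite powR_gt0.
have m0 : 0 < m by rewrite /m divr_gt0 // exprn_gt0.
have k0 : 0 <= k%:R :> R by [].
have mk : m ^+ 2 * (m ^+ k * m `^ alpha) <= y ^+ 2 / 2 ^+ j.
  have -> : m ^+ 2 * (m ^+ k * m `^ alpha) = m `^ (2 + k%:R + alpha).
    by rewrite mulrA -exprD -powR_mulrn ?(ltW m0) // natrD -powRD // (gt_eqF m0) implybT.
  rewrite /m /freq_at powRM ?(ltW yc) ?invr_ge0 ?exprn_ge0 // -powRrM.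
  have -> : critical k alpha * (2 + k%:R + alpha) = 2 by rewrite /critical divfK // gt_eqF //; lra.
  rewrite (powR_mulrn 2) ?(ltW y0) //; apply: ler_wpM2l; first exact: sqr_ge0.
  apply: ge1r_powR; last by lra.
  by rewrite invr_gt0 exprn_gt0 //= invf_le1 ?exprn_gt0 // exprn_ege1 // ler1n.
have dm2 : damping delta sigma y ^+ 2 <= m ^+ 2.
  by rewrite ler_sqr ?nnegrE ?(ltW m0) // mulr_ge0 ?powR_ge0 // ltW.
rewrite /level_at -/m mulrAC ler_pdivrMr ?exprn_gt0 //.
have W0 : 0 <= m ^+ k * m `^ alpha by rewrite mulr_ge0 ?powR_ge0 // exprn_ge0 // ltW.
apply: le_trans (_ : 2 * m ^+ 2 * (m ^+ k * m `^ alpha) <= _).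
  by apply: ler_wpM2r => //; lra.
rewrite -mulrA; apply: le_trans (ler_wpM2l _ mk) _ => //.
by rewrite mulrA mulrAC.
Qed.

(** Existence of the data of a coefficient, together with the eigenvalues whose
    modes resonate with it. *)
Lemma cascade_exists (R : realType) (lam : nat -> R) k (alpha delta sigma : R) :
  (forall n, 0 < lam n) -> (forall M, exists n, M < lam n) ->
  0 < alpha -> 0 < delta -> sigma < 1 / (2 + k%:R + alpha) ->
  exists (P : cascade k alpha) (nn : nat -> nat),
    [/\ eps P <= 1, forall j, (nn j < nn j.+1)%N,
        forall j, 1 <= lam (nn j) /\ j%:R <= lam (nn j),
        forall j, [/\ lam (nn j) ^+ 2 * level P j = damping delta sigma (lam (nn j)) ^+ 2 + freq P j ^+ 2,
          lam (nn j) ^+ 2 * depth P j = freq P j ^+ 2 &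
          4 * lam (nn j) ^+ 2 * level P j.+1 <= 1]
      & forall j,
        8 * j.+1%:R * (damping delta sigma (lam (nn j)) +
          lam (nn j) `^ (critical k alpha * (1 - j.+2%:R^-1)) + 1) <=
          eps P * freq P j / scale R j /\
        8 * j.+1%:R * \sum_(0 <= i < j) freq P i <= eps P * freq P j / scale R j].
Proof.
move=> lam0 lamM a0 d0 s1.
have [th [th' [dth th0 th1 thb ths]]] := smooth_step_exists R.
have [e [e0 e1 he]] : exists e, [/\ 0 < e, e <= 1 & forall (m : nat -> R), (forall j, scale R j <= m j) ->
    forall j t, `|e * ripple th th' e m j t| <= 1 / 2].
  apply: ripple_small_exists => //; have [K HK] := symbol_bounded (ths 0%N).2.
  by exists K => x; apply: le_trans (ler_norm _) (HK 0%N x).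
have [nn [nnS Qn Sn]] := subsequence_exists lam0 lamM
  (fun j => good_eventually j a0 d0 s1 e0) (fun j x => sparse_eventually j a0 d0 s1 e0 (x := x)).
pose m j := freq_at k alpha j (lam (nn j)).
have sm j : scale R j <= m j by have [] := Qn j.
have m0 j : 0 < m j by exact: lt_le_trans (scale_gt0 R j) (sm j).
have L0 j : 0 < lam (nn j) by [].
have L20 j : 0 < lam (nn j) ^+ 2 by rewrite exprn_gt0.
pose C j := level_at k alpha delta sigma j (lam (nn j)).
pose w j := depth_at k alpha j (lam (nn j)).
have w0 j : 0 < w j by apply: divr_gt0 (L20 j); apply: exprn_gt0; exact: m0.
have wC j : w j <= C j.
  by rewrite /w /C /depth_at /level_at ler_pM2r ?invr_gt0 // lerDr sqr_ge0.
have CS j : C j.+1 <= C j / 2 by have [] := Sn j.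
have C0 : C 0%N <= 1 / 4 by have [] := Qn 0%N.
have dm j : damping delta sigma (lam (nn j)) <= m j by have [] := Qn j.
have lf j : C j * (m j ^+ k * m j `^ alpha) <= 2 / 2 ^+ j.
  exact: level_at_freq.
pose P := @Cascade R k alpha th th' e m C w dth th0 th1 thb ths e0 (he m sm) sm w0 wC CS C0 lf.
exists P, nn; split => //.
- by move=> j; have [] := Qn j.
- move=> j; split => /=.
  + by rewrite /C /level_at mulrC divfK // gt_eqF.
  + by rewrite /w /depth_at mulrC divfK // gt_eqF.
  + by have [] := Sn j.
move=> j; split; first by have [] := Qn j.
rewrite /=; case: j => [|j].
  rewrite big_geq // mulr0; apply: mulr_ge0; last by rewrite invr_ge0 ltW // scale_gt0.
  by apply: mulr_ge0; exact: ltW.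
have [_ _ _] := Sn j; apply: le_trans; apply: ler_wpM2l => //.
have mS i : m i <= m i.+1 by have [] := Sn i.
elim: j => [|j ih]; first by rewrite big_nat1 mul1r.
have -> : j.+2%:R = j.+1%:R + 1 :> R by rewrite natr1.
rewrite big_nat_recr //= mulrDl mul1r lerD2r; apply: (le_trans ih).
by apply: ler_wpM2l => //; exact: mS.
Qed.

(** * Sequences supported on the chosen eigenvalues *)

(** The sequence with value [a j] at the index [nn j], and 0 elsewhere. *)
Definition spread (R : realType) (nn : nat -> nat) (a : nat -> R) (n : nat) : R :=
  \sum_(j < n.+1 | nn j == n) a j.

Lemma strictly_increasing_lt (nn : nat -> nat) : (forall j, (nn j < nn j.+1)%N) ->
  forall i j, (i < j)%N -> (nn i < nn j)%N.
Proof.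
move=> nnS i; elim=> [//|j ih]; rewrite ltnS leq_eqVlt => /orP[/eqP ->//|/ih h].
exact: ltn_trans (nnS j).
Qed.

Lemma strictly_increasing_inj (nn : nat -> nat) : (forall j, (nn j < nn j.+1)%N) ->
  injective nn.
Proof.
move=> /strictly_increasing_lt nnS i j e.
by case: (ltngtP i j) => // /nnS; rewrite e ltnn.
Qed.

Lemma strictly_increasing_ge (nn : nat -> nat) : (forall j, (nn j < nn j.+1)%N) ->
  forall j, (j <= nn j)%N.
Proof. by move=> nnS; elim=> [//|j ih]; exact: leq_ltn_trans ih (nnS j). Qed.

Lemma spreadE (R : realType) (nn : nat -> nat) (a : nat -> R) j :
  (forall j, (nn j < nn j.+1)%N) -> spread nn a (nn j) = a j.
Proof.
move=> nnS; have jn : (j < (nn j).+1)%N by rewrite ltnS; exact: strictly_increasing_ge.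
rewrite /spread (bigD1 (Ordinal jn)) //= big1 ?addr0 // => i /andP[/eqP e].
by rewrite -val_eqE /= (strictly_increasing_inj nnS e) eqxx.
Qed.

Lemma spread_off (R : realType) (nn : nat -> nat) (a : nat -> R) n :
  (forall j, nn j <> n) -> spread nn a n = 0.
Proof. by move=> h; rewrite /spread big1 // => i /eqP /h. Qed.

Lemma sqnorm_ge0 (R : realType) (w v : nat -> R) : (forall n, 0 <= w n) -> (0 <= sqnorm w v)%E.
Proof. by move=> w0; apply: nneseries_ge0 => n _ _; rewrite lee_fin mulr_ge0 ?sqr_ge0. Qed.

Lemma sqnorm_term_le (R : realType) (w v : nat -> R) n : (forall n, 0 <= w n) ->
  ((w n * v n ^+ 2)%:E <= sqnorm w v)%E.
Proof.
move=> w0; have pos i : (0 <= (w i * v i ^+ 2)%:E)%E by rewrite lee_fin mulr_ge0 ?sqr_ge0.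
apply: le_trans (nneseries_lim_ge n.+1 (fun i _ _ => pos i)).
by rewrite big_nat_recr //= leeDr // sume_ge0.
Qed.

(** Geometric bounds on the components along the chosen eigenvalues bound the
    norm, wherever these eigenvalues sit in the whole sequence. *)
Lemma sqnorm_spread_le (R : realType) (w : nat -> R) (nn : nat -> nat) (a : nat -> R) M :
  (forall n, 0 <= w n) -> (forall j, (nn j < nn j.+1)%N) ->
  (forall j, w (nn j) * a j ^+ 2 <= M / 2 ^+ j) ->
  (sqnorm w (spread nn a) <= (2 * M)%:E)%E.
Proof.
move=> w0 nnS aM.
have M0 : 0 <= M.
  apply: le_trans (_ : w (nn 0%N) * a 0%N ^+ 2 <= _); first by rewrite mulr_ge0 ?sqr_ge0.
  by have := aM 0%N; rewrite expr0 divr1.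
have pos i : (0 <= (w i * spread nn a i ^+ 2)%:E)%E by rewrite lee_fin mulr_ge0 ?sqr_ge0.
apply: lime_le; first by apply: is_cvg_nneseries => i _ _; exact: pos.
near=> N; rewrite sumEFin lee_fin.
have t0 j : 0 <= w (nn j) * a j ^+ 2 by rewrite mulr_ge0 ?sqr_ge0.
apply: le_trans (_ : \sum_(0 <= n < N) \sum_(0 <= j < N | nn j == n) (w (nn j) * a j ^+ 2) <= _).
  rewrite !big_nat; apply: ler_sum => n /andP[_ nN].
  have [[j e]|off] := pselect (exists j, nn j = n); last first.
    rewrite spread_off; last by move=> j e; apply: off; exists j.
    by rewrite expr0n mulr0 sumr_ge0.
  rewrite -{}e in nN *; rewrite spreadE //; have jN : (j < N)%N.
    exact: leq_ltn_trans (strictly_increasing_ge nnS j) nN.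
  rewrite big_mkord (bigD1 (Ordinal jN)) //= lerDl sumr_ge0 //.
rewrite (exchange_big_dep xpredT) //=.
apply: le_trans (_ : \sum_(0 <= j < N) w (nn j) * a j ^+ 2 <= _).
  apply: ler_sum => j _; rewrite big_mkord; case: (ltnP (nn j) N) => jN.
    rewrite (bigD1 (Ordinal jN)) //= big1 ?addr0 // => i /andP[/eqP e].
    by rewrite -val_eqE /= e eqxx.
  by rewrite big1 // => i /eqP e; move: jN; rewrite e leqNgt ltn_ord.
have tM j : `|w (nn j) * a j ^+ 2| <= M / 2 ^+ j by rewrite ger0_norm.
have := series_sub_geometric_bound tM (leq0n N).
by rewrite [series _ 0%N]big_geq // subr0 expr0 divr1 => /ler_normlW.
Unshelve. all: by end_near. Qed.

Lemma sqnorm_cvg0 (R : realType) (F : set_system R) (FF : Filter F) (g : R -> \bar R) (M t : R) :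
  F --> t -> (\forall s \near F, (0 <= g s <= (M * (s - t) ^+ 2)%:E)%E) -> g @ F --> 0%E.
Proof.
move=> Ft gM; apply: (squeeze_cvge gM); first exact: cvg_cst.
apply: cvg_trans (cvg_app _ Ft) _.
have -> : 0%E = (M * (t - t) ^+ 2)%:E :> \bar R by rewrite subrr expr0n mulr0.
apply: cvg_EFin; first by near=> s.
apply: cvgM; first exact: cvg_cst.
apply: (cvg_comp (fun s => s - t) (fun s => s ^+ 2)); last exact: exprn_continuous.
by apply: cvgB; [exact: cvg_id|exact: cvg_cst].
Unshelve. all: by end_near. Qed.

(** Continuity in a weighted space follows from bounds on the components and
    on their Lipschitz constants. *)
Lemma C0_in_spread (R : realType) (w : nat -> R) (nn : nat -> nat) (U : nat -> R -> R)
    (B : nat -> R) (M : R) (D : set R) :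
  (forall n, 0 <= w n) -> (forall j, (nn j < nn j.+1)%N) ->
  (forall j, w (nn j) * B j ^+ 2 <= M / 2 ^+ j) ->
  (forall j t, D t -> `|U j t| <= B j) ->
  (forall j s t, D s -> D t -> `|U j s - U j t| <= B j * `|s - t|) ->
  C0_in w D (fun t => spread nn (U^~ t)).
Proof.
move=> w0 nnS wB UB UL t Dt.
have sq (x y z : R) n : `|x| <= y * `|z| -> w n * x ^+ 2 <= w n * y ^+ 2 * z ^+ 2.
  move=> xy; rewrite -mulrA; apply: ler_wpM2l => //.
  rewrite -exprMn -(real_normK (num_real x)) -(real_normK (num_real (y * z))) normrM.
  have yz : `|x| <= `|y| * `|z| by apply: le_trans xy _; rewrite ler_wpM2r // ler_norm.
  by rewrite ler_sqr ?nnegrE // mulr_ge0.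
split.
  apply: le_lt_trans (_ : _ <= (2 * M)%:E)%E (ltry _); apply: sqnorm_spread_le => // j.
  apply: le_trans (wB j); rewrite -[leRHS]mulr1 -(expr1n _ 2); apply: sq.
  by rewrite normr1 mulr1; exact: UB.
apply: (@sqnorm_cvg0 _ _ _ _ (2 * M) t); first exact: cvg_within.
near=> s; have Ds : D s by near: s; exact: withinT.
rewrite sqnorm_ge0 //=.
rewrite (_ : spread nn (U^~ s) - spread nn (U^~ t) = spread nn (fun j => U j s - U j t)); last first.
  by apply/funext => n; rewrite /spread !fctE sumrB.
rewrite -mulrA; apply: sqnorm_spread_le => // j.
apply: le_trans (sq _ _ _ _ (UL j s t Ds Dt)) _.
by rewrite [leRHS]mulrAC; apply: ler_wpM2r; [exact: sqr_ge0|exact: wB].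
Unshelve. all: by end_near. Qed.

Lemma C1_in_spread (R : realType) (w : nat -> R) (nn : nat -> nat) (U V : nat -> R -> R)
    (B : nat -> R) (M : R) (D : set R) :
  (forall n, 0 <= w n) -> (forall j, (nn j < nn j.+1)%N) ->
  (forall j, w (nn j) * B j ^+ 2 <= M / 2 ^+ j) ->
  (forall j t, D t -> `|U j t| <= B j /\ `|V j t| <= B j) ->
  (forall j s t, D s -> D t ->
    [/\ `|U j s - U j t| <= B j * `|s - t|, `|V j s - V j t| <= B j * `|s - t| &
        `|U j s - U j t - (s - t) * V j t| <= B j * `|s - t| * `|s - t|]) ->
  C1_in w D (fun t => spread nn (U^~ t)) (fun t => spread nn (V^~ t)).
Proof.
move=> w0 nnS wB UB UL; split.
- have h1 j t : D t -> `|U j t| <= B j by move=> Dt; have [] := UB j t Dt.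
  have h2 j s t : D s -> D t -> `|U j s - U j t| <= B j * `|s - t|.
    by move=> Ds Dt; have [] := UL j s t Ds Dt.
  exact: (C0_in_spread w0 nnS wB h1 h2).
- have h1 j t : D t -> `|V j t| <= B j by move=> Dt; have [] := UB j t Dt.
  have h2 j s t : D s -> D t -> `|V j s - V j t| <= B j * `|s - t|.
    by move=> Ds Dt; have [] := UL j s t Ds Dt.
  exact: (C0_in_spread w0 nnS wB h1 h2).
move=> t Dt.
apply: (@sqnorm_cvg0 _ _ _ _ (2 * M) t).
  by apply: cvg_trans (cvg_within _) _; exact: nbhs_dnbhs.
near=> s; have Ds : D s by near: s; exact: (withinT D (dnbhs_filter t)).
have st : s != t.
  near: s; have h : t^' [set x | x != t] by exact: (nbhs_dnbhs_neq t).
  by apply: (filterS _ h) => x.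
have st0 : s - t != 0 by rewrite subr_eq0.
rewrite sqnorm_ge0 //=.
rewrite (_ : (s - t)^-1 *: _ - _ = spread nn (fun j => (s - t)^-1 * (U j s - U j t) - V j t)); last first.
  apply/funext => n; rewrite /spread !fctE sumrB -mulr_sumr sumrB //.
rewrite -mulrA; apply: sqnorm_spread_le => // j.
have [_ _ h] := UL j s t Ds Dt.
have le : `|(s - t)^-1 * (U j s - U j t) - V j t| <= B j * `|s - t|.
  have -> : (s - t)^-1 * (U j s - U j t) - V j t = (s - t)^-1 * (U j s - U j t - (s - t) * V j t).
    by field.
  by rewrite normrM normfV ler_pdivrMl ?normr_gt0 // [leRHS]mulrC.
apply: le_trans (_ : w (nn j) * B j ^+ 2 * (s - t) ^+ 2 <= _); last first.
  by rewrite [leRHS]mulrAC; apply: ler_wpM2r; [exact: sqr_ge0|exact: wB].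
rewrite -mulrA; apply: ler_wpM2l => //.
rewrite -exprMn -(real_normK (num_real (_ - V j t))) -(real_normK (num_real (B j * _))) normrM.
have h2 : `|(s - t)^-1 * (U j s - U j t) - V j t| <= `|B j| * `|s - t|.
  by apply: le_trans le _; rewrite ler_wpM2r // ler_norm.
by rewrite ler_sqr ?nnegrE // mulr_ge0.
Unshelve. all: by end_near. Qed.

(** * Gevrey spaces and ultradistributions *)

Lemma expR_opp_le_geometric (R : realType) (x : R) j : j%:R <= x -> expR (- x) <= 1 / 2 ^+ j.
Proof.
move=> jx; rewrite expRN div1r lef_pV2 ?posrE ?expR_gt0 ?exprn_gt0 //.
apply: le_trans (_ : expR j%:R <= _); last by rewrite ler_expR.
rewrite -[j%:R]mulr1 expRM_natl; apply: lerXn2r; rewrite ?nnegrE ?expR_ge0 //.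
by have := expR_ge1Dx (1 : R); lra.
Qed.

Lemma geometric_of_eventually (R : realType) (a : nat -> R) J :
  (forall j, 0 <= a j) -> (forall j, (J <= j)%N -> a j <= 1 / 2 ^+ j) ->
  exists M, forall j, a j <= M / 2 ^+ j.
Proof.
move=> a0 aJ; exists (1 + \sum_(i < J) a i * 2 ^+ i) => j.
have p0 : 0 < 2 ^+ j :> R by rewrite exprn_gt0.
have t0 (i : 'I_J) : 0 <= a i * 2 ^+ i by rewrite mulr_ge0 ?exprn_ge0.
case: (leqP J j) => jJ.
  apply: le_trans (aJ j jJ) _; rewrite ler_pM2r ?invr_gt0 // lerDl.
  by apply: sumr_ge0.
rewrite ler_pdivlMr // (bigD1 (Ordinal jJ)) //=.
have : 0 <= \sum_(i < J | i != Ordinal jJ) a i * 2 ^+ i by apply: sumr_ge0.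
by lra.
Qed.

(** Every power of 1 + L lies between exponentials of any given positive power
    of L. *)
Lemma powR_1D_bounds (R : realType) (L s p : R) : 1 <= L -> 0 < s ->
  expR (- (`|p| * (1 + s * L `^ (1 / s)))) <= (1 + L) `^ p <=
  expR (`|p| * (1 + s * L `^ (1 / s))).
Proof.
move=> L1 s0; set Z := L `^ (1 / s).
have L0 : 0 < 1 + L by lra.
have LZ : L <= expR (s * Z).
  have -> : L = Z `^ s by rewrite /Z -powRrM divfK ?gt_eqF // powRr1 //; lra.
  rewrite (mulrC s) expRM; apply: ge0_ler_powR; rewrite ?nnegrE ?powR_ge0 ?expR_ge0 ?ltW //.
  by have := expR_gt1Dx; have := expR_ge1Dx Z; lra.
have up : ln (1 + L) <= 1 + s * Z.
  rewrite -ler_expR lnK ?posrE // expRD.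
  have E1 : 2 <= expR 1 :> R by have := expR_ge1Dx (1 : R); lra.
  apply: le_trans (_ : 2 * expR (s * Z) <= _); last by rewrite ler_wpM2r ?expR_ge0.
  by lra.
have lo : 0 <= ln (1 + L) by apply: ln_ge0; lra.
have -> : (1 + L) `^ p = expR (ln (1 + L) * p) by rewrite expRM lnK ?posrE.
rewrite !ler_expR -ler_norml normrM (ger0_norm lo) mulrC.
by apply: ler_wpM2l.
Qed.

Lemma natr_ge_exists (R : realType) (x : R) : exists J, forall j, (J <= j)%N -> x <= j%:R.
Proof.
exists (Num.truncn x).+1 => j xj; apply: ltW; apply: lt_le_trans (truncnS_gt x) _.
by rewrite ler_nat.
Qed.

Lemma subcritical_eventually (R : realType) k (alpha s : R) :
  0 < alpha -> 1 + (k%:R + alpha) / 2 < s ->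
  exists J, forall j, (J <= j)%N -> 1 / s <= critical k alpha * (1 - j.+2%:R^-1).
Proof.
move=> a0 hs; have k0 : 0 <= k%:R :> R by [].
have s0 : 0 < s by lra.
have gap : 0 < critical k alpha - 1 / s.
  have D0 : 0 < 2 + k%:R + alpha by lra.
  by rewrite subr_gt0 /critical ltr_pdivlMr // mulrAC ltr_pdivrMr //; lra.
have c0 := critical_gt0 k a0.
have [J HJ] := natr_ge_exists (critical k alpha / (critical k alpha - 1 / s)).
exists J => j /HJ; rewrite ler_pdivrMr // => h.
have j2 : 0 < j.+2%:R :> R by rewrite ltr0n.
have e : j.+2%:R = j%:R + 2 :> R by rewrite -addn2 natrD.
have : critical k alpha / j.+2%:R <= critical k alpha - 1 / s.
  by rewrite ler_pdivrMr // e; move: (critical k alpha) (1 / s) h c0 gap => x y h c0 gap; lra.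
by rewrite mulrBr mulr1 => h'; rewrite lerBrDr addrC -lerBrDr.
Qed.

(** Components that are at most exp(- 2 (j + 1) L_j^p), with p increasing to the
    critical exponent, make up an element of every Gevrey space whose order
    exceeds the reciprocal of that exponent. *)
Lemma gevrey_of_decay (R : realType) (lam : nat -> R) (nn : nat -> nat) k (alpha s r beta : R)
    (a : nat -> R) :
  0 < alpha -> 1 + (k%:R + alpha) / 2 < s ->
  (forall j, (nn j < nn j.+1)%N) -> (forall j, 1 <= lam (nn j)) ->
  (forall j, a j ^+ 2 <=
     expR (- (4 * j.+1%:R * (lam (nn j) `^ (critical k alpha * (1 - j.+2%:R^-1)) + 1)))) ->
  gevrey lam s r beta (spread nn a).
Proof.
move=> a0 hs nnS L1 adec.
have k0 : 0 <= k%:R :> R by [].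
have s0 : 0 < s by lra.
have w0 n : 0 <= gevrey_weight lam s r beta n by rewrite mulr_ge0 ?powR_ge0 ?expR_ge0.
have [J1 HJ1] := subcritical_eventually a0 hs.
have [J2 HJ2] := natr_ge_exists (`|4 * beta| * (1 + s) + 2 * r).
have [M HM] : exists M, forall j, gevrey_weight lam s r beta (nn j) * a j ^+ 2 <= M / 2 ^+ j.
  apply: (@geometric_of_eventually _ _ (maxn J1 J2)) => [j|j].
    by rewrite mulr_ge0 ?sqr_ge0.
  rewrite geq_max => /andP[/HJ1 h1 /HJ2 h2].
  have Lj := L1 j; rewrite /gevrey_weight; have := adec j; move: (lam (nn j)) Lj => L Lj adj.
  pose Z := L `^ (1 / s).
  have Z1 : 1 <= Z by rewrite -(powRr0 L); apply: ler_powR => //; rewrite divr_ge0 // ltW.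
  have ZL : Z <= L `^ (critical k alpha * (1 - j.+2%:R^-1)) by apply: ler_powR.
  have /andP[_ hp] := powR_1D_bounds (4 * beta) Lj s0; rewrite -/Z in hp.
  apply: le_trans (ler_pM _ _ (ler_wpM2r (expR_ge0 _) hp) adj) _; rewrite ?sqr_ge0 //.
    by rewrite mulr_ge0 ?powR_ge0 ?expR_ge0.
  rewrite -!expRD -/Z.
  apply: le_trans (_ : expR (- j%:R) <= _); last exact: expR_opp_le_geometric.
  rewrite ler_expR.
  have e : j.+1%:R = j%:R + 1 :> R by rewrite natr1.
  have j0 : 0 <= j%:R :> R by [].
  have m1 : 4 * j.+1%:R * (Z + 1) <= 4 * j.+1%:R * (L `^ (critical k alpha * (1 - j.+2%:R^-1)) + 1).
    by apply: ler_wpM2l; lra.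
  have n0 := normr_ge0 (4 * beta).
  have m2 : `|4 * beta| * (1 + s * Z) + 2 * r * Z <= (`|4 * beta| * (1 + s) + 2 * r) * Z.
    have : 0 <= `|4 * beta| * (Z - 1) by rewrite mulr_ge0 // subr_ge0.
    by lra.
  have m3 : (`|4 * beta| * (1 + s) + 2 * r) * Z <= j%:R * Z by apply: ler_wpM2r => //; lra.
  have m4 : 0 <= j%:R * Z by rewrite mulr_ge0 //; lra.
  by rewrite e in m1 *; lra.
by apply: le_lt_trans (sqnorm_spread_le w0 nnS HM) _; exact: ltry.
Qed.

(** Components whose energy is of order exp(3 (j + 1) L_j^p) or more, with p increasing
    to the critical exponent, do not make up an ultradistribution whose order
    exceeds the reciprocal of that exponent. *)
Lemma not_ultradistribution (R : realType) (lam : nat -> R) (nn : nat -> nat) k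
    (alpha S rho beta : R) (a b : nat -> R) J :
  0 < alpha -> 1 + (k%:R + alpha) / 2 < S ->
  (forall j, (nn j < nn j.+1)%N) -> (forall j, 1 <= lam (nn j)) ->
  (forall j, (J <= j)%N ->
     expR (3 * j.+1%:R * (lam (nn j) `^ (critical k alpha * (1 - j.+2%:R^-1)) + 1)) / 2 <=
     b j ^+ 2 + lam (nn j) ^+ 2 * a j ^+ 2) ->
  ~ (ultradistribution lam S rho beta (spread nn a) /\
     ultradistribution lam S rho beta (spread nn b)).
Proof.
move=> a0 hS nnS L1 low [fa fb].
have k0 : 0 <= k%:R :> R by [].
have S0 : 0 < S by lra.
have w0 n : 0 <= ultra_weight lam S rho beta n by rewrite mulr_ge0 ?powR_ge0 ?expR_ge0.
have bound (v : nat -> R) : ultradistribution lam S rho beta (spread nn v) ->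
    exists2 M, 0 <= M & forall j, ultra_weight lam S rho beta (nn j) * v j ^+ 2 <= M.
  move=> fv; have q0 := sqnorm_ge0 (spread nn v) w0.
  have fin : sqnorm (ultra_weight lam S rho beta) (spread nn v) \is a fin_num.
    by rewrite ge0_fin_numE.
  exists (fine (sqnorm (ultra_weight lam S rho beta) (spread nn v))); first exact: fine_ge0.
  move=> j; rewrite -(spreadE v j nnS) -lee_fin fineK //; exact: sqnorm_term_le.
have [Ma Ma0 HMa] := bound a fa; have [Mb Mb0 HMb] := bound b fb.
have [J1 HJ1] := subcritical_eventually a0 hS.
pose A := (2 + `|4 * beta|) * (1 + S) + 2 * rho.
have [J2 HJ2] := natr_ge_exists A.
have [J3 HJ3] := natr_ge_exists (2 * (Ma + Mb)).
pose j := maxn J (maxn J1 (maxn J2 J3)).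
have := low j (leq_maxl _ _).
have /HJ1 h1 : (J1 <= j)%N by rewrite /j; lia.
have /HJ2 h2 : (J2 <= j)%N by rewrite /j; lia.
have /HJ3 h3 : (J3 <= j)%N by rewrite /j; lia.
have ha := HMa j; have hb := HMb j; have Lj := L1 j.
move: ha hb; rewrite /ultra_weight; clearbody j.
move: (lam (nn j)) (a j) (b j) Lj h1 h2 h3 => L x y Lj h1 h2 h3.
pose Z := L `^ (1 / S); rewrite -/Z.
have Z1 : 1 <= Z by rewrite -(powRr0 L); apply: ler_powR => //; rewrite divr_ge0 // ltW.
have ZL : Z <= L `^ (critical k alpha * (1 - j.+2%:R^-1)) by apply: ler_powR.
have /andP[hp _] := powR_1D_bounds (4 * beta) Lj S0; rewrite -/Z in hp.
have /andP[_ hq] := powR_1D_bounds 2 Lj S0; rewrite -/Z in hq.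
have j0 : 0 <= j%:R :> R by [].
have e : j.+1%:R = j%:R + 1 :> R by rewrite natr1.
pose W := expR (`|4 * beta| * (1 + S * Z) + 2 * rho * Z).
have Wb z M : (1 + L) `^ (4 * beta) * expR (-2 * rho * Z) * z ^+ 2 <= M -> z ^+ 2 <= M * W.
  move=> zM; rewrite -ler_pdivrMr ?expR_gt0 // mulrC; apply: le_trans zM.
  apply: ler_wpM2r; first exact: sqr_ge0.
  rewrite -expRN opprD expRD mulNr mulNr; apply: ler_wpM2r => //; exact: expR_ge0.
move=> /Wb ha /Wb hb lo.
have L2 : L ^+ 2 <= expR (2 * (1 + S * Z)).
  rewrite [X in X * _]ger0_norm // in hq.
  apply: le_trans hq; rewrite powR_mulrn; last by lra.
  by apply: lerXn2r; rewrite ?nnegrE; lra.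
have up : y ^+ 2 + L ^+ 2 * x ^+ 2 <= (Ma + Mb) * (expR (2 * (1 + S * Z)) * W).
  have W0 : 0 <= W by exact: expR_ge0.
  have q1 : 1 <= expR (2 * (1 + S * Z)).
    by apply: le_trans L2; rewrite expr_ge1 //; lra.
  have q2 : y ^+ 2 <= Mb * (expR (2 * (1 + S * Z)) * W).
    apply: (le_trans hb); apply: ler_wpM2l => //.
    by rewrite ler_peMl.
  have q3 : L ^+ 2 * x ^+ 2 <= Ma * (expR (2 * (1 + S * Z)) * W).
    by rewrite [leRHS]mulrCA; apply: ler_pM => //; exact: sqr_ge0.
  by rewrite mulrDl; lra.
have AZ : 2 * (1 + S * Z) + (`|4 * beta| * (1 + S * Z) + 2 * rho * Z) <= j%:R * Z.
  have n0 := normr_ge0 (4 * beta).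
  have m1 : 0 <= (2 + `|4 * beta|) * (Z - 1) by rewrite mulr_ge0 ?subr_ge0 // addr_ge0.
  have m2 : A * Z <= j%:R * Z by apply: ler_wpM2r => //; lra.
  by move: m2; rewrite /A; lra.
have up2 : 2 * (Ma + Mb) < expR (j%:R * Z).
  apply: le_lt_trans h3 _; apply: le_lt_trans (ler_peMr j0 Z1) _.
  by have := expR_ge1Dx (j%:R * Z); lra.
have : expR (3 * j.+1%:R * (L `^ (critical k alpha * (1 - j.+2%:R^-1)) + 1)) <
    expR (j%:R * Z) * expR (j%:R * Z).
  apply: le_lt_trans (_ : 2 * (Ma + Mb) * expR (j%:R * Z) < _); last by rewrite ltr_pM2r ?expR_gt0.
  apply: le_trans (_ : 2 * ((Ma + Mb) * (expR (2 * (1 + S * Z)) * W)) <= _); first by lra.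
  rewrite mulrA; apply: ler_wpM2l; first by rewrite mulr_ge0 // addr_ge0.
  by rewrite /W -expRD ler_expR.
rewrite -expRD ltr_expR => bad.
have m1 : 3 * j.+1%:R * (Z + 1) <= 3 * j.+1%:R * (L `^ (critical k alpha * (1 - j.+2%:R^-1)) + 1).
  by apply: ler_wpM2l; lra.
have m4 : 0 <= j%:R * Z by rewrite mulr_ge0 //; lra.
by move: m1 bad; rewrite e; lra.
Qed.

(** * The solution *)

Lemma is_derive_segment_dist (R : realType) (f f' : R -> R) (K a b s t : R) :
  (forall x : R, a <= x <= b -> is_derive x 1 f (f' x)) ->
  (forall x, a <= x <= b -> `|f' x| <= K) -> a <= s <= b -> a <= t <= b ->
  exists2 x, a <= x <= b /\ `|x - t| <= `|s - t| &
    f s - f t = f' x * (s - t) /\ `|f s - f t| <= K * `|s - t|.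
Proof.
move=> df fK /andP[s0 s1] /andP[t0 t1].
suff [x [xab xt] e] : exists2 x, a <= x <= b /\ `|x - t| <= `|s - t| & f s - f t = f' x * (s - t).
  exists x => //; split => //.
  by rewrite e normrM ler_wpM2r // fK.
case: (leP t s) => ts.
  have h x : t <= x <= s -> a <= x <= b by move=> /andP[? ?]; apply/andP; split; lra.
  have [x /[dup] xts /andP[x1 x2] e] := is_derive_mean_value ts (fun x xts => df x (h x xts)).
  exists x => //; split; first exact: h.
  by rewrite !ger0_norm; lra.
have h x : s <= x <= t -> a <= x <= b by move=> /andP[? ?]; apply/andP; split; lra.
have [x /[dup] xts /andP[x1 x2] e] := is_derive_mean_value (ltW ts) (fun x xts => df x (h x xts)).
exists x.
  split; first exact: h.
  by rewrite !ler0_norm; lra.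
by rewrite -opprB e -mulrN opprB.
Qed.

(** Size and modulus of continuity of a mode and of its derivative, from the
    bound on its energy. *)
Lemma mode_C1_bounds (R : realType) (d L tau delta : R) (c u v : R -> R) :
  0 < delta -> 0 <= d -> d <= delta * L -> 1 <= L ->
  (forall t, 0 <= c t <= 1) ->
  (forall t : R, is_derive t 1 u (v t) /\ is_derive t 1 v (- (2 * d) * v t - L ^+ 2 * c t * u t)) ->
  (forall t, 0 <= t -> v t ^+ 2 + L ^+ 2 * u t ^+ 2 <= expR ((4 * d + L) * (1 + t))) ->
  let B := (2 * delta + 1) * L * expR ((4 * delta + 1) * (1 + tau) / 2 * L) in
  (forall t, 0 <= t <= tau -> `|u t| <= B /\ `|v t| <= B) /\
  (forall s t, 0 <= s <= tau -> 0 <= t <= tau ->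
    [/\ `|u s - u t| <= B * `|s - t|, `|v s - v t| <= B * `|s - t| &
        `|u s - u t - (s - t) * v t| <= B * `|s - t| * `|s - t|]).
Proof.
move=> dl0 d0 dL L1 c01 uv en B.
pose X := expR ((4 * delta + 1) * (1 + tau) / 2 * L).
have X0 : 0 < X by exact: expR_gt0.
have sq (x : R) : x ^+ 2 <= X ^+ 2 -> `|x| <= X.
  move=> h; rewrite -(ler_sqr (x := `|x|)) ?nnegrE ?(ltW X0) //.
  by rewrite real_normK // num_real.
have E t : 0 <= t <= tau -> `|v t| <= X /\ `|L * u t| <= X.
  move=> /andP[t0 tt]; have h : v t ^+ 2 + L ^+ 2 * u t ^+ 2 <= X ^+ 2.
    apply: le_trans (en t t0) _; rewrite /X expr2 -expRD ler_expR.
    have -> : (4 * delta + 1) * (1 + tau) / 2 * L + (4 * delta + 1) * (1 + tau) / 2 * L =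
      ((4 * delta + 1) * L) * (1 + tau) by field.
    by apply: ler_pM; lra.
  have p1 := sqr_ge0 (v t); have p2 : 0 <= L ^+ 2 * u t ^+ 2 by apply: mulr_ge0; exact: sqr_ge0.
  by split; apply: sq; rewrite ?exprMn; lra.
have BE : B = (2 * delta + 1) * L * X by [].
have LX : X <= L * X by rewrite ler_peMl // ltW.
have dX : 0 <= delta * (L * X) by rewrite mulr_ge0 ?ltW // (lt_le_trans X0).
have XB : X <= B by rewrite BE; lra.
have ub t : 0 <= t <= tau -> `|u t| <= B /\ `|v t| <= B.
  move=> /E[h1 h2]; split; last exact: le_trans XB.
  apply: le_trans (le_trans _ h2) XB.
  by rewrite normrM ger0_norm ?ler_peMl //; lra.
have wb t : 0 <= t <= tau -> `|- (2 * d) * v t - L ^+ 2 * c t * u t| <= B.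
  move=> /E[h1 h2]; apply: le_trans (ler_normB _ _) _.
  have q1 : `|- (2 * d) * v t| <= 2 * (delta * L) * X.
    rewrite normrM normrN normrM normr_nat (ger0_norm d0).
    by apply: ler_pM => //; [rewrite mulr_ge0|rewrite ler_pM2l].
  have q2 : `|L ^+ 2 * c t * u t| <= L * X.
    have -> : L ^+ 2 * c t * u t = L * (c t * (L * u t)) by ring.
    have /andP[c0 c1] := c01 t.
    rewrite normrM (ger0_norm (x := L)); last by lra.
    apply: ler_wpM2l; first by lra.
    by rewrite normrM (ger0_norm c0) -[X]mul1r ler_pM.
  by apply: le_trans (lerD q1 q2) _; rewrite BE; lra.
split => // s t hs ht.
have [x [xt1 xt2] [e1 b1]] := is_derive_segment_dist (fun x _ => (uv x).1) (fun x h => (ub x h).2) hs ht.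
have [_ _ [_ b2]] := is_derive_segment_dist (fun x _ => (uv x).2) wb hs ht.
split => //.
have [_ _ [_ b3]] := is_derive_segment_dist (fun x _ => (uv x).2) wb xt1 ht.
have -> : u s - u t - (s - t) * v t = (v x - v t) * (s - t) by rewrite e1; ring.
rewrite normrM; apply: ler_wpM2r => //; apply: (le_trans b3).
by apply: ler_wpM2l => //; apply: ltW; exact: lt_le_trans XB.
Qed.

Lemma mode_weight (R : realType) (delta tau rho p L : R) j :
  0 < delta -> 0 <= tau -> 1 <= L -> j%:R <= L -> p <= 2 ->
  (4 * delta + 1) * (1 + tau) / 2 + 3 <= rho ->
  (1 + L) `^ p * expR (- 2 * rho * L `^ (1 / 1)) *
    ((2 * delta + 1) * L * expR ((4 * delta + 1) * (1 + tau) / 2 * L)) ^+ 2 <=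
  (2 * delta + 1) ^+ 2 / 2 ^+ j.
Proof.
move=> d0 t0 L1 jL p2 hr; rewrite divr1 powRr1; last by lra.
have EL : 1 + L <= expR L by exact: expR_ge1Dx.
have h1 : (1 + L) `^ p <= expR L ^+ 2.
  apply: le_trans (_ : (1 + L) `^ 2 <= _); first by apply: ler_powR => //; lra.
  by rewrite powR_mulrn ?ler_sqr ?nnegrE ?expR_ge0 //; lra.
have h2 : L ^+ 2 <= expR L ^+ 2 by rewrite ler_sqr ?nnegrE ?expR_ge0 //; lra.
set Y := expR ((4 * delta + 1) * (1 + tau) / 2 * L).
have -> : (1 + L) `^ p * expR (- 2 * rho * L) * ((2 * delta + 1) * L * Y) ^+ 2 =
   (2 * delta + 1) ^+ 2 * ((1 + L) `^ p * L ^+ 2 * (expR (- 2 * rho * L) * (Y * Y))) by ring.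
apply: ler_wpM2l; first exact: sqr_ge0.
apply: le_trans (_ : expR L ^+ 2 * expR L ^+ 2 * (expR (- 2 * rho * L) * (Y * Y)) <= _).
  apply: ler_wpM2r; first by rewrite !mulr_ge0 ?expR_ge0.
  by apply: ler_pM; rewrite ?powR_ge0 ?sqr_ge0.
have := expR_opp_le_geometric jL; rewrite div1r; apply: le_trans.
rewrite (expr2 (expR L)) /Y -!expRD ler_expR.
have : 0 <= (rho - ((4 * delta + 1) * (1 + tau) / 2 + 3)) * L by rewrite mulr_ge0 ?subr_ge0 //; lra.
by lra.
Qed.

Theorem theorem3p6 (R : realType)
  (H : completeNormedModType R) (ip : {dot H for idfun})
  (ip_norm : induces_norm ip)
  (D : set H) (A : H -> H) (A_lin : linear_operator D A)
  (e : nat -> H) (e_on : orthonormal_system ip e)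
  (lam : nat -> R) (lam_gt0 : forall n : nat, 0 < lam n)
  (lam_unbounded : forall M : R, exists n : nat, M < lam n)
  (e_eigen : forall n : nat, D (e n) /\ A (e n) = lam n ^+ 2 *: e n)
  (delta alpha sigma : R) (k : nat)
  (delta_gt0 : 0 < delta) (alpha_gt0 : 0 < alpha) (alpha_le1 : alpha <= 1)
  (sigma_ge0 : 0 <= sigma) (sigma_lt : sigma < 1 / (2 + k%:R + alpha)) :
  exists (c : R -> R) (u du : R -> nat -> R),
    [/\ (forall t : R, 0 <= c t) /\ is_solution lam delta sigma c u du,
        [/\ Ck_hoelder k alpha c,
            smooth_on [set t | t != 0] c
          & forall t : R, 0 < t -> 0 < c t <= 1],
        forall s r beta : R, 1 + (k%:R + alpha) / 2 < s -> 0 < r ->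
          gevrey lam s r beta (u 0) /\ gevrey lam s r beta (du 0)
      & forall t S rho beta : R,
          0 < t -> 1 + (k%:R + alpha) / 2 < S -> 0 < rho ->
          ~ (ultradistribution lam S rho beta (u t) /\
             ultradistribution lam S rho beta (du t))].
Proof.
have [P [nn [e1 nnS L1 rel grow]]] :=
  cascade_exists lam_gt0 lam_unbounded alpha_gt0 delta_gt0 sigma_lt.
have [K K0 later] := coefficient_later P.
pose c : R -> R := coefficient P; pose L j := lam (nn j).
pose d j := damping delta sigma (L j); pose Gam j := eps P * freq P j / scale R j.
pose Kj j := K * \sum_(0 <= i < j) freq P i.
have Kj0 j : 0 <= Kj j.
  by apply: mulr_ge0 => //; apply: sumr_ge0 => i _; exact: ltW (freq_gt0 P i).
have c01 t : 0 <= c t <= 1 by rewrite coefficient_ge0 coefficient_le1.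
have d0 j : 0 <= d j by rewrite mulr_ge0 ?powR_ge0 // ltW.
have L1' j : 1 <= L j by have [] := L1 j.
have dL j : d j <= delta * L j.
  apply: ler_wpM2l; first exact: ltW.
  rewrite -[leRHS]powRr1; last by apply: le_trans (L1' j).
  apply: ler_powR => //.
  have : sigma * (2 + k%:R + alpha) < 1 by rewrite -ltr_pdivlMr //; have : 0 <= k%:R :> R by []; lra.
  have : 0 <= sigma * (k%:R + alpha) by rewrite mulr_ge0 // addr_ge0 // ltW.
  by lra.
have modes j : exists UV : (R -> R) * (R -> R),
  [/\ forall t : R, is_derive t 1 UV.1 (UV.2 t) /\
        is_derive t 1 UV.2 (- (2 * d j) * UV.2 t - L j ^+ 2 * c t * UV.1 t),
      forall t, 0 <= t ->
        UV.2 t ^+ 2 + L j ^+ 2 * UV.1 t ^+ 2 <= expR ((4 * d j + L j) * (1 + t)),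
      UV.2 0 ^+ 2 + UV.1 0 ^+ 2 <= expR (- Gam j + 4 * d j + 1)
    & forall t, 8 / scale R j <= t ->
        expR (Gam j - 2 - 2 * d j - (4 * d j + Kj j) * t) / 2 <=
        UV.2 t ^+ 2 + L j ^+ 2 * UV.1 t ^+ 2].
  have [r1 r2 r3] := rel j.
  have [u [v [h1 h2 h3 h4]]] := resonant_mode_exists alpha_gt0 alpha_le1 e1 (d0 j) (L1' j)
    (Kj0 j) (later j) r1 r2 r3.
  by exists (u, v).
have [UV HUV] := choice modes.
pose U j := (UV j).1; pose V j := (UV j).2.
pose W j t := - (2 * d j) * V j t - L j ^+ 2 * c t * U j t.
pose u t := spread nn (U^~ t); pose du t := spread nn (V^~ t).
exists c, u, du.
have decay j x : x ^+ 2 <= expR (- Gam j + 4 * d j + 1) -> x ^+ 2 <=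
     expR (- (4 * j.+1%:R * (lam (nn j) `^ (critical k alpha * (1 - j.+2%:R^-1)) + 1))).
  (* the damping d_j is absorbed by half of G_j *)
  move=> /le_trans; apply; rewrite ler_expR; have [g _] := grow j.
  have j0 : 0 <= j%:R :> R by [].
  have ej : j.+1%:R = j%:R + 1 :> R by rewrite natr1.
  have p0 := powR_ge0 (lam (nn j)) (critical k alpha * (1 - j.+2%:R^-1)).
  have q1 : 0 <= j%:R * d j by exact: mulr_ge0.
  have q2 := mulr_ge0 j0 p0; have dj := d0 j.
  by move: g; rewrite -/(L j) -/(d j) -/(Gam j) ej; lra.
split.
- split; first by move=> t; have /andP[] := c01 t.
  split.
    exists (fun t => spread nn (W^~ t)) => n t t0.
    have [[j <-]|off] := pselect (exists j, nn j = n); last first.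
      have z a : spread nn a n = 0 by apply: spread_off => j ej; apply: off; exists j.
      have z0 : has_deriv_within `[0, +oo[ (fun=> 0 : R) t 0.
        by apply: has_deriv_within_of_is_derive; exact: is_derive_const.
      split.
      + by rewrite /du z (_ : (fun s => u s n) = (fun=> 0)) //; apply/funext => s; exact: z.
      + by rewrite z (_ : (fun s => du s n) = (fun=> 0)) //; apply/funext => s; exact: z.
      + by rewrite /op_power /u /du !z !mulr0 !addr0.
    have [h1 h2] : is_derive t 1 (U j) (V j t) /\ is_derive t 1 (V j) (W j t).
      by have [h _ _ _] := HUV j; exact: h.
    split.
    + rewrite /du spreadE //; apply: has_deriv_within_of_is_derive.
      by rewrite /u (_ : (fun s => _) = U j) //; apply/funext => s; rewrite spreadE.
    + rewrite spreadE //; apply: has_deriv_within_of_is_derive.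
      by rewrite /du (_ : (fun s => _) = V j) //; apply/funext => s; rewrite spreadE.
    + rewrite /op_power /u /du !spreadE // mulr1 powR_mulrn; last by rewrite ltW.
      by rewrite /W /d /damping -/(L j); ring.
  exists (fun tau => (4 * delta + 1) * (1 + tau) / 2 + 3); split.
  + move=> tau t0 /=; have : 0 <= delta * tau by rewrite mulr_ge0 // ltW.
    by lra.
  + move=> t1 t2 t10 t12 /=; rewrite lerD2r ler_pM2r //; apply: ler_wpM2l; lra.
  move=> tau tau0.
  pose B j := (2 * delta + 1) * L j * expR ((4 * delta + 1) * (1 + tau) / 2 * L j).
  have bounds j : (forall t, 0 <= t <= tau -> `|U j t| <= B j /\ `|V j t| <= B j) /\
    (forall s t, 0 <= s <= tau -> 0 <= t <= tau ->
    [/\ `|U j s - U j t| <= B j * `|s - t|, `|V j s - V j t| <= B j * `|s - t| &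
        `|U j s - U j t - (s - t) * V j t| <= B j * `|s - t| * `|s - t|]).
    have [h1 h2 _ _] := HUV j.
    exact: (mode_C1_bounds tau delta_gt0 (d0 j) (dL j) (L1' j) c01 h1 h2).
  have wB beta : 4 * beta <= 2 -> forall j,
      ultra_weight lam 1 ((4 * delta + 1) * (1 + tau) / 2 + 3) beta (nn j) * B j ^+ 2 <=
      (2 * delta + 1) ^+ 2 / 2 ^+ j.
    by move=> b2 j; have [l1 l2] := L1 j; exact: mode_weight (ltW tau0) l1 l2 b2 (lexx _).
  have w0 beta n : 0 <= ultra_weight lam 1 ((4 * delta + 1) * (1 + tau) / 2 + 3) beta n.
    by rewrite mulr_ge0 ?powR_ge0 ?expR_ge0.
  have b1 j t : `[0, tau]%classic t -> `|U j t| <= B j /\ `|V j t| <= B j.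
    by rewrite /= in_itv /=; exact: (bounds j).1.
  have b2 j s t : `[0, tau]%classic s -> `[0, tau]%classic t ->
    [/\ `|U j s - U j t| <= B j * `|s - t|, `|V j s - V j t| <= B j * `|s - t| &
        `|U j s - U j t - (s - t) * V j t| <= B j * `|s - t| * `|s - t|].
    by rewrite /= !in_itv /=; exact: (bounds j).2.
  have half : 4 * (1 / 2) <= 2 :> R by lra.
  have zero : 4 * 0 <= 2 :> R by lra.
  split.
    have [h _ _] := C1_in_spread (w0 (1 / 2)) nnS (wB (1 / 2) half) b1 b2.
    exact: h.
  exact: (C1_in_spread (w0 0) nnS (wB 0 zero) b1 b2).
- split.
  + exact: coefficient_Ck_hoelder.
  + exact: coefficient_smooth.
  + by move=> t /(coefficient_gt0 P) ->; exact: coefficient_le1.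
- move=> s r beta hs _.
  split; apply: gevrey_of_decay hs nnS L1' _ => // j; apply: decay;
    have [_ _ h _] := HUV j; apply: le_trans h.
    by rewrite lerDr sqr_ge0.
  by rewrite lerDl sqr_ge0.
move=> t S rho beta t0 hS _.
have [J0 _ HJ0] := inv_scale_archi 0 t0.
have [J1 HJ1] := natr_ge_exists (2 + 4 * t + K * t).
apply: (@not_ultradistribution _ _ _ k alpha _ _ _ _ _ (maxn J0.+1 J1)) => // j.
rewrite geq_max => /andP[jJ0 /HJ1 jJ1].
have jt : 8 / scale R j <= t by apply: le_trans (ltW HJ0); exact: block_end_le.
have [_ _ _ h] := HUV j; apply: le_trans (h t jt).
rewrite ler_pM2r ?invr_gt0 // ler_expR.
have [g1 g2] := grow j; have dj := d0 j.
move: g1 g2; rewrite -/(L j) -/(d j) -/(Gam j) => g1 g2.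
have p0 := powR_ge0 (L j) (critical k alpha * (1 - j.+2%:R^-1)).
have S0 : 0 <= \sum_(0 <= i < j) freq P i by apply: sumr_ge0 => i _; exact: ltW (freq_gt0 P i).
have ej : j.+1%:R = j%:R + 1 :> R by rewrite natr1.
have j0 : 0 <= j%:R :> R by [].
move: g1 g2 p0 S0; rewrite /Kj ej.
move: (L j `^ _) (\sum_(0 <= i < j) freq P i) (Gam j) (d j) dj => Z Sj G dd dd0 g1 g2 Z0 S0.
have Kt : 0 <= K * t by rewrite mulr_ge0 // ltW.
have m1 : (2 + 4 * t) * dd <= j%:R * dd by apply: ler_wpM2r => //; lra.
have m2 : K * t * Sj <= j%:R * Sj by apply: ler_wpM2r => //; lra.
have m3 := mulr_ge0 j0 Z0; have m4 := mulr_ge0 j0 S0; have m5 := mulr_ge0 j0 dd0.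
by lra.
Qed.
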